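(* Let $\Gamma$ be a finite, compact metric graph and let $H$ be a Schr\''odinger operator in $L^2(\Gamma)$ with real-valued potential $q \in L^\infty(\Gamma)$ and local, self-adjoint vertex conditions at the vertices. Assume that $v_1, v_2$ are two distinct vertices of $\Gamma$ such that the vertex conditions of $H$ at $v_1$ and $v_2$ are either both of type III(a), with coefficients $C_{v_1} = C_{v_2} \in \mathbb{R}$, or both of type III(b), with coefficients $D_{v_1} = D_{v_2} \neq 0$. Denote by $\widetilde\Gamma$ the graph obtained from $\Gamma$ by joining $v_1$ and $v_2$ to form one single vertex $v_0$. Let $\widetilde H$ be the self-adjoint Schr\''odinger operator in $L^2(\widetilde\Gamma)$ with potential $q$ having the same vertex conditions as $H$ at all vertices apart from $v_0$ and satisfying, at $v_0$, conditions of the same type as $H$ satisfies at $v_1$ and $v_2$, with coefficient $C_{v_0} := C_{v_1} = C_{v_2}$ or $D_{v_0} := D_{v_1} = D_{v_2}$, respectively. Then the following assertions hold (with $\mathbb{N} = \{1,2,\dots\}$). (i) If the conditions at $v_1, v_2, v_0$ are of type III(a) then $\lambda_k(\widetilde H) \leq \lambda_k(H)$ for all $k \in \mathbb{N}$. (ii) If the conditions at $v_1, v_2, v_0$ are of type III(b) with coefficient $D_{v_0} > 0$ then $\lambda_k(H) \leq \lambda_k(\widetilde H)$ for all $k \in \mathbb{N}$. (iii) If the conditions at $v_1, v_2, v_0$ are of type III(b) with coefficient $D_{v_0} < 0$ then $\lambda_k(\widetilde H) \leq \lambda_k(H)$ for all $k \in \mathbb{N}$.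
   Context: Metric graphs. A finite, compact metric graph $\Gamma$ consists of a finite vertex set $V$, a finite edge set $E$ (loops and multiple edges are allowed) and a length function $L : E \to (0,\infty)$. Each edge $e$ is identified with the interval $[0, L(e)]$; the endpoint $0$ is attached to the initial vertex of $e$ and the endpoint $L(e)$ to its terminal vertex (these coincide if $e$ is a loop). For $v \in V$, $E_{v,\mathrm{i}}$ (resp. $E_{v,\mathrm{t}}$) is the set of edges with initial (resp. terminal) vertex $v$, and $\deg(v) = |E_{v,\mathrm{i}}| + |E_{v,\mathrm{t}}|$. One sets $L^2(\Gamma) = \bigoplus_{e \in E} L^2(0,L(e))$ and $\widetilde H^k(\Gamma) = \bigoplus_{e\in E} H^k(0,L(e))$; $f_e$ denotes the restriction of $f$ to $e$. Boundary vectors. For $v \in V$ fix enumerations $e_1,\dots,e_l$ of $E_{v,\mathrm{i}}$ and $e_{l+1},\dots,e_m$ of $E_{v,\mathrm{t}}$, $m = \deg(v)$, and put $F(v) = (f_{e_1}(0),\dots,f_{e_l}(0), f_{e_{l+1}}(L(e_{l+1})),\dots,f_{e_m}(L(e_m)))^\top$ and $F'(v) = (f'_{e_1}(0),\dots,f'_{e_l}(0), -f'_{e_{l+1}}(L(e_{l+1})),\dots,-f'_{e_m}(L(e_m)))^\top$, with components $F_j(v)$, $F_j'(v)$. Operators. Local, self-adjoint vertex conditions at $v$ are given by orthogonal projections $P_{v,\mathrm D}, P_{v,\mathrm N}, P_{v,\mathrm R}$ in $\mathbb{C}^{\deg(v)}$ with mutually orthogonal ranges and sum $I$, and a self-adjoint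 invertible operator $\Lambda_v$ in $\operatorname{ran} P_{v,\mathrm R}$; the conditions read $P_{v,\mathrm D}F(v) = 0$, $P_{v,\mathrm N}F'(v) = 0$, $P_{v,\mathrm R}F'(v) = \Lambda_v P_{v,\mathrm R}F(v)$. The Schr\''odinger operator with real-valued potential $q \in L^\infty(\Gamma)$ and such conditions at every vertex is the self-adjoint operator $H$ in $L^2(\Gamma)$ with $(Hf)_e = -f_e'' + q_e f_e$ for $e\in E$, whose domain consists of all $f \in \widetilde H^2(\Gamma)$ satisfying the conditions at each $v \in V$. Its spectrum is purely discrete and bounded from below; $\lambda_1(H) \le \lambda_2(H) \le \dots$ denote its eigenvalues in non-decreasing order, counted with multiplicities. Type III conditions at $v$. Let $d = \deg(v)$, let $\mathcal{P}_d$ be the orthogonal projection in $\mathbb{C}^d$ onto $\operatorname{span}\{(1,\dots,1)^\top\}$ and $\mathcal{Q}_d = I - \mathcal{P}_d$. - Type III(a) with real coefficient $C_v \neq 0$: $P_{v,\mathrm R} = \mathcal{Q}_d$, $P_{v,\mathrm D} = \mathcal{P}_d$, $P_{v,\mathrm N} = 0$, $\Lambda_v$ = multiplication by $C_v$; i.e. $\sum_{j=1}^d F_j(v) = 0$ and $F_j'(v) - F_k'(v) = C_v(F_j(v) - F_k(v))$ for all $j,k \in \{1,\dots,d\}$. - Type III(b) with real coefficient $D_v \neq 0$: $P_{v,\mathrm R} = \mathcal{Q}_d$, $P_{v,\mathrm D} = 0$, $P_{v,\mathrm N} = \mathcal{P}_d$, $\Lambda_v$ = multiplication by $1/D_v$;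 i.e. $\sum_{j=1}^d F_j'(v) = 0$ and $F_j(v) - F_k(v) = D_v(F_j'(v) - F_k'(v))$ for all $j,k \in \{1,\dots,d\}$. Joining vertices. Two vertices $v_1, v_2$ of $\Gamma$ are joined to one vertex $v_0$ if $v_1$ and $v_2$ are removed from $V$ and, instead, a vertex $v_0$ with $E_{v_0,\mathrm i} := E_{v_1,\mathrm i} \cup E_{v_2,\mathrm i}$ and $E_{v_0,\mathrm t} := E_{v_1,\mathrm t} \cup E_{v_2,\mathrm t}$ is introduced. The edge set and edge lengths are unchanged, so $L^2(\Gamma)$ and $L^2(\widetilde\Gamma)$ are identified. *)

(* Defs.v *)
From HB Require Import structures.
From mathcomp Require Import all_boot all_order all_algebra.
From mathcomp Require Import all_classical all_reals all_analysis.
From mathcomp Require Import complex.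

Set Implicit Arguments.
Unset Strict Implicit.
Unset Printing Implicit Defensive.

Import Order.TTheory GRing.Theory Num.Theory.
Import numFieldNormedType.Exports.

Local Open Scope classical_set_scope.
Local Open Scope ring_scope.
Local Open Scope complex_scope.
Local Open Scope sesquilinear_scope.

(* [Ei v] and [Et v] are the enumerations of the edges with initial, resp.
   terminal, vertex [v] with respect to which boundary vectors are written;
   a loop at [v] occurs in both. *)
Record metric_graph (R : realType) := MetricGraph {
  vert : finType;
  edge : finType;
  init : edge -> vert;
  term : edge -> vert;
  len : edge -> R;
  len_gt0 : forall e, 0 < len e;
  Ei : vert -> seq edge;
  Et : vert -> seq edge;
  Ei_uniq : forall v, uniq (Ei v);
  Et_uniq : forall v, uniq (Et v);
  mem_Ei : forall v e, (e \in Ei v) = (init e == v);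
  mem_Et : forall v e, (e \in Et v) = (term e == v)
}.

Definition deg (R : realType) (G : metric_graph R) (v : vert G) : nat :=
  (size (Ei v) + size (Et v))%N.

(* Complex-valued functions on a graph: only the values of [f e] on
   [0, len e] are meaningful. *)
Definition gfun (R : realType) (G : metric_graph R) := edge G -> R -> R[i].

Definition L2eq (R : realType) (G : metric_graph R) (f g : gfun G) : Prop :=
  forall e, {ae @lebesgue_measure R, forall x, x \in `[0, len e] ->
    f e x = g e x}.

(* [f] is absolutely continuous on [0, l] with a.e. derivative [g]. *)
Definition ac_deriv (R : realType) (l : R) (f g : R -> R) : Prop :=
  (@lebesgue_measure R).-integrable `[0, l] (EFin \o g) /\
  forall x, x \in `[0, l] ->
    f x = f 0 + \int[@lebesgue_measure R]_(t in `[0, x]) g t.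

Definition cac_deriv (R : realType) (l : R) (f g : R -> R[i]) : Prop :=
  ac_deriv l (fun x => complex.Re (f x)) (fun x => complex.Re (g x)) /\
  ac_deriv l (fun x => complex.Im (f x)) (fun x => complex.Im (g x)).

Definition L2fun (R : realType) (l : R) (f : R -> R[i]) : Prop :=
  ((fun x => complex.Re (f x)) \_ `[0, l] \in Lfun (@lebesgue_measure R) 2%:E) /\
  ((fun x => complex.Im (f x)) \_ `[0, l] \in Lfun (@lebesgue_measure R) 2%:E).

(* [f] is the C^1 representative of an element of H^2(0, l), [f1] the continuous
   representative of f' (so that boundary values make sense) and [f2] a
   representative of f''. *)
Definition H2 (R : realType) (l : R) (f f1 f2 : R -> R[i]) : Prop :=
  [/\ cac_deriv l f f1, cac_deriv l f1 f2 & L2fun l f2].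

Definition bvec (R : realType) (G : metric_graph R) (f : gfun G) (v : vert G) :
    'cV[R[i]]_(deg v) :=
  col_mx (\col_(j < size (Ei v)) f (tnth (in_tuple (Ei v)) j) 0)
         (\col_(j < size (Et v)) let e := tnth (in_tuple (Et v)) j in
                                 f e (len e)).

Definition bvec' (R : realType) (G : metric_graph R) (f1 : gfun G)
    (v : vert G) : 'cV[R[i]]_(deg v) :=
  col_mx (\col_(j < size (Ei v)) f1 (tnth (in_tuple (Ei v)) j) 0)
         (\col_(j < size (Et v)) let e := tnth (in_tuple (Et v)) j in
                                 - f1 e (len e)).

(* An operator in ran [PR] is encoded by its extension by zero to the orthogonal
   complement of ran [PR]; [Lam_inv] says that it is invertible in ran [PR]. *)
Record vertex_cond (R : realType) (d : nat) := VertexCond {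
  PD : 'M[R[i]]_d;
  PN : 'M[R[i]]_d;
  PR : 'M[R[i]]_d;
  Lam : 'M[R[i]]_d;
  PD_herm : PD \is hermsymmx;
  PN_herm : PN \is hermsymmx;
  PR_herm : PR \is hermsymmx;
  PD_idem : PD *m PD = PD;
  PN_idem : PN *m PN = PN;
  PR_idem : PR *m PR = PR;
  PDN_orth : PD ^t* *m PN = 0;
  PDR_orth : PD ^t* *m PR = 0;
  PNR_orth : PN ^t* *m PR = 0;
  P_sum : PD + PN + PR = 1%:M;
  Lam_ran : PR *m Lam *m PR = Lam;
  Lam_herm : Lam \is hermsymmx;
  Lam_inv : exists M : 'M[R[i]]_d,
    [/\ PR *m M *m PR = M, Lam *m M = PR & M *m Lam = PR]
}.

Definition satisfies (R : realType) (d : nat) (K : vertex_cond R d)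
    (F F' : 'cV[R[i]]_d) : Prop :=
  [/\ PD K *m F = 0, PN K *m F' = 0 & PR K *m F' = Lam K *m (PR K *m F)].

(* The orthogonal projection onto the span of (1, ..., 1)^T. *)
Definition Pones (R : realType) (d : nat) : 'M[R[i]]_d :=
  const_mx (d%:R^-1).

Definition Qones (R : realType) (d : nat) : 'M[R[i]]_d := 1%:M - Pones R d.

Definition typeIIIa (R : realType) (d : nat) (K : vertex_cond R d) (C : R) :
    Prop :=
  C != 0 /\
  [/\ PR K = Qones R d, PD K = Pones R d, PN K = 0 & Lam K = C%:C *: PR K].

Definition typeIIIb (R : realType) (d : nat) (K : vertex_cond R d) (D : R) :
    Prop :=
  D != 0 /\
  [/\ PR K = Qones R d, PD K = 0, PN K = Pones R d & Lam K = (D^-1)%:C *: PR K].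

Definition potential (R : realType) (G : metric_graph R)
    (q : edge G -> R -> R) : Prop :=
  forall e, q e \_ `[0, len e] \in Lfun (@lebesgue_measure R) +oo%E.

(* Graph of the operator: [f] is in the domain and [H f = g] in L^2. *)
Definition schroedinger (R : realType) (G : metric_graph R)
    (q : edge G -> R -> R) (K : forall v : vert G, vertex_cond R (deg v))
    (f g : gfun G) : Prop :=
  exists f1 f2 : gfun G,
    [/\ forall e, H2 (len e) (f e) (f1 e) (f2 e),
        forall v, satisfies (K v) (bvec f v) (bvec' f1 v)
      & L2eq g (fun e x => - f2 e x + (q e x)%:C * f e x)].

Definition in_eigenspace (R : realType) (G : metric_graph R)
    (H : gfun G -> gfun G -> Prop) (mu : R) (f : gfun G) : Prop :=
  H f (fun e x => mu%:C * f e x).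

Definition lincomb (R : realType) (G : metric_graph R) (n : nat)
    (c : 'I_n -> R[i]) (phi : 'I_n -> gfun G) : gfun G :=
  fun e x => \sum_(i < n) c i * phi i e x.

(* [dim ker (H - mu) = n], as a complex subspace of L^2; for [n = 0] this says
   that [mu] is not an eigenvalue. *)
Definition has_multiplicity (R : realType) (G : metric_graph R)
    (H : gfun G -> gfun G -> Prop) (mu : R) (n : nat) : Prop :=
  exists phi : 'I_n -> gfun G,
    [/\ forall i, in_eigenspace H mu (phi i),
        forall c : 'I_n -> R[i],
          L2eq (lincomb c phi) (fun _ _ => 0) -> forall i, c i = 0
      & forall f, in_eigenspace H mu f ->
          exists c : 'I_n -> R[i], L2eq f (lincomb c phi)].

(* [lam 0 <= lam 1 <= ...] lists the eigenvalues of [H], each repeated according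
   to its multiplicity; thus [lam k] is the (k+1)-st eigenvalue. *)
Definition eigenvalue_enum (R : realType) (G : metric_graph R)
    (H : gfun G -> gfun G -> Prop) (lam : nat -> R) : Prop :=
  (forall j k : nat, (j <= k)%N -> lam j <= lam k) /\
  (forall mu : R, exists n : nat,
     has_multiplicity H mu n /\ ([set k | lam k = mu] #= `I_n)%card).

Section join.
Context (R : realType) (G : metric_graph R) (v1 v2 : vert G).
Hypothesis v12 : v1 != v2.

(* [None] is the new vertex; [insub] sends v1 and v2 to it. *)
Definition join_vert : finType := option {w : vert G | w \notin [:: v1; v2]}.

Definition join_Ei (v : join_vert) : seq (edge G) :=
  if v is Some w then Ei (val w) else Ei v1 ++ Ei v2.

Definition join_Et (v : join_vert) : seq (edge G) :=
  if v is Some w then Et (val w) else Et v1 ++ Et v2.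

Lemma join_Ei_uniq v : uniq (join_Ei v).
Proof.
case: v => [w|] /=; first exact: Ei_uniq.
rewrite cat_uniq !Ei_uniq andbT /=; apply/hasPn => e.
by rewrite !mem_Ei => /eqP ->; rewrite eq_sym.
Qed.

Lemma join_Et_uniq v : uniq (join_Et v).
Proof.
case: v => [w|] /=; first exact: Et_uniq.
rewrite cat_uniq !Et_uniq andbT /=; apply/hasPn => e.
by rewrite !mem_Et => /eqP ->; rewrite eq_sym.
Qed.

Lemma insub_join (u : vert G) (v : join_vert) :
  (insub u == v) =
    if v is Some w then u == val w else (u == v1) || (u == v2).
Proof.
case: v => [w|]; case: insubP => [x xP xu|].
- by rewrite -xu.
- move=> /negP uN; apply/esym/negbTE/eqP => uw; apply: uN.
  by rewrite uw (valP w).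
- by move: xP; rewrite !inE => /negbTE ->.
- by rewrite negbK !inE => ->.
Qed.

Lemma mem_join_Ei v e : (e \in join_Ei v) = (insub (init e) == v).
Proof. by rewrite insub_join; case: v => [w|]; rewrite /= ?mem_cat !mem_Ei. Qed.

Lemma mem_join_Et v e : (e \in join_Et v) = (insub (term e) == v).
Proof. by rewrite insub_join; case: v => [w|]; rewrite /= ?mem_cat !mem_Et. Qed.

(* For [Some w] the enumerations, hence the degree and the boundary vectors,
   are definitionally those of [val w] in [G]. *)
Definition join : metric_graph R :=
  @MetricGraph R join_vert (edge G) (fun e => insub (init e))
    (fun e => insub (term e)) (@len R G) (@len_gt0 R G) join_Ei join_Et
    join_Ei_uniq join_Et_uniq mem_join_Ei mem_join_Et.

End join.

Section Pones_facts.
Context (R : realType) (d : nat).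

Fact Pones_herm : Pones R d \is hermsymmx.
Proof.
apply/is_hermitianmxP; rewrite expr0 scale1r.
by apply/matrixP => i j; rewrite !mxE fmorphV rmorph_nat.
Qed.

Fact Pones_idem : Pones R d *m Pones R d = Pones R d.
Proof.
apply/matrixP => i j; rewrite !mxE.
under eq_bigr do rewrite !mxE.
rewrite sumr_const card_ord -[LHS]mulr_natr -mulrA mulVf ?mulr1//.
by rewrite pnatr_eq0; case: (d) i => [[]|].
Qed.

Fact Pones_range (F : 'cV[R[i]]_d) :
  Pones R d *m F = F <-> exists c : R[i], F = const_mx c.
Proof.
split=> [<-|[c ->]].
  exists (\sum_j d%:R^-1 * F j 0); apply/matrixP => i j; rewrite !mxE ord1.
  by apply: eq_bigr => k _; rewrite !mxE.
apply/matrixP => i j; rewrite !mxE.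
under eq_bigr do rewrite !mxE.
rewrite sumr_const card_ord -[LHS]mulr_natr mulrAC mulVf ?mul1r//.
by rewrite pnatr_eq0; case: (d) i => [[]|].
Qed.

End Pones_facts.

(* Main.v *)
Require Import Defs.
From mathcomp Require Import all_boot all_order all_algebra.
From mathcomp Require Import all_classical all_reals all_analysis.
From mathcomp Require Import complex.
From mathcomp Require Import measurable_realfun ess_sup_inf ring lra.

(* Let h and h~ be the quadratic forms of H and H~. For type III(a) the form
   domain of h~ contains that of h and h~ extends h; for type III(b) the form
   domains agree and h~ - h is 1/D times a nonnegative term, the defect in
   |s1 + s2|^2/(d1 + d2) <= |s1|^2/d1 + |s2|^2/d2, where s1, s2 are the sums of the
   boundary values at v1, v2. The assertions follow from the min-max principle.

   The lower bound in the min-max principle is proved without compactness or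
   spectral theory. Cut every edge into n cells. For n large, h - nu is bounded
   below by the L^2 norm on the functions with vanishing cell averages. Hence the
   map (u(0), u'(0), c) |-> (vertex conditions, cell averages), on the solutions of
   -u'' + q u = nu u + (step function with values c), is injective, thus bijective
   since both sides have dimension (2 + n)|E|. So each f in the form domain is
   u + g, with u in the operator domain, (H - nu) u a step function, and g without
   cell averages; this is orthogonal for h - nu, the form on the u's is a Hermitian
   matrix, and the kernel of that matrix consists of eigenfunctions. Consequently
   the number of min-max values equal to nu is at most the multiplicity of nu. *)

Set Implicit Arguments.
Unset Strict Implicit.
Unset Printing Implicit Defensive.

Import Order.TTheory GRing.Theory Num.Theory.
Import numFieldNormedType.Exports.
Local Open Scope ring_scope.

Local Open Scope classical_set_scope.

(** * Primitives of bounded measurable functions *)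

(** Functions are taken Lipschitz, as primitives of bounded measurable functions, instead of H^1.
    Once [q] is replaced by a bounded representative, this class contains all eigenfunctions and all
    solutions used as trial vectors, and products are integrable in it without L^2 theory; both
    min-max inequalities are proved on this class directly, without passing to a completion. The
    cells work because (H - nu) u is a step function: paired with any f, it sees f only through the
    cell integrals of f. This one fact gives the injectivity (a solution without cell averages has
    h(u,u) = nu |u|^2, against coercivity), the orthogonality of u and g, and the Hermitian matrix.
    About the given list of eigenvalues only its order and its multiplicities are known, so the hard
    inequality is a count. A margin of 1 in the coercivity and the finiteness of the matrix leave a
    gap on both sides of [nu]; this makes the count possible although the infima are not known to be
    attained. *)

Section BoundedMeasurable.
Context {R : realType}.
Implicit Types (l a b c x y : R) (f g : R -> R).

(** The bound holds at every point of [0, l], not almost everywhere, so that no exceptional sets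
    occur before the spectrum itself is treated. *)
Definition bmeas l f : Prop :=
  measurable_fun (`[0, l]%classic : set R) f /\
  exists M : R, forall x, 0 <= x <= l -> `|f x| <= M.

Definition itg a b f : R := \int[@lebesgue_measure R]_(t in `[a, b]) f t.

Lemma bmeas_integrable l f a b : bmeas l f -> 0 <= a -> b <= l ->
  (@lebesgue_measure R).-integrable `[a, b] (EFin \o f).
Proof.
move=> [mf [M fM]] a0 bl.
have sub : (`[a, b]%classic : set R) `<=` `[0, l]%classic.
  by apply: subset_itv; rewrite bnd_simp.
refine (@integrableS _ _ R lebesgue_measure `[0, l]%classic `[a, b]%classic
  (EFin \o f) _ _ sub _) => //.
apply: measurable_bounded_integrable => //.
- exact: (compact_finite_measure (@segment_compact _ _ _)).
- exists M; split; first exact: num_real.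
  move=> x Mx y /=; rewrite in_itv/= => yl.
  exact/ltW/(le_lt_trans (fM _ yl)).
Qed.

Lemma bmeas_cst l c : bmeas l (fun=> c).
Proof. by split; [exact: measurable_cst | exists `|c|]. Qed.

Lemma bmeasD l f g : bmeas l f -> bmeas l g -> bmeas l (fun x => f x + g x).
Proof.
move=> [mf [M fM]] [mg [N gN]]; split; first exact: measurable_funD.
exists (M + N) => x xl; rewrite (le_trans (ler_normD _ _))// lerD//; auto.
Qed.

Lemma bmeasM l f g : bmeas l f -> bmeas l g -> bmeas l (fun x => f x * g x).
Proof.
move=> [mf [M fM]] [mg [N gN]]; split; first exact: measurable_funM.
by exists (M * N) => x xl; rewrite normrM ler_pM//; auto.
Qed.

Lemma bmeasZ l c f : bmeas l f -> bmeas l (fun x => c * f x).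
Proof. by move=> bf; apply: bmeasM => //; exact: bmeas_cst. Qed.

Lemma bmeasN l f : bmeas l f -> bmeas l (fun x => - f x).
Proof.
move=> [mf [M fM]]; split; first exact: measurableT_comp.
by exists M => x xl; rewrite normrN; exact: fM.
Qed.

Lemma bmeasB l f g : bmeas l f -> bmeas l g -> bmeas l (fun x => f x - g x).
Proof. by move=> bf bg; apply: bmeasD => //; exact: bmeasN. Qed.

Lemma bmeas_norm l f : bmeas l f -> bmeas l (fun x => `|f x|).
Proof.
move=> [mf [M fM]]; split; first exact: measurableT_comp.
by exists M => x xl; rewrite normr_id; exact: fM.
Qed.

Lemma bmeas_sum (I : Type) (r : seq I) (P : pred I) l (F : I -> R -> R) :
  (forall i, P i -> bmeas l (F i)) ->
  bmeas l (fun x => \sum_(i <- r | P i) F i x).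
Proof.
move=> bF; elim: r => [|i r IH].
  by under eq_fun do rewrite big_nil; exact: bmeas_cst.
under eq_fun do rewrite big_cons.
by case: (boolP (P i)) => // Pi; apply: bmeasD => //; exact: bF.
Qed.

Lemma bmeas_indic_itv l a b : bmeas l (\1_(`[a, b[%classic : set R) : R -> R).
Proof.
split; first exact: (measurable_funTS (measurable_indic _)).
by exists 1 => x _; rewrite indicE; case: (_ \in _); rewrite ?normr1 ?normr0.
Qed.

Lemma eq_bmeas l f g : (forall x, 0 <= x <= l -> f x = g x) ->
  bmeas l f -> bmeas l g.
Proof.
move=> fg [mf [M fM]]; split.
  by apply: (eq_measurable_fun f) => // x; rewrite inE/= in_itv/= => /fg.
by exists M => x xl; rewrite -fg//; exact: fM.
Qed.

Lemma eq_itg a b f g : (forall x, a <= x <= b -> f x = g x) ->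
  itg a b f = itg a b g.
Proof.
by move=> fg; apply: eq_Rintegral => x; rewrite inE/= in_itv/=; exact: fg.
Qed.

Lemma itgD l a b f g : 0 <= a -> b <= l -> bmeas l f -> bmeas l g ->
  itg a b (fun x => f x + g x) = itg a b f + itg a b g.
Proof. by move=> *; rewrite /itg RintegralD//; exact: (@bmeas_integrable l). Qed.

Lemma itgZ l a b c f : 0 <= a -> b <= l -> bmeas l f ->
  itg a b (fun x => c * f x) = c * itg a b f.
Proof. by move=> *; rewrite /itg RintegralZl//; exact: (@bmeas_integrable l). Qed.

Lemma itgN l a b f : 0 <= a -> b <= l -> bmeas l f ->
  itg a b (fun x => - f x) = - itg a b f.
Proof.
move=> a0 bl bf; rewrite -mulN1r -(itgZ _ a0 bl bf).
by apply: eq_itg => x _; rewrite mulN1r.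
Qed.

Lemma itgB l a b f g : 0 <= a -> b <= l -> bmeas l f -> bmeas l g ->
  itg a b (fun x => f x - g x) = itg a b f - itg a b g.
Proof. by move=> *; rewrite /itg RintegralB//; exact: (@bmeas_integrable l). Qed.

Lemma itg_cst a b c : a <= b -> itg a b (fun=> c) = c * (b - a).
Proof.
move=> ab; rewrite /itg Rintegral_cst//= lebesgue_measure_itv/= lte_fin.
by move: ab; rewrite le_eqVlt => /predU1P[->|->//]; rewrite ltxx subrr.
Qed.

Lemma le_itg l a b f g : 0 <= a -> b <= l -> bmeas l f -> bmeas l g ->
  (forall x, a <= x <= b -> f x <= g x) -> itg a b f <= itg a b g.
Proof.
move=> a0 bl bf bg fg; apply: le_Rintegral => //; try exact: (@bmeas_integrable l).
Qed.

Lemma itg_ge0 a b f : (forall x, a <= x <= b -> 0 <= f x) -> 0 <= itg a b f.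
Proof. by move=> f0; apply: Rintegral_ge0 => x /=; rewrite in_itv/= => /f0. Qed.

Lemma norm_itg l a b f : 0 <= a -> b <= l -> bmeas l f ->
  `|itg a b f| <= itg a b (fun x => `|f x|).
Proof. by move=> *; apply: le_normr_Rintegral => //; exact: (@bmeas_integrable l). Qed.

Lemma norm_itg_le l a b f c : 0 <= a -> a <= b -> b <= l -> bmeas l f ->
  (forall x, a <= x <= b -> `|f x| <= c) -> `|itg a b f| <= c * (b - a).
Proof.
move=> a0 ab bl bf fc; apply: (le_trans (norm_itg a0 bl bf)).
rewrite -itg_cst//; apply: (le_itg a0 bl) => //; [exact: bmeas_norm | exact: bmeas_cst].
Qed.

Lemma itg_split l a b c f : 0 <= a -> a <= b -> b <= c -> c <= l -> bmeas l f ->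
  itg a c f = itg a b f + itg b c f.
Proof.
move=> a0 ab bc cl bf.
have := @Rintegral_itvB R f (BLeft a) (BRight c) b.
rewrite !bnd_simp => /(_ (bmeas_integrable bf a0 cl) ab bc) H.
apply/eqP; rewrite addrC -subr_eq; apply/eqP.
rewrite /itg H Rintegral_itv_obnd_cbnd//.
apply: (integrableS _ _ _ (bmeas_integrable bf (le_trans a0 ab) cl)) => //.
by apply: subset_itvr; rewrite bnd_simp.
Qed.

Lemma itg_aa a f : itg a a f = 0.
Proof. by rewrite /itg set_itv1 Rintegral_set1. Qed.

Lemma subset_le_itg l a b a' b' f : 0 <= a' -> a' <= a -> a <= b -> b <= b' -> b' <= l ->
  bmeas l f -> (forall x, 0 <= f x) -> itg a b f <= itg a' b' f.
Proof.
move=> a0 aa ab bb bl bf f0.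
rewrite (itg_split a0 aa (le_trans ab bb) bl bf).
rewrite (itg_split (le_trans a0 aa) ab bb bl bf).
by rewrite addrCA lerDl addr_ge0// itg_ge0.
Qed.

(** Cells are half-open, to be disjoint, while [itg] uses closed intervals; the endpoint is a null
    set. *)
Lemma itg_indic l a b f : 0 <= a -> a <= b -> b <= l -> bmeas l f ->
  itg 0 l (fun x => (\1_(`[a, b[%classic : set R) x : R) * f x) = itg a b f.
Proof.
move=> a0 ab bl bf.
rewrite -[RHS]Rintegral_itv_bndo_bndc; last first.
  apply: (integrableS _ _ _ (bmeas_integrable bf a0 bl)) => //.
  by apply: subset_itvl; rewrite bnd_simp.
have sab : (`[0, l] `&` `[a, b[)%classic = `[a, b[%classic :> set R.
  apply/setIidr => x /=; rewrite !in_itv/= => /andP[ax xb].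
  by rewrite (le_trans a0 ax) (le_trans (ltW xb) bl).
rewrite -[in RHS]sab Rintegral_mkcondr; apply: eq_itg => x _.
by rewrite patchE indicE; case: ifP => _; rewrite ?mul1r ?mul0r.
Qed.

(** Cauchy-Schwarz against the constant 1: integrate (f - t)^2 >= 0 for [t] the mean value of
    [f]. *)
Lemma sqr_itg_le l a b f : 0 <= a -> a < b -> b <= l -> bmeas l f ->
  itg a b f ^+ 2 <= (b - a) * itg a b (fun x => f x ^+ 2).
Proof.
move=> a0 ab bl bf; have d0 : 0 < b - a by rewrite subr_gt0.
have bf2 : bmeas l (fun x => f x ^+ 2) by exact: bmeasM.
pose t := itg a b f / (b - a).
have : 0 <= itg a b (fun x => (f x - t) ^+ 2) by apply: itg_ge0 => x _; exact: sqr_ge0.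
have -> : itg a b (fun x => (f x - t) ^+ 2) =
    itg a b (fun x => f x ^+ 2 - (2 * t * f x - t ^+ 2)).
  by apply: eq_itg => x _; ring.
have bc := bmeas_cst l (t ^+ 2).
have bl2 := bmeasZ (2 * t) bf.
rewrite (itgB a0 bl bf2 (bmeasB bl2 bc)) (itgB a0 bl bl2 bc) (itgZ _ a0 bl bf).
rewrite (itg_cst _ (ltW ab)) subr_ge0 => H.
have -> : itg a b f ^+ 2 =
  (b - a) * (2 * t * itg a b f - t ^+ 2 * (b - a)) by rewrite /t; field; rewrite gt_eqF.
by rewrite ler_pM2l.
Qed.

(** Over [n] equal steps the increments add up to at most n K (x/n)^2 = K x^2 / n, which tends to 0.
    This spares the product rule any differentiation almost everywhere. *)
Lemma quadratic_mod_cst (l K : R) (F : R -> R) : 0 <= l ->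
  (forall x y, 0 <= x -> x <= y -> y <= l -> `|F y - F x| <= K * (y - x) ^+ 2) ->
  forall x, 0 <= x <= l -> F x = F 0.
Proof.
move=> l0 HF x /andP[x0 xl].
have step n : (0 < n)%N -> `|F x - F 0| <= K * x ^+ 2 / n%:R.
  move=> n0; have n0' : (0 : R) < n%:R by rewrite ltr0n.
  have H k : (k <= n)%N -> `|F (x * k%:R / n%:R) - F 0| <= k%:R * (K * (x / n%:R) ^+ 2).
    elim: k => [|k IH] kn; first by rewrite mulr0 mul0r subrr normr0 mul0r.
    rewrite -(subrKA (F (x * k%:R / n%:R))) (le_trans (ler_normD _ _))//.
    rewrite -natr1 mulrDl mul1r addrC lerD ?IH// 1?ltnW//.
    have -> : x / n%:R = x * (k%:R + 1) / n%:R - x * k%:R / n%:R by field; rewrite gt_eqF.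
    apply: HF.
    - by rewrite divr_ge0// ?mulr_ge0.
    - by rewrite ler_pM2r ?invr_gt0// ler_wpM2l// lerDl.
    - rewrite natr1 (le_trans _ xl)// -mulrA ler_piMr// ler_pdivrMr// mul1r ler_nat//.
  have := H n (leqnn n); rewrite mulfK ?gt_eqF// => /le_trans; apply.
  by rewrite le_eqVlt; apply/orP; left; apply/eqP; field; rewrite gt_eqF.
apply/eqP; rewrite -subr_eq0 -normr_le0; apply/ler_addgt0Pr => e e0; rewrite add0r.
pose n := (Num.truncn (K * x ^+ 2 / e)).+1.
apply: (le_trans (step n _)) => //.
rewrite ler_pdivrMr ?ltr0n// [e * _]mulrC -ler_pdivrMr//.
exact/ltW/truncnS_gt.
Qed.

End BoundedMeasurable.

(** * Lipschitz functions as primitives *)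

Section Primitive.
Context {R : realType}.
Implicit Types (l a b c x y : R) (f g : R -> R).

(** A derivative [g] is part of the data, because [f] determines it only up to a null set; functions
    on the graph later carry their derivative along for the same reason. *)
Definition prim l f g : Prop :=
  bmeas l g /\ forall x, 0 <= x <= l -> f x = f 0 + itg 0 x g.

Lemma prim_sub l f g x y : prim l f g -> 0 <= x -> x <= y -> y <= l ->
  f y - f x = itg x y g.
Proof.
move=> [bg fg] x0 xy yl.
rewrite fg ?(le_trans x0 xy)// [f x]fg ?x0 ?(le_trans xy yl)//.
by rewrite (itg_split _ x0 xy yl bg)//; ring.
Qed.

Lemma prim_lip l f g : 0 <= l -> prim l f g -> exists2 K : R, 0 <= K &
  forall x y, 0 <= x -> x <= y -> y <= l -> `|f y - f x| <= K * (y - x).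
Proof.
move=> l0 fg; have [[mg [M gM]] _] := fg; exists M.
  by rewrite (le_trans (normr_ge0 (g 0)))// gM// lexx.
move=> x y x0 xy yl; rewrite (prim_sub fg x0 xy yl).
apply: (norm_itg_le x0 xy yl); first by case: fg.
by move=> z /andP[xz zy]; rewrite gM// (le_trans x0 xz) (le_trans zy yl).
Qed.

Lemma prim_bmeas l f g : 0 <= l -> prim l f g -> bmeas l f.
Proof.
move=> l0 fg; have [K K0 fK] := prim_lip l0 fg; split; last first.
  exists (`|f 0| + K * l) => x /andP[x0 xl].
  rewrite -[f x](subrK (f 0)) addrC (le_trans (ler_normD _ _))// lerD2l.
  by rewrite (le_trans (fK 0 x _ x0 xl))// subr0 ler_wpM2l.
(* [f] is controlled on [0, l] only; composed with the projection [cl] onto that interval it becomes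
   globally Lipschitz, hence continuous and measurable. *)
pose cl x := Num.max 0 (Num.min x l).
have cl0 x : 0 <= cl x by rewrite le_max lexx.
have cll x : cl x <= l by rewrite ge_max l0 ge_min lexx orbT.
have clid x : 0 <= x <= l -> cl x = x by move=> /andP[x0 xl]; rewrite /cl min_l ?max_r.
apply: (eq_measurable_fun (f \o cl)).
  by move=> x; rewrite inE/= in_itv/= => /clid ->.
apply: measurable_funTS; apply: continuous_measurable_fun.
have clip x y : x <= y -> 0 <= cl y - cl x <= y - x.
  move=> xy; rewrite /cl; case: (leP x l) => ?; case: (leP y l) => ?;
    case: (leP 0 x) => ?; case: (leP 0 y) => ?; case: (leP 0 l) => ?;
    apply/andP; split; lra.
have flip x y : x <= y -> `|f (cl y) - f (cl x)| <= K * (y - x).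
  move=> xy; have /andP[h1 h2] := clip x y xy.
  apply: le_trans (ler_wpM2l K0 h2); apply: fK => //.
  by rewrite -subr_ge0.
move=> x; apply/cvgrPdist_le => e e0.
have K1 : 0 < K + 1 by rewrite ltr_wpDl.
near=> y.
have xy : `|x - y| <= e / (K + 1).
  near: y; apply: (@cvgr_dist_le _ R^o) => //.
  by rewrite divr_gt0.
have : K * `|x - y| <= e.
  rewrite (le_trans (ler_wpM2l K0 xy))// mulrCA ger_pMr// ler_pdivrMr// mul1r.
  by rewrite lerDl.
move=> /= ; case: (leP x y) => h.
  apply: le_trans; rewrite distrC (le_trans (flip _ _ h))//.
  by rewrite distrC ger0_norm ?subr_ge0.
apply: le_trans; rewrite (le_trans (flip _ _ (ltW h)))//.
by rewrite ger0_norm ?subr_ge0// ltW.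
Unshelve. all: by end_near. Qed.

Lemma prim_itg l a g : bmeas l g -> prim l (fun x => a + itg 0 x g) g.
Proof. by move=> bg; split=> // x _; rewrite itg_aa addr0. Qed.

Lemma prim_cst l a : prim l (fun=> a) (fun=> 0).
Proof.
split; first exact: bmeas_cst.
by move=> x /andP[x0 _]; rewrite itg_cst// mul0r addr0.
Qed.

Lemma primD l f g f' g' : prim l f f' -> prim l g g' ->
  prim l (fun x => f x + g x) (fun x => f' x + g' x).
Proof.
move=> [bf ff] [bg gg]; split; first exact: bmeasD.
move=> x xl; have /andP[x0 xl'] := xl.
by rewrite (itgD (lexx 0) xl' bf bg) ff// gg//; ring.
Qed.

Lemma primN l f f' : prim l f f' -> prim l (fun x => - f x) (fun x => - f' x).
Proof.
move=> [bf ff]; split; first exact: bmeasN.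
move=> x xl; have /andP[x0 xl'] := xl.
by rewrite (itgN (lexx 0) xl' bf) ff//; ring.
Qed.

Lemma primB l f g f' g' : prim l f f' -> prim l g g' ->
  prim l (fun x => f x - g x) (fun x => f' x - g' x).
Proof. by move=> pf pg; apply: primD => //; exact: primN. Qed.

Lemma eq_prim l f g f' g' : (forall x, 0 <= x <= l -> f x = g x) ->
  (forall x, 0 <= x <= l -> f' x = g' x) -> prim l f f' -> prim l g g'.
Proof.
move=> fg fg' [bf ff]; split; first exact: (eq_bmeas fg').
move=> x xl; have /andP[x0 xl'] := xl.
rewrite -fg// -fg ?lexx ?(le_trans x0 xl')// ff//; congr (_ + _).
by apply: eq_itg => y /andP[y0 yx]; rewrite fg'// y0 (le_trans yx xl').
Qed.

(* The increments of [f g - int (f' g + f g')] are [O((y - x)^2)], because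
   [f] and [g] are Lipschitz. *)
Lemma primM l f g f' g' : 0 <= l -> prim l f f' -> prim l g g' ->
  prim l (fun x => f x * g x) (fun x => f' x * g x + f x * g' x).
Proof.
move=> l0 pf pg; have [bf' _] := pf; have [bg' _] := pg.
have bf := prim_bmeas l0 pf; have bg := prim_bmeas l0 pg.
have bd : bmeas l (fun x => f' x * g x + f x * g' x).
  by apply: bmeasD; exact: bmeasM.
split=> // z zl.
pose F x := f x * g x - itg 0 x (fun x => f' x * g x + f x * g' x).
have [K K0 fK] := prim_lip l0 pf; have [L L0 gL] := prim_lip l0 pg.
have [[_ [M f'M]] [_ [N g'N]]] := (bf', bg').
suff : F z = F 0 by rewrite /F itg_aa subr0 => <-; rewrite subrK.
apply: (@quadratic_mod_cst _ l (M * L + K * N)) => // x y x0 xy yl.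
have x0l := le_trans xy yl; have y0 := le_trans x0 xy.
have -> : F y - F x =
    itg x y (fun t => f' t * (g y - g t) - (f t - f x) * g' t).
  rewrite /F (itg_split (lexx 0) x0 xy yl bd).
  transitivity ((f y - f x) * g y + f x * (g y - g x) -
    itg x y (fun t => f' t * g t + f t * g' t)); first by ring.
  rewrite (prim_sub pf x0 xy yl) (prim_sub pg x0 xy yl).
  rewrite mulrC -(itgZ _ x0 yl bf') -(itgZ _ x0 yl bg').
  have b1 := bmeasZ (g y) bf'; have b2 := bmeasZ (f x) bg'.
  rewrite -(itgD x0 yl b1 b2) -(itgB x0 yl (bmeasD b1 b2) bd).
  by apply: eq_itg => t _; ring.
have -> : (M * L + K * N) * (y - x) ^+ 2 =
    (M * (L * (y - x)) + K * (y - x) * N) * (y - x) by ring.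
apply: (norm_itg_le x0 xy yl).
  apply: bmeasB; apply: bmeasM => //; apply: bmeasB => //; exact: bmeas_cst.
move=> t /andP[xt ty]; have t0 := le_trans x0 xt; have tl := le_trans ty yl.
rewrite (le_trans (ler_normB _ _))// !normrM lerD// ler_pM//.
- by apply: f'M; rewrite t0.
- rewrite (le_trans (gL _ _ t0 ty yl))// ler_wpM2l//.
  by rewrite lerD2l lerN2.
- by rewrite (le_trans (fK _ _ x0 xt tl))// ler_wpM2l// lerD2r.
- by apply: g'N; rewrite t0.
Qed.

(** The squared distance of [f x] from the mean over [a, b] is at most (b - a) times the energy. On
    a short interval the energy thus enters with a small factor, and the rest depends on one
    average. *)
Lemma prim_sqr_le l f g a b x : 0 <= a -> a < b -> b <= l -> a <= x <= b ->
  prim l f g ->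
  f x ^+ 2 <= 2 * ((b - a) * itg 0 l (fun t => g t ^+ 2)) +
              2 * (itg a b f / (b - a)) ^+ 2.
Proof.
move=> a0 ab bl /andP[ax xb] fg; have [bg _] := fg.
have l0 : 0 <= l by rewrite (le_trans a0)// (le_trans (ltW ab)).
have d0 : 0 < b - a by rewrite subr_gt0.
have bf := prim_bmeas l0 fg; have bg2 : bmeas l (fun t => g t ^+ 2) by exact: bmeasM.
set D := (b - a) * itg 0 l _.
have incr s t : a <= s -> s <= t -> t <= b -> (f t - f s) ^+ 2 <= D.
  move=> as_ st tb; rewrite (prim_sub fg (le_trans a0 as_) st (le_trans tb bl)).
  move: st; rewrite le_eqVlt => /predU1P[->|st].
    rewrite itg_aa expr0n/= mulr_ge0//; first exact: ltW.
    by apply: itg_ge0 => u _; exact: sqr_ge0.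
  rewrite (le_trans (sqr_itg_le _ st _ bg)) ?(le_trans a0) ?(le_trans tb)//.
  rewrite ler_pM//; first by rewrite subr_ge0 ltW.
  - by apply: itg_ge0 => u _; exact: sqr_ge0.
  - by rewrite lerD ?lerN2.
  - apply: (subset_le_itg _ (le_trans a0 as_) (ltW st) (le_trans tb bl) (lexx l) bg2) => //.
    by move=> u; exact: sqr_ge0.
have dist t : a <= t <= b -> (f x - f t) ^+ 2 <= D.
  move=> /andP[at_ tb]; case: (leP t x) => [tx|/ltW xt]; first exact: incr.
  by rewrite -sqrrN opprB; exact: incr.
have E : (f x - itg a b f / (b - a)) ^+ 2 <= D.
  have -> : f x - itg a b f / (b - a) = itg a b (fun t => f x - f t) / (b - a).
    rewrite (itgB a0 bl (bmeas_cst _ _) bf) (itg_cst _ (ltW ab)).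
    by field; rewrite gt_eqF.
  rewrite expr_div_n ler_pdivrMr ?exprn_gt0//.
  have bxf : bmeas l (fun t => f x - f t) by apply: bmeasB => //; exact: bmeas_cst.
  rewrite (le_trans (sqr_itg_le a0 ab bl bxf))//.
  rewrite [X in _ <= X](_ : _ = (b - a) * (D * (b - a))); last by ring.
  rewrite ler_pM2l// -(itg_cst _ (ltW ab)).
  by apply: (le_itg a0 bl) => //; [exact: bmeasM | exact: bmeas_cst].
(* With [m] the mean, (f - 2m)^2 >= 0 says f^2 <= 2 (f - m)^2 + 2 m^2. *)
have := sqr_ge0 (f x - 2 * (itg a b f / (b - a))).
move: E; set m := itg a b f / _; nra.
Qed.

(** Apply [prim_sqr_le] on a window of length [e] containing [x]: the mean vanishes by
    Cauchy-Schwarz, and the energy term is 2 e I, with [e] arbitrarily small. *)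
Lemma prim_sqr_eq0 l f g : 0 < l -> prim l f g -> itg 0 l (fun t => f t ^+ 2) = 0 ->
  forall x, 0 <= x <= l -> f x = 0.
Proof.
move=> l0 fg f0 x /andP[x0 xl].
have bf := prim_bmeas (ltW l0) fg.
have bf2 : bmeas l (fun t => f t ^+ 2) by exact: bmeasM.
set I := itg 0 l (fun t => g t ^+ 2).
have I0 : 0 <= I by apply: itg_ge0 => t _; exact: sqr_ge0.
have key e : 0 < e -> e <= l -> f x ^+ 2 <= 2 * (e * I).
  move=> e0 el.
  have [a [a0 [ax xae ael]]] : exists a, 0 <= a /\ [/\ a <= x, x <= a + e & a + e <= l].
    case: (leP x e) => xe; first by exists 0; rewrite add0r.
    by exists (x - e); rewrite subr_ge0 ltW// subrK gerBl ltW.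
  have ae : a < a + e by rewrite ltrDl.
  have := prim_sqr_le a0 ae ael _ fg (x := x); rewrite ax xae => /(_ isT).
  have -> : itg a (a + e) f = 0.
    apply/eqP; rewrite -sqrf_eq0; apply/eqP/le_anti; rewrite sqr_ge0 andbT.
    rewrite (le_trans (sqr_itg_le a0 ae ael bf))// [a + e]addrC addrK.
    rewrite pmulr_rle0// -f0 [e + a]addrC.
    by apply: (subset_le_itg (lexx 0) a0 (ltW ae) ael (lexx l) bf2) => t; exact: sqr_ge0.
  by rewrite mul0r expr0n/= mulr0 addr0 [a + e]addrC addrK.
apply/eqP; rewrite -sqrf_eq0; apply/eqP/le_anti; rewrite sqr_ge0 andbT.
apply/ler_addgt0Pr => e e0; rewrite add0r.
have d0 : 0 < Num.min l (e / (2 * (I + 1))).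
  by rewrite lt_min l0 divr_gt0// mulr_gt0// ltr_wpDl.
apply: (le_trans (key _ d0 _)); first by rewrite ge_min lexx.
have I1 : 0 < I + 1 by rewrite ltr_wpDl.
apply: (@le_trans _ _ (2 * (e / (2 * (I + 1)) * I))).
  by rewrite ler_pM2l// ler_wpM2r// ge_min lexx orbT.
rewrite [X in X <= _](_ : _ = e * (I / (I + 1))); last by field; rewrite gt_eqF.
by rewrite ger_pMr// ler_pdivrMr// mul1r lerDl.
Qed.

(** Integration by parts: the integral of g^2 is a boundary term minus the integral of f h, and both
    vanish with [f]. *)
Lemma prim_deriv_eq0 l f g h : 0 < l -> prim l f g -> prim l g h ->
  (forall x, 0 <= x <= l -> f x = 0) -> forall x, 0 <= x <= l -> g x = 0.
Proof.
move=> l0 fg gh f0; apply: (prim_sqr_eq0 l0 gh).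
have [_ /(_ l)] := primM (ltW l0) fg gh.
rewrite lexx ltW// !f0 ?lexx ?ltW// !mul0r add0r => /(_ isT) H.
rewrite [RHS]H; apply: eq_itg => x /f0 fx; rewrite fx mul0r addr0 expr2//.
Qed.

End Primitive.

(** * Linear second order initial value problems *)

(** 2C / 2^n is the tail of the geometric series, so the intervals of that radius around [v n] are
    nested; the limit is the supremum of their left ends. *)
Lemma half_pow_cauchy {R : realType} (v : nat -> R) (C : R) :
  (forall n, `|v n.+1 - v n| <= C / 2 ^+ n) ->
  exists L, forall n, `|v n - L| <= 2 * C / 2 ^+ n.
Proof.
move=> vC.
have C0 : 0 <= C.
  by have := vC 0%N; rewrite expr0 divr1; apply: le_trans.
pose t n : R := 2 * C / 2 ^+ n.
have t0 n : 0 <= t n by rewrite divr_ge0 ?mulr_ge0// exprn_ge0.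
have tS n : t n = C / 2 ^+ n + t n.+1.
  by rewrite /t exprS; field; rewrite expf_neq0.
have step n : v n - t n <= v n.+1 - t n.+1 /\ v n.+1 + t n.+1 <= v n + t n.
  have := vC n; rewrite tS ler_norml; set w := C / _; set z := t _.
  by move=> /andP[? ?]; split; lra.
have homoa n m : (n <= m)%N -> v n - t n <= v m - t m.
  elim: m => [|m IH]; first by rewrite leqn0 => /eqP ->.
  rewrite leq_eqVlt => /predU1P[->//|/IH h].
  by apply: (le_trans h); have [] := step m.
have homob n m : (n <= m)%N -> v m + t m <= v n + t n.
  elim: m => [|m IH]; first by rewrite leqn0 => /eqP ->.
  rewrite leq_eqVlt => /predU1P[->//|/IH h].
  by apply: le_trans h; have [] := step m.
have ab n m : v n - t n <= v m + t m.
  have h1 := homoa _ _ (leq_maxl n m); have h2 := homob _ _ (leq_maxr n m).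
  by have := t0 (maxn n m); lra.
pose A : set R := range (fun n => v n - t n).
have Aub m : ubound A (v m + t m) by move=> _ [n _ <-]; exact: ab.
have A0 : A !=set0 by exists (v 0%N - t 0%N), 0%N.
exists (sup A) => n; rewrite ler_norml.
have h1 : v n - t n <= sup A.
  by apply: ub_le_sup; [exists (v 0%N + t 0%N) | exists n].
have h2 : sup A <= v n + t n by exact: ge_sup.
by rewrite -/(t n); apply/andP; split; lra.
Qed.

Lemma le_half_pow_eq0 {R : realType} (x C : R) :
  (forall n, `|x| <= C / 2 ^+ n) -> x = 0.
Proof.
move=> xC; apply/eqP; rewrite -normr_le0; apply/ler_addgt0Pr => e e0; rewrite add0r.
pose n := (Num.truncn (C / e)).+1.
have Cn : C / e < 2 ^+ n.
  rewrite (lt_trans (truncnS_gt _))// -natrX ltr_nat.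
  exact: ltn_expl.
rewrite (le_trans (xC n))// ler_pdivrMr ?exprn_gt0// [e * _]mulrC -ler_pdivrMr//.
exact: ltW.
Qed.

Section Ivp.
Context {R : realType}.
Variables (l : R) (p r : R -> R) (a b : R).
Hypotheses (l0 : 0 <= l) (bp : bmeas l p) (br : bmeas l r).

(** The Picard operator of u'' = p u - r with u(0) = a, u'(0) = b. *)
Let S (u : R -> R) (x : R) : R :=
  a + itg 0 x (fun t => b + itg 0 t (fun s => p s * u s - r s)).

(** Each integration gains a factor 1/K against the weight e^(Kt). *)
Lemma itg_expR_le (K x : R) : 0 < K -> 0 <= x ->
  itg 0 x (fun t => expR (K * t)) <= expR (K * x) / K.
Proof.
move=> K0; rewrite le_eqVlt => /predU1P[<-|x0].
  by rewrite itg_aa divr_ge0 ?expR_ge0// ltW.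
rewrite /itg /Rintegral (@continuous_FTC2 _ _ (fun x => expR (K * x) / K))//.
- by rewrite mulr0 expR0/= gerBl; apply: divr_ge0 => //; exact: ltW.
- apply: continuous_subspaceT => y; apply: continuous_comp; last exact: continuous_expR.
  by apply: cvgM; [exact: cvg_cst|exact: cvg_id].
- have cF : continuous (fun x => expR (K * x) / K).
    move=> y; apply: cvgM; last exact: cvg_cst.
    apply: continuous_comp; last exact: continuous_expR.
    by apply: cvgM; [exact: cvg_cst|exact: cvg_id].
  split.
  + move=> y _; exact: ex_derive.
  + by apply: cvg_at_right_filter; exact: cF.
  + by apply: cvg_at_left_filter; exact: cF.
- move=> y _; rewrite derive1E derive_val/=.
  by rewrite /GRing.scale/=; field; rewrite gt_eqF.
Qed.

Lemma picard_bmeas u : bmeas l u -> bmeas l (S u).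
Proof.
move=> bu; apply: (prim_bmeas l0); apply: prim_itg.
apply: (prim_bmeas l0); apply: prim_itg.
by apply: bmeasB => //; exact: bmeasM.
Qed.

Lemma bmeas_expR (c K : R) : bmeas l (fun t => c * expR (K * t)).
Proof.
apply: bmeasZ; split.
  apply: measurable_funTS; apply: continuous_measurable_fun => x.
  apply: continuous_comp; last exact: continuous_expR.
  by apply: cvgM; [exact: cvg_cst | exact: cvg_id].
exists (expR (`|K| * l)) => x /andP[x0 xl].
rewrite ger0_norm ?expR_ge0// ler_expR.
rewrite (le_trans (ler_norm _))// normrM ler_wpM2l//.
by rewrite ger0_norm.
Qed.

(** A weighted supremum norm makes the Picard operator a contraction on the whole of [0, l],
    whatever its length, so that no continuation from short intervals arises. *)
Lemma picard_contraction : exists2 K : R, 0 < K &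
  forall u v c, bmeas l u -> bmeas l v -> 0 <= c ->
  (forall x, 0 <= x <= l -> `|u x - v x| <= c * expR (K * x)) ->
  forall x, 0 <= x <= l -> `|S u x - S v x| <= c / 2 * expR (K * x).
Proof.
have [_ [M pM]] := bp.
have M0 : 0 <= M by rewrite (le_trans (normr_ge0 (p 0)))// pM// lexx.
(* Two integrations give the factor M / K^2, and K = 2M + 1 makes it at most 1/2. *)
pose K := 2 * M + 1; have K0 : 0 < K by rewrite /K; lra.
exists K => // u v c bu bv c0 uv x /andP[x0 xl].
have bpu := bmeasM bp bu; have bpv := bmeasM bp bv.
have bI w : bmeas l w -> bmeas l (fun t => b + itg 0 t w).
  by move=> bw; apply: (prim_bmeas l0); exact: prim_itg.
have bIu := bI _ (bmeasB bpu br); have bIv := bI _ (bmeasB bpv br).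
have subDD z w t : z + w - (z + t) = w - t :> R by ring.
rewrite /S subDD.
rewrite -(itgB (lexx 0) xl bIu bIv).
have inner t : 0 <= t <= x ->
    `|b + itg 0 t (fun s => p s * u s - r s) - (b + itg 0 t (fun s => p s * v s - r s))|
    <= M * c / K * expR (K * t).
  move=> /andP[t0 tx]; have tl := le_trans tx xl.
  rewrite subDD -(itgB (lexx 0) tl (bmeasB bpu br) (bmeasB bpv br)).
  have bd := bmeasB (bmeasB bpu br) (bmeasB bpv br).
  rewrite (le_trans (norm_itg (lexx 0) tl bd))//.
  have := le_itg (lexx 0) tl (bmeas_norm bd) (bmeas_expR (M * c) K).
  move=> /(_ _)/le_trans; apply.
    move=> s /andP[s0 st]; have sl : 0 <= s <= l by rewrite s0 (le_trans st).
    rewrite [X in `|X|](_ : _ = p s * (u s - v s)); last by ring.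
    by rewrite normrM -mulrA ler_pM// ?pM// uv.
  rewrite (itgZ (l := l))//; last first.
    by under eq_fun do rewrite -[expR _]mul1r; exact: bmeas_expR.
  rewrite [X in _ <= X](_ : _ = M * c * (expR (K * t) / K)); last by ring.
  rewrite ler_wpM2l ?mulr_ge0//.
  exact: itg_expR_le.
rewrite (le_trans (norm_itg (lexx 0) xl (bmeasB bIu bIv)))//.
have := le_itg (lexx 0) xl (bmeas_norm (bmeasB bIu bIv)) (bmeas_expR (M * c / K) K).
move=> /(_ inner)/le_trans; apply.
rewrite (itgZ (l := l))//; last first.
  by under eq_fun do rewrite -[expR _]mul1r; exact: bmeas_expR.
apply: (@le_trans _ _ (M * c / K * (expR (K * x) / K))).
  by rewrite ler_wpM2l ?divr_ge0 ?mulr_ge0 ?itg_expR_le// ltW.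
rewrite [X in X <= _](_ : _ = c * expR (K * x) * (M / K / K)); last by ring.
rewrite [X in _ <= X](_ : _ = c * expR (K * x) * (1 / 2)); last by ring.
rewrite ler_wpM2l ?mulr_ge0 ?expR_ge0//.
by rewrite !ler_pdivrMr// /K; nra.
Qed.

Lemma ivp_solvable : exists u u1 : R -> R,
  [/\ prim l u u1, prim l u1 (fun x => p x * u x - r x), u 0 = a & u1 0 = b].
Proof.
have [K K0 contr] := picard_contraction.
pose U n := iter n S (fun=> 0).
have bU n : bmeas l (U n).
  by elim: n => [|n IH]; [exact: bmeas_cst | exact: picard_bmeas].
(* [U 0] is zero, so a bound [W] for [U 1] bounds the first increment. *)
have [_ [W UW]] := bU 1%N.
have W0 : 0 <= W by rewrite (le_trans (normr_ge0 (U 1%N 0)))// UW// lexx.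
have eK x : 0 <= x -> 1 <= expR (K * x).
  by move=> x0; rewrite -expR0 ler_expR mulr_ge0// ltW.
have dU n x : 0 <= x <= l -> `|U n.+1 x - U n x| <= W / 2 ^+ n * expR (K * x).
  elim: n x => [|n IH] x xl.
    rewrite subr0 expr0 divr1 (le_trans (UW _ xl))// ler_peMr// eK//.
    by case/andP: xl.
  rewrite [X in X * _](_ : _ = W / 2 ^+ n / 2); last first.
    by rewrite exprSr invfM mulrA.
  by apply: (contr (U n.+1) (U n)) => //; rewrite divr_ge0// exprn_ge0.
have lim x : exists L, 0 <= x <= l ->
    forall n, `|U n x - L| <= 2 * (W * expR (K * x)) / 2 ^+ n.
  case: (boolP (0 <= x <= l)) => xl; last by exists 0.
  have [|L HL] := @half_pow_cauchy R (fun n => U n x) (W * expR (K * x)).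
    by move=> n; rewrite mulrAC; exact: dU.
  by exists L.
have {lim} [u Uu] := choice lim.
have bu : bmeas l u.
  split; last first.
    exists (2 * (W * expR (K * l))) => x xl.
    have := Uu x xl 0%N; rewrite sub0r normrN expr0 divr1 => /le_trans; apply.
    rewrite ler_wpM2l// ler_wpM2l// ler_expR; apply: ler_wpM2l; first exact: ltW.
    by case/andP: xl.
  apply: (@measurable_fun_cvg _ _ _ _ U); first by move=> m; case: (bU m).
  move=> x /=; rewrite in_itv/= => xl.
  apply/cvgrPdist_le => e e0; near=> n.
  rewrite distrC (le_trans (Uu x xl n))//.
  rewrite ler_pdivrMr ?exprn_gt0// [e * _]mulrC -ler_pdivrMr//.
  set z := _ / e.
  apply: (@le_trans _ _ n%:R); first by near: n; exact: nbhs_infty_ger.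
  by rewrite -natrX ler_nat; exact/ltnW/ltn_expl.
have fix_u x : 0 <= x <= l -> u x = S u x.
  move=> xl; apply/eqP; rewrite -subr_eq0; apply/eqP.
  apply: (@le_half_pow_eq0 _ _ (2 * (W * expR (K * x)))) => n.
  (* Compare [u] with [S u] through U (n+1) = S (U n); both distances are of order 2^-n. *)
  rewrite -(subrKA (U n.+1 x)) (le_trans (ler_normD _ _))//.
  rewrite [X in _ <= X](_ : _ = 2 * (W * expR (K * x)) / 2 ^+ n.+1 +
    (2 * W / 2 ^+ n) / 2 * expR (K * x)); last first.
    by rewrite exprS; field; rewrite expf_neq0.
  rewrite lerD//; first by rewrite distrC; exact: Uu.
  apply: (contr (U n) u) => //.
    by rewrite divr_ge0 ?mulr_ge0// exprn_ge0.
  by move=> y yl; rewrite mulrAC -[2 * W * _]mulrA; exact: Uu.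
have bpu : bmeas l (fun x => p x * u x - r x) by apply: bmeasB => //; exact: bmeasM.
have pu1 : prim l (fun t => b + itg 0 t (fun s => p s * u s - r s)) (fun x => p x * u x - r x).
  exact: prim_itg.
exists u, (fun t => b + itg 0 t (fun s => p s * u s - r s)); split=> //.
- apply: (@eq_prim _ _ (S u)) => //; first by move=> x /fix_u ->.
  by apply: prim_itg; exact: (prim_bmeas l0 pu1).
- by rewrite fix_u ?lexx// /S itg_aa addr0.
- by rewrite itg_aa addr0.
Unshelve. all: by end_near. Qed.

End Ivp.

Local Close Scope classical_set_scope.

(** * Hermitian forms and the min-max principle *)

Local Open Scope complex_scope.

Section FiniteLinearAlgebra.
Context {F : fieldType} {I J : finType}.
Variable phi : I -> J -> F.

(** There are fewer equations than unknowns. Both are selected by subsets and the solution is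
    extended by zero, because test families and signs of eigenvalues are given by subsets of index
    types. *)
Lemma exists_nontrivial_solution (A : {set I}) (B : {set J}) : (#|B| < #|A|)%N ->
  exists x : I -> F, [/\ forall i, i \notin A -> x i = 0, exists i, x i != 0
    & forall j, j \in B -> \sum_i x i * phi i j = 0].
Proof.
move=> ltBA.
pose M : 'M[F]_(#|A|, #|B|) := \matrix_(i, j) phi (enum_val i) (enum_val j).
have /rowV0Pn[r rM r0] : kermx M != 0.
  rewrite -mxrank_eq0 mxrank_ker subn_eq0 -ltnNge.
  by rewrite (leq_ltn_trans (rank_leq_col _)).
move/sub_kermxP in rM.
pose x i := if insub i is Some j then r 0 (enum_rank_in (svalP j) (sval j)) else 0 : F.
have xE (k : 'I_#|A|) : x (enum_val k) = r 0 k.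
  rewrite /x insubT; first exact: enum_valP.
  by move=> kA /=; rewrite enum_valK_in.
have xN i : i \notin A -> x i = 0 by move=> iA; rewrite /x insubN.
exists x; split => //.
- have /rV0Pn[k rk] := r0.
  by exists (enum_val k); rewrite xE.
- move=> j jB; rewrite (bigID (mem A))/= [X in _ + X]big1 ?addr0; last first.
    by move=> i /xN ->; rewrite mul0r.
  rewrite big_enum_val/=.
  have /rowP/(_ (enum_rank_in jB j)) := rM.
  rewrite !mxE => H; rewrite -[RHS]H; apply: eq_bigr => k _.
  by rewrite !mxE xE enum_rankK_in.
Qed.

(** An injective linear map into a space of no larger dimension is onto. *)
Lemma injective_solvable :
  (forall x : I -> F, (forall j, \sum_i x i * phi i j = 0) -> forall i, x i = 0) ->
  (#|J| <= #|I|)%N ->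
  forall y : J -> F, exists x : I -> F, forall j, \sum_i x i * phi i j = y j.
Proof.
move=> inj leJI y.
pose M : 'M[F]_(#|I|, #|J|) := \matrix_(i, j) phi (enum_val i) (enum_val j).
have sumE (r : 'rV[F]_#|I|) j :
    \sum_i r 0 (enum_rank i) * phi i j = (r *m M) 0 (enum_rank j).
  rewrite mxE (reindex (@enum_rank I))/=; last exact/onW_bij/enum_rank_bij.
  by apply: eq_bigr => i _; rewrite mxE !enum_rankK.
have free : row_free M.
  rewrite -kermx_eq0; apply/rowV0P => r /sub_kermxP rM.
  apply/rowP => k; rewrite mxE -[k]enum_valK.
  by apply: (inj (fun i => r 0 (enum_rank i))) => j; rewrite sumE rM mxE.
have full : row_full M.
  by rewrite /row_full eqn_leq rank_leq_col (eqP free).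
exists (fun i => ((\row_j y (enum_val j)) *m pinvmx M) 0 (enum_rank i)) => j.
rewrite sumE mulmxKpV ?mxE ?enum_rankK//.
exact: submx_full.
Qed.

End FiniteLinearAlgebra.

Section FiniteSpectral.
Local Open Scope sesquilinear_scope.
Context {R : realType} {I : finType}.

Lemma hermitian_eigenbasis (A : I -> I -> R[i]) :
  (forall i j, A i j = conjc (A j i)) ->
  exists (d : I -> R) (E : I -> I -> R[i]),
  [/\ forall k i, \sum_j A i j * E k j = (d k)%:C * E k i,
      forall k m, \sum_j E k j * conjc (E m j) = (k == m)%:R
    & forall i j, \sum_k E k i * conjc (E k j) = (i == j)%:R].
Proof.
move=> Ah.
pose M : 'M[R[i]]_#|I| := \matrix_(i, j) A (enum_val i) (enum_val j).
have Mh : M \is hermsymmx.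
  apply/is_hermitianmxP; rewrite expr0 scale1r.
  by apply/matrixP => i j; rewrite !mxE; exact: Ah.
have Mn := hermitian_normalmx Mh.
have /orthomx_spectralP := Mn.
have Du := spectral_unitarymx M.
rewrite invmx_unitary//.
have Dr := hermitian_spectral_diag_real Mh.
move: Du Dr; set P := spectralmx M; set D := spectral_diag M => Pu Dr ME.
have PP : P *m P^t* = 1%:M by exact/unitarymxP.
have PP' : P^t* *m P = 1%:M by exact: mulmx1C.
(* The eigenvectors are the columns of the adjoint of [P], whence the conjugate; the eigenvalues are
   real, so nothing is lost by [complex.Re]. *)
exists (fun k => complex.Re (D 0 (enum_rank k))),
  (fun k j => conjc (P (enum_rank k) (enum_rank j))).
split.
- move=> k i.
  have /matrixP/(_ (enum_rank i) (enum_rank k)) : M *m P^t* = P^t* *m diag_mx D.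
    by rewrite ME -!mulmxA PP mulmx1.
  rewrite mul_mx_diag !mxE (reindex (@enum_rank I))/=; last exact/onW_bij/enum_rank_bij.
  rewrite RRe_real; last by have /mxOverP := Dr; apply.
  rewrite [RHS]mulrC => <-; apply: eq_bigr => j _.
  by rewrite !mxE !enum_rankK.
- move=> k m; have /matrixP/(_ (enum_rank m) (enum_rank k)) := PP.
  rewrite !mxE (reindex (@enum_rank I))/=; last exact/onW_bij/enum_rank_bij.
  rewrite (inj_eq enum_rank_inj) eq_sym => <-; apply: eq_bigr => j _.
  by rewrite /= !mxE mulrC; congr (_ * _); rewrite conjcK.
- move=> i j; have /matrixP/(_ (enum_rank i) (enum_rank j)) := PP'.
  rewrite !mxE (reindex (@enum_rank I))/=; last exact/onW_bij/enum_rank_bij.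
  rewrite (inj_eq enum_rank_inj) => <-; apply: eq_bigr => k _.
  by rewrite /= !mxE; congr (_ * _); rewrite conjcK.
Qed.

End FiniteSpectral.

Section ComplexParts.
Context {R : rcfType}.
Implicit Types y z : R[i].

Definition sqnorm z : R := complex.Re z ^+ 2 + complex.Im z ^+ 2.

Lemma sqnorm_ge0 z : 0 <= sqnorm z.
Proof. by rewrite addr_ge0// sqr_ge0. Qed.

Lemma conjcM y z : conjc (y * z) = conjc y * conjc z.
Proof. exact: rmorphM. Qed.

Lemma complex_ReZ (a : R) z : complex.Re (a%:C * z) = a * complex.Re z.
Proof. by case: z => x y /=; ring. Qed.

Lemma complex_ReD y z : complex.Re (y + z) = complex.Re y + complex.Re z.
Proof. by case: y; case: z. Qed.

Lemma complex_ImD y z : complex.Im (y + z) = complex.Im y + complex.Im z.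
Proof. by case: y; case: z. Qed.

Lemma complex_ReM y z : complex.Re (y * z) =
  complex.Re y * complex.Re z - complex.Im y * complex.Im z.
Proof. by case: y; case: z. Qed.

Lemma complex_ImM y z : complex.Im (y * z) =
  complex.Re y * complex.Im z + complex.Im y * complex.Re z.
Proof. by case: y; case: z. Qed.

Lemma complex_ReJ z : complex.Re (conjc z) = complex.Re z.
Proof. by case: z. Qed.

Lemma complex_ImJ z : complex.Im (conjc z) = - complex.Im z.
Proof. by case: z. Qed.

Lemma complex_Re_sum (I : Type) (r : seq I) (P : pred I) (F : I -> R[i]) :
  complex.Re (\sum_(i <- r | P i) F i) = \sum_(i <- r | P i) complex.Re (F i).
Proof. by elim/big_rec2: _ => // i x y _ <-; case: (F i) => ? ?; case: y => ? ?. Qed.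

Lemma complex_Im_sum (I : Type) (r : seq I) (P : pred I) (F : I -> R[i]) :
  complex.Im (\sum_(i <- r | P i) F i) = \sum_(i <- r | P i) complex.Im (F i).
Proof. by elim/big_rec2: _ => // i x y _ <-; rewrite complex_ImD. Qed.

End ComplexParts.

(** * Hermitian forms on subspaces *)

Section HermitianForms.
Context {R : realType} {V : lmodType R[i]}.
Implicit Types (X : V -> Prop) (s h b : V -> V -> R[i]) (u v w : V).

(** Subspaces are predicates on one ambient space, so that the two form domains to be compared share
    their vectors. *)
Definition lin_closed X : Prop :=
  X 0 /\ forall (a : R[i]) u v, X u -> X v -> X (a *: u + v).

(** The laws are required on [X] only, since integrals are additive only on integrable functions. *)
Definition herm_form X s : Prop :=
  (forall (a : R[i]) u v w, X u -> X v -> X w ->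
     s (a *: u + v) w = a * s u w + s v w) /\
  (forall u v, X u -> X v -> s u v = conjc (s v u)).

Definition qform s u : R := complex.Re (s u u).

Section Forms.
Variables (X : V -> Prop).
Hypothesis Xlin : lin_closed X.

Lemma lin_closedZ a u : X u -> X (a *: u).
Proof.
by move=> Xu; rewrite -[_ *: _]addr0; apply: (proj2 Xlin) => //; case: Xlin.
Qed.

Lemma lin_closedD u v : X u -> X v -> X (u + v).
Proof. by move=> Xu Xv; rewrite -[u]scale1r; exact: (proj2 Xlin). Qed.

Lemma lin_closedB u v : X u -> X v -> X (u - v).
Proof. by move=> Xu Xv; rewrite addrC -scaleN1r; exact: (proj2 Xlin). Qed.

Lemma lin_closed_sum (I : finType) (P : pred I) (c : I -> R[i]) (u : I -> V) :
  (forall i, P i -> X (u i)) -> X (\sum_(i | P i) c i *: u i).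
Proof.
move=> Xu; elim/big_rec: _ => [|i v Pi Xv]; first by case: Xlin.
by apply: (proj2 Xlin _ _ _ _ _) => //; exact: Xu.
Qed.

Section Form.
Variable s : V -> V -> R[i].
Hypothesis sH : herm_form X s.

Lemma herm_formC u v : X u -> X v -> s u v = conjc (s v u).
Proof. exact: (proj2 sH). Qed.

Lemma herm_form0l w : X w -> s 0 w = 0.
Proof.
move=> Xw; have := (proj1 sH) 1 _ _ _ (proj1 Xlin) (proj1 Xlin) Xw.
by rewrite scale1r addr0 mul1r => /esym/eqP; rewrite -subr_eq0 addrK => /eqP.
Qed.

Lemma herm_formZl a u w : X u -> X w -> s (a *: u) w = a * s u w.
Proof.
by move=> Xu Xw; rewrite -[a *: u]addr0 (proj1 sH) ?herm_form0l ?addr0//; by case: Xlin.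
Qed.

Lemma herm_formDl u v w : X u -> X v -> X w -> s (u + v) w = s u w + s v w.
Proof. by move=> Xu Xv Xw; rewrite -[u in LHS]scale1r (proj1 sH)// mul1r. Qed.

Lemma herm_formDr u v w : X u -> X v -> X w -> s w (u + v) = s w u + s w v.
Proof.
move=> Xu Xv Xw; rewrite herm_formC ?herm_formDl//; last exact: lin_closedD.
by rewrite rmorphD/= [s w u]herm_formC// [s w v]herm_formC.
Qed.

Lemma herm_formZr a u w : X u -> X w -> s w (a *: u) = conjc a * s w u.
Proof.
move=> Xu Xw; rewrite herm_formC ?herm_formZl//; last exact: lin_closedZ.
by rewrite rmorphM/= [s w u]herm_formC.
Qed.

Lemma herm_form_suml (I : finType) (P : pred I) (c : I -> R[i]) (u : I -> V) w :
  (forall i, P i -> X (u i)) -> X w ->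
  s (\sum_(i | P i) c i *: u i) w = \sum_(i | P i) c i * s (u i) w.
Proof.
move=> Xu Xw.
suff [] : s (\sum_(i | P i) c i *: u i) w = \sum_(i | P i) c i * s (u i) w /\
  X (\sum_(i | P i) c i *: u i) by [].
elim/big_rec2: _ => [|i y v Pi [<- Xv]]; first by split; [exact: herm_form0l|by case: Xlin].
have Xi := Xu i Pi; split; last exact: (proj2 Xlin).
exact: (proj1 sH).
Qed.

Lemma herm_form_sumr (I : finType) (P : pred I) (c : I -> R[i]) (u : I -> V) w :
  (forall i, P i -> X (u i)) -> X w ->
  s w (\sum_(i | P i) c i *: u i) = \sum_(i | P i) conjc (c i) * s w (u i).
Proof.
move=> Xu Xw; rewrite herm_formC ?herm_form_suml//; last exact: lin_closed_sum.
rewrite rmorph_sum; apply: eq_bigr => i Pi.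
by rewrite rmorphM/= [s w (u i)]herm_formC//; exact: Xu.
Qed.

Lemma qformE u : X u -> s u u = (qform s u)%:C.
Proof.
move=> Xu; have := herm_formC Xu Xu; rewrite /qform.
case: (s u u) => a b [] bE; rewrite /= (_ : b = 0)//.
by move/eqP: bE; rewrite -addr_eq0 -mulr2n mulrn_eq0/= => /eqP.
Qed.

Lemma qformD u v : X u -> X v ->
  qform s (u + v) = qform s u + qform s v + 2 * complex.Re (s u v).
Proof.
move=> Xu Xv; rewrite /qform herm_formDl ?herm_formDr//; last exact: lin_closedD.
rewrite [s v u]herm_formC//.
by case: (s u u); case: (s v v); case: (s u v) => /= *; ring.
Qed.

Lemma qformZ a u : X u -> qform s (a *: u) =
  (complex.Re a ^+ 2 + complex.Im a ^+ 2) * qform s u.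
Proof.
move=> Xu; rewrite {1}/qform herm_formZl ?herm_formZr//; last exact: lin_closedZ.
rewrite (qformE Xu); move: (qform s u) => t.
by case: a => x y /=; ring.
Qed.

Lemma qform_sum_sum (I : finType) (c : I -> R[i]) (u : I -> V) :
  (forall i, X (u i)) ->
  qform s (\sum_i c i *: u i) =
  complex.Re (\sum_i \sum_j c i * conjc (c j) * s (u i) (u j)).
Proof.
move=> Xu; rewrite /qform herm_form_suml//; last exact: lin_closed_sum.
congr complex.Re; apply: eq_bigr => i _; rewrite herm_form_sumr// mulr_sumr.
by apply: eq_bigr => j _; rewrite mulrA.
Qed.

(** The real and imaginary parts of c_i conj(c_j) are bounded by the sum of squares, so the entries
    of the Gram matrix can be summed up. The summand 1 in [M] makes it positive, to be divided by
    later. *)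
Lemma qform_sum_bound (I : finType) (u : I -> V) : (forall i, X (u i)) ->
  exists2 M, 0 < M & forall c : I -> R[i],
  qform s (\sum_i c i *: u i) <=
    M * \sum_i (complex.Re (c i) ^+ 2 + complex.Im (c i) ^+ 2).
Proof.
move=> Xu.
pose m (z : R[i]) : R := `|complex.Re z| + `|complex.Im z|.
exists (1 + \sum_i \sum_j m (s (u i) (u j))).
  by rewrite ltr_wpDr// sumr_ge0// => i _; rewrite sumr_ge0// => j _; rewrite addr_ge0.
move=> c; rewrite qform_sum_sum//; set N := \sum_i (_ + _).
have cN i : complex.Re (c i) ^+ 2 + complex.Im (c i) ^+ 2 <= N.
  rewrite /N (bigD1 i)//= lerDl sumr_ge0// => j _.
  by rewrite addr_ge0// sqr_ge0.
have N0 : 0 <= N by rewrite sumr_ge0// => i _; rewrite addr_ge0// sqr_ge0.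
rewrite complex_Re_sum mulrDl mul1r; apply: ler_wpDl => //.
rewrite mulr_suml; apply: ler_sum => i _.
rewrite complex_Re_sum mulr_suml; apply: ler_sum => j _.
have := cN i; have := cN j; rewrite /m.
case: (c i) => x y; case: (c j) => z t; case: (s _ _) => p q /=.
move=> h1 h2.
have k1 : `|x * z + y * t| <= N.
  have := sqr_ge0 (x - z); have := sqr_ge0 (x + z).
  have := sqr_ge0 (y - t); have := sqr_ge0 (y + t).
  by rewrite ler_norml => *; apply/andP; split; lra.
have k2 : `|y * z - x * t| <= N.
  have := sqr_ge0 (y - z); have := sqr_ge0 (y + z).
  have := sqr_ge0 (x - t); have := sqr_ge0 (x + t).
  by rewrite ler_norml => *; apply/andP; split; lra.
rewrite [X in X <= _](_ : _ = (x * z + y * t) * p - (y * z - x * t) * q); last by ring.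
rewrite (le_trans (ler_norm _))// (le_trans (ler_normB _ _))// !normrM mulrDl.
by rewrite lerD// mulrC ler_wpM2l.
Qed.

Hypothesis s_ge0 : forall u, X u -> 0 <= qform s u.

(** The parallelogram identity: the defect is the form at u - v. *)
Lemma qformD_le u v : X u -> X v -> qform s (u + v) <= 2 * (qform s u + qform s v).
Proof.
move=> Xu Xv; have Xm : X (- 1 *: v) by exact: lin_closedZ.
have := s_ge0 (lin_closedD Xu Xm).
rewrite (qformD Xu Xm) (qformD Xu Xv) (qformZ _ Xv) herm_formZr//.
by case: (s u v) => p q /=; nra.
Qed.

(** Otherwise a suitable multiple of [u] added to [w] would make the form negative, because [u]
    itself contributes nothing. *)
Lemma qform_eq0_orth u w : X u -> X w -> qform s u = 0 -> s w u = 0.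
Proof.
move=> Xu Xw u0.
have key (a : R[i]) : 0 <= qform s w + 2 * complex.Re (conjc a * s w u).
  have Xa := lin_closedZ a Xu.
  have := s_ge0 (lin_closedD Xw Xa).
  by rewrite (qformD Xw Xa) (qformZ _ Xu) u0 mulr0 addr0 herm_formZr.
have qw := s_ge0 Xw.
case E : (s w u) key => [p q] key; set m := p ^+ 2 + q ^+ 2.
have [m0|m0] : m = 0 \/ 0 < m.
  have : 0 <= m by rewrite addr_ge0 ?sqr_ge0.
  by rewrite le_eqVlt => /predU1P[<-|]; [left|right].
  move/eqP: m0; rewrite paddr_eq0 ?sqr_ge0// !sqrf_eq0 => /andP[/eqP-> /eqP->].
  by [].
(* The multiple -t s(w,u) lowers the form by 2 t m = 2 (Q + 1), more than its value [Q]. *)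
set Q := qform s w in qw key; pose t := (Q + 1) / m.
have tm : t * m = Q + 1 by rewrite mulfVK// gt_eqF.
have := key ((- t * p) +i* (- t * q)).
rewrite [X in _ <= _ + 2 * X -> _](_ : _ = - (t * m)); last by rewrite /m/=; ring.
by rewrite tm => h; exfalso; lra.
Qed.

End Form.
End Forms.
End HermitianForms.

(** * Min-max values as infima over test families *)

Section MinMax.
Context {R : realType} {V : lmodType R[i]}.
Variables (X : V -> Prop) (h b : V -> V -> R[i]) (E : R -> V -> Prop).
Hypotheses (Xlin : lin_closed X) (hH : herm_form X h) (bH : herm_form X b).
Hypothesis b_ge0 : forall u, X u -> 0 <= qform b u.

(** A subspace of dimension at least [m] with Rayleigh quotients at most [mu]; the m-th min-max
    value is the infimum of such [mu]. Positivity of [b] expresses independence modulo null vectors: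
    [b] is only semidefinite, because in the application values outside [0, len e] are arbitrary. *)
Definition test_family (m : nat) (mu : R) : Prop :=
  exists (J : finType) (A : {set J}) (psi : J -> V),
  [/\ (m <= #|A|)%N, forall j, X (psi j)
    & forall c : J -> R[i], (forall j, j \notin A -> c j = 0) ->
        (exists j, c j != 0) ->
        0 < qform b (\sum_j c j *: psi j) /\
        qform h (\sum_j c j *: psi j) <= mu * qform b (\sum_j c j *: psi j)].

Lemma test_family_le m n mu : (m <= n)%N -> test_family n mu -> test_family m mu.
Proof.
move=> mn [J [A [psi [nA Xpsi H]]]]; exists J, A, psi; split=> //.
exact: leq_trans nA.
Qed.

(* The vectors [w] diagonalize [h - nu b] with eigenvalues [d], and [ell] gives
   their coordinates; a null vector lies in [E nu], and [h - nu b] dominates [b]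
   where all coordinates vanish. *)
Definition shifted_diag (nu : R) (I : finType) (d : I -> R) (w : I -> V)
    (ell : I -> V -> R[i]) : Prop :=
  [/\ forall i, X (w i),
      forall i f, X f -> h (w i) f = nu%:C * b (w i) f + (d i)%:C * conjc (ell i f),
      forall i j, ell i (w j) = (i == j)%:R
    & forall i (a : R[i]) f g, X f -> X g ->
        ell i (a *: f + g) = a * ell i f + ell i g] /\
  [/\ forall g, X g -> (forall i, ell i g = 0) -> (nu + 1) * qform b g <= qform h g,
      forall f i, X f -> qform b f = 0 -> ell i f = 0
    & forall i, d i = 0 -> E nu (w i)].

Section Reduction.
Variables (nu : R) (I : finType) (d : I -> R) (w : I -> V) (ell : I -> V -> R[i]).
Hypothesis red : shifted_diag nu d w ell.

Let Xw i : X (w i). Proof. by have [[]] := red. Qed.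

Let Xsum (y : I -> R[i]) : X (\sum_i y i *: w i).
Proof. exact: (lin_closed_sum Xlin). Qed.

Let ell0 i : ell i 0 = 0.
Proof.
have [[_ _ _ lin] _] := red.
have := lin i 1 _ _ (proj1 Xlin) (proj1 Xlin).
by rewrite scale1r addr0 mul1r => /esym/eqP; rewrite -subr_eq0 addrK => /eqP.
Qed.

Let ell_sum (J : finType) (y : J -> R[i]) (f : J -> V) i : (forall j, X (f j)) ->
  ell i (\sum_j y j *: f j) = \sum_j y j * ell i (f j).
Proof.
move=> Xf; have [[_ _ _ lin] _] := red.
suff [] : ell i (\sum_j y j *: f j) = \sum_j y j * ell i (f j) /\ X (\sum_j y j *: f j) by [].
elim/big_rec2: _ => [|j z u _ [<- Xu]]; first by split=> //; case: Xlin.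
by split; [rewrite lin | exact: (proj2 Xlin)].
Qed.

Lemma shifted_diag_coord (y : I -> R[i]) i : ell i (\sum_j y j *: w j) = y i.
Proof.
have [[_ _ dual _] _] := red.
rewrite ell_sum// (bigD1 i)//= dual eqxx mulr1 big1 ?addr0// => j ji.
by rewrite dual eq_sym (negbTE ji) mulr0.
Qed.

Let h_sum (y : I -> R[i]) f : X f ->
  h (\sum_i y i *: w i) f =
  nu%:C * b (\sum_i y i *: w i) f + \sum_i y i * (d i)%:C * conjc (ell i f).
Proof.
move=> Xf; have [[_ hw _ _] _] := red.
rewrite (herm_form_suml Xlin hH)// (herm_form_suml Xlin bH)// mulr_sumr -big_split/=.
by apply: eq_bigr => i _; rewrite hw//; ring.
Qed.

Let qh_sum (y : I -> R[i]) :
  qform h (\sum_i y i *: w i) =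
  nu * qform b (\sum_i y i *: w i) + \sum_i d i * sqnorm (y i).
Proof.
rewrite {1}/qform h_sum// (qformE bH)// -rmorphM.
rewrite [X in _ + X](eq_bigr (fun i => (d i * sqnorm (y i))%:C)) => [|i _].
  by rewrite -rmorph_sum/=.
rewrite shifted_diag_coord /sqnorm; case: (y i) => p q; apply/eqP; rewrite eq_complex/=.
by apply/andP; split; apply/eqP; ring.
Qed.

Let negs := [set i | d i < 0].
Let zeros := [set i | d i == 0].

(** The family consists of the [w i] with negative [d i]. As they are finitely many, the Rayleigh
    quotient stays below [nu] by a definite amount. *)
Lemma reduction_test_family : exists2 e, 0 < e & test_family #|negs| (nu - e).
Proof.
have [M M0 bM] := qform_sum_bound Xlin bH Xw.
(* Starting the minimum at 1 keeps it positive when no [d i] is negative. *)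
pose m := \big[Num.min/1]_(i in negs) (- d i).
have m0 : 0 < m.
  rewrite /m; elim/big_ind: _ => // [x y x0 y0|i]; first by rewrite lt_min x0.
  by rewrite inE oppr_gt0.
have md i : i \in negs -> d i <= - m.
  by move=> ni; rewrite lerNr; apply: bigmin_le_cond.
exists (m / M); first exact: divr_gt0.
exists I, negs, w; split => // c c0 [i ci].
have bc0 : 0 < qform b (\sum_j c j *: w j).
  rewrite lt_neqAle b_ge0// andbT; apply: contraNneq ci => bE.
  have [_ [_ ell_eq0 _]] := red.
  by rewrite -(shifted_diag_coord c i); apply/eqP; apply: ell_eq0.
split=> //; rewrite qh_sum mulrBl lerD2l.
apply: (@le_trans _ _ (- m * \sum_i sqnorm (c i))).
  rewrite mulr_sumr; apply: ler_sum => j _; case: (boolP (j \in negs)) => jn.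
    by rewrite ler_wpM2r ?sqnorm_ge0// md.
  by rewrite c0// /sqnorm/= expr0n/= addr0 !mulr0.
rewrite mulNr lerN2 -mulrA ler_pM2l// ler_pdivrMl//.
Qed.

(** A larger family would contain a nonzero combination whose coordinates with d <= 0 all vanish.
    There h - nu b dominates a multiple of [b], on the diagonalized part by the positive [d] and on
    the rest by coercivity, which excludes bounds below nu + e. *)
Lemma reduction_bound : exists2 e, 0 < e & forall n mu, mu < nu + e ->
  test_family n mu -> (n <= #|negs| + #|zeros|)%N.
Proof.
have [M M0 bM] := qform_sum_bound Xlin bH Xw.
pose m := \big[Num.min/1]_(i | 0 < d i) d i.
have m0 : 0 < m.
  by rewrite /m; elim/big_ind: _ => // x y x0 y0; rewrite lt_min x0.
have md i : 0 < d i -> m <= d i by move=> ni; apply: bigmin_le_cond.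
(* m / M serves the diagonalized part and 1 the coercive part; half of the minimum survives the
   parallelogram inequality. *)
pose k := Num.min (m / M) 1.
have k0 : 0 < k by rewrite lt_min ltr01 divr_gt0.
exists (k / 2); first exact: divr_gt0.
move=> n mu mue [J [A [psi [nA Xpsi test]]]].
have negz : (#|negs| + #|zeros|)%N = #|negs :|: zeros|.
  have nz : negs :&: zeros = finset.set0.
    by apply/setP => i; rewrite !inE; case: ltgtP.
  by rewrite cardsU nz cards0 subn0.
rewrite negz leqNgt; apply/negP => lt_n.
have [x [xA xn0 xK]] := exists_nontrivial_solution (fun j i => ell i (psi j))
  (leq_trans lt_n nA).
have [f0] := test x xA xn0; apply/negP; rewrite -ltNge.
set f := \sum_j _ in f0 *.
have Xf : X f by exact: (lin_closed_sum Xlin).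
pose y i := ell i f; pose u := \sum_i y i *: w i; pose g := f - u.
have Xu : X u by exact: Xsum.
have Xg : X g by exact: (lin_closedB Xlin).
have [[_ _ _ lin] [coer _ _]] := red.
have ellg i : ell i g = 0.
  by rewrite /g addrC -scaleN1r lin// shifted_diag_coord mulN1r addNr.
have y0 i : d i <= 0 -> y i = 0.
  move=> di; rewrite /y /f ell_sum//; apply: xK.
  by rewrite !inE orbC -le_eqVlt.
have fE : f = u + g by rewrite /g addrC subrK.
have hug : h u g = nu%:C * b u g.
  by rewrite h_sum// [X in _ + X]big1 ?addr0// => i _; rewrite ellg conjc0 mulr0.
have Hf : qform h f = nu * qform b u + \sum_i d i * sqnorm (y i) + qform h g +
    nu * (2 * complex.Re (b u g)).
  rewrite fE (qformD Xlin hH)// qh_sum hug -/u.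
  by case: (b u g) => p q /=; ring.
have Bf : qform b f = qform b u + qform b g + 2 * complex.Re (b u g).
  by rewrite fE (qformD Xlin bH).
have hu : k * qform b u <= \sum_i d i * sqnorm (y i).
  apply: (@le_trans _ _ (m * \sum_i sqnorm (y i))).
    apply: (@le_trans _ _ (m / M * qform b u)).
      by rewrite ler_wpM2r ?b_ge0// ge_min lexx.
    by rewrite -mulrA ler_pM2l// ler_pdivrMl// bM.
  rewrite mulr_sumr; apply: ler_sum => i _.
  case: (leP (d i) 0) => di; first by rewrite y0// /sqnorm/= expr0n/= addr0 !mulr0.
  by rewrite ler_wpM2r ?sqnorm_ge0// md.
have hg : nu * qform b g + k * qform b g <= qform h g.
  rewrite -mulrDl (le_trans _ (coer g Xg ellg))// ler_wpM2r ?b_ge0// lerD2l.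
  by rewrite ge_min lexx orbT.
have par : qform b f <= 2 * (qform b u + qform b g).
  by rewrite fE; apply: (qformD_le Xlin bH b_ge0).
have H1 : nu * qform b f + k * (qform b u + qform b g) <= qform h f.
  by rewrite Hf {1}Bf; move: hu hg; lra.
have H2 : nu * qform b f + k / 2 * qform b f <= qform h f.
  apply: le_trans H1; rewrite lerD2l -mulrA ler_pM2l// ler_pdivrMl//.
rewrite (lt_le_trans _ H2)// -mulrDl ltr_pM2r//.
Qed.

End Reduction.

Variable lam : nat -> R.
Hypothesis lam_homo : forall j k : nat, (j <= k)%N -> lam j <= lam k.
Hypothesis reduction : forall nu, exists (I : finType) (d : I -> R) (w : I -> V)
  (ell : I -> V -> R[i]), shifted_diag nu d w ell.
Hypothesis semibounded : exists c0 : R, forall f, X f -> c0 * qform b f <= qform h f.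
Hypothesis multiplicity : forall nu (I : finType) (Z : {set I}) (w : I -> V),
  (forall i, i \in Z -> E nu (w i)) ->
  (forall c : I -> R[i], (forall i, i \notin Z -> c i = 0) ->
     qform b (\sum_i c i *: w i) = 0 -> forall i, c i = 0) ->
  exists s : seq nat, [/\ uniq s, (#|Z| <= size s)%N & forall k, k \in s -> lam k = nu].

(* Let [nu] be the infimum of the bounds of test families of size [k + 1], and let
   [p] and [z] be the numbers of negative and zero eigenvalues of [h - nu b]. Then
   [p <= k < p + z], the first [p] of the [lam j] are below [nu] by induction, and
   [z] of them equal [nu]; hence [lam k <= nu]. *)
Lemma eigenvalue_le_of_test_family k mu : test_family k.+1 mu -> lam k <= mu.
Proof.
elim/ltn_ind: k mu => k IH mu tmu.
pose T := [set t | test_family k.+1 t]%classic; have [c0 hc0] := semibounded.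
have Tlb t : T t -> c0 <= t.
  move=> [J [A [psi [nA Xpsi test]]]].
  have /card_gt0P[j jA] : (0 < #|A|)%N by exact: leq_trans nA.
  have [||] := test (fun i => (i == j)%:R).
    by move=> i; apply: contraNeq; rewrite pnatr_eq0 eqb0 negbK => /eqP ->.
    by exists j; rewrite eqxx oner_eq0.
  set f := \sum_i _ => f0 hf.
  rewrite -(ler_pM2r f0) (le_trans _ hf)// hc0//.
  exact: (lin_closed_sum Xlin).
have T0 : has_inf T by split; [exists mu | exists c0].
pose nu := inf T.
have [I [d [w [ell red]]]] := reduction nu.
have [e1 e10 tneg] := reduction_test_family red.
have [e2 e20 bound] := reduction_bound red.
have [t Tt tlt] := inf_adherent e20 T0.
have kle := bound _ _ tlt Tt.
set p := #|[set i | d i < 0]| in tneg kle.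
(* Otherwise a test family of size k + 1 with bound nu - e1 would undercut the infimum. *)
have pk : (p <= k)%N.
  rewrite leqNgt; apply/negP => kp.
  have : nu <= nu - e1 by apply: (ge_inf T0.2); exact: test_family_le tneg.
  by rewrite lerDl oppr_ge0 leNgt e10.
have numu : nu <= mu by apply: (ge_inf T0.2).
apply: le_trans numu; rewrite leNgt; apply/negP => nulam.
have [s [us ns snu]] : exists s : seq nat,
    [/\ uniq s, (#|[set i | d i == 0%R]| <= size s)%N & forall k, k \in s -> lam k = nu].
  have [[Xw _ dual lin] [_ ell_eq0 Ew]] := red.
  apply: (multiplicity (w := w)) => [i|c c0' bc i]; first by rewrite inE => /eqP/Ew.
  rewrite -(shifted_diag_coord red c i); apply: ell_eq0 => //.
  exact: (lin_closed_sum Xlin).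
(* Under nu < lam k, every index in [s] lies in [p, k), which leaves room for at most k - p of them,
   fewer than the number of zero eigenvalues. *)
have : {subset s <= iota p (k - p)}.
  move=> j js; rewrite mem_iota subnKC//; apply/andP; split.
    rewrite leqNgt; apply/negP => jp.
    have p0 : (0 < p)%N by exact: leq_ltn_trans jp.
    have : lam p.-1 <= nu - e1.
      apply: IH; first by rewrite prednK.
      by rewrite prednK.
    have := lam_homo (j := j) (k := p.-1); rewrite -ltnS prednK// => /(_ jp).
    by rewrite (snu _ js); move: e10; lra.
  by rewrite ltnNge; apply/negP => /lam_homo; rewrite (snu _ js) leNgt nulam.
move=> /(uniq_leq_size us); rewrite size_iota => sk.
have := leq_trans ns sk; rewrite leqNgt => /negP; apply.
by rewrite ltn_subLR//.
Qed.

End MinMax.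

Section TestFamilies.
Context {R : realType} {V : lmodType R[i]}.

(** One family serves both forms, since they act on the same vectors with the same [b]. This reduces
    the comparison of operators to one of forms. *)
Lemma test_family_transfer (X X' : V -> Prop) (h h' b : V -> V -> R[i]) n mu :
  lin_closed X -> (forall u, X u -> X' u /\ qform h' u <= qform h u) ->
  test_family X h b n mu -> test_family X' h' b n mu.
Proof.
move=> Xlin XX' [J [A [psi [nA Xpsi H]]]]; exists J, A, psi; split=> //.
  by move=> j; have [] := XX' _ (Xpsi j).
move=> c cA cn0; have [b0 hb] := H c cA cn0; split=> //.
by apply: le_trans hb; apply: (XX' _ _).2; exact: (lin_closed_sum Xlin).
Qed.

Variables (X : V -> Prop) (h b : V -> V -> R[i]) (E : R -> V -> Prop).
Hypotheses (Xlin : lin_closed X) (hH : herm_form X h) (bH : herm_form X b).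
Hypothesis b_ge0 : forall u, X u -> 0 <= qform b u.
Hypothesis EX : forall nu v, E nu v -> X v.
Hypothesis hE : forall nu v f, E nu v -> X f -> h v f = nu%:C * b v f.

Lemma eigen_orth nu mu v w : E nu v -> E mu w -> nu != mu -> b v w = 0.
Proof.
move=> Ev Ew numu; have Xv := EX Ev; have Xw := EX Ew.
have := hE Ev Xw; rewrite (herm_formC hH Xv Xw) (hE Ew Xv) conjcM conjc_real.
rewrite -(herm_formC bH Xv Xw) => /eqP; rewrite -subr_eq0 -mulrBl mulf_eq0.
rewrite -rmorphB/= => /orP[|/eqP//].
rewrite -[0]/(0%:C) (inj_eq (@complexI R)) subr_eq0 eq_sym.
by rewrite (negbTE numu).
Qed.

(** Independence is assumed within each eigenvalue only, which is what an eigenvalue enumeration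
    provides; different eigenvalues are separated by orthogonality. *)
Lemma test_family_eigen n (nu : 'I_n -> R) (psi : 'I_n -> V) mu :
  (forall i, E (nu i) (psi i)) -> (forall i, nu i <= mu) ->
  (forall i0 (c : 'I_n -> R[i]), (forall i, nu i != nu i0 -> c i = 0) ->
     qform b (\sum_i c i *: psi i) = 0 -> forall i, c i = 0) ->
  test_family X h b n mu.
Proof.
move=> Epsi nu_le indep.
have Xpsi i : X (psi i) by exact: EX (Epsi i).
have Xs c : X (\sum_i c i *: psi i) by exact: (lin_closed_sum Xlin).
exists 'I_n, [set: 'I_n], psi; split => //; first by rewrite cardsT card_ord.
move=> c _ [i0 ci0]; set f := \sum_j _; have Xf : X f by exact: Xs.
split.
  rewrite lt_neqAle b_ge0// andbT; apply: contraNneq ci0 => /esym bf.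
  (* The part of [f] belonging to one eigenvalue; by orthogonality b(f', f') equals b(f', f), which
     is 0 as [f] is null. *)
  pose c' i := if nu i == nu i0 then c i else 0.
  pose f' := \sum_i c' i *: psi i; have Xf' : X f' by exact: Xs.
  suff : c' i0 = 0 by rewrite /c' eqxx => ->.
  apply: (indep i0); first by move=> i /negbTE ni; rewrite /c' ni.
  have bf' : b f' f = 0 by exact: (qform_eq0_orth Xlin bH b_ge0).
  rewrite -/f' /qform -[RHS]/(complex.Re (0 : R[i])) -bf'; congr complex.Re.
  rewrite !(herm_form_suml Xlin bH)//; apply: eq_bigr => i _.
  rewrite /c'; case: eqP => [ni|]; last by rewrite !mul0r.
  congr (_ * _); rewrite !(herm_form_sumr Xlin bH)//; apply: eq_bigr => j _.
  rewrite /c'; case: eqP => // nj; rewrite (eigen_orth (Epsi i) (Epsi j)) ?mulr0//.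
  by rewrite ni; apply/eqP => H; apply: nj.
(* By orthogonality [mu b - h] is [b] evaluated at the combination with the
   coefficients [c i * s i]. *)
pose s i := Num.sqrt (mu - nu i).
have s2 i : s i * s i = mu - nu i by rewrite -expr2 sqr_sqrtr// subr_ge0.
have := b_ge0 (Xs (fun i => c i * (s i)%:C)).
rewrite -(lerD2l (qform h f)) addr0 => /le_trans; apply.
rewrite le_eqVlt; apply/orP; left; apply/eqP.
pose q := \sum_i c i * (nu i)%:C * b (psi i) f.
pose r := \sum_i c i * (mu - nu i)%:C * b (psi i) f.
have hf : qform h f = complex.Re q.
  rewrite /qform {1}/f (herm_form_suml Xlin hH)//; congr complex.Re.
  by apply: eq_bigr => i _; rewrite (hE (Epsi i))// mulrA.
have -> : qform b (\sum_i (c i * (s i)%:C) *: psi i) = complex.Re r.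
  rewrite /qform (herm_form_suml Xlin bH)//; congr complex.Re.
  apply: eq_bigr => i _; rewrite !(herm_form_sumr Xlin bH)// !mulr_sumr.
  apply: eq_bigr => j _; rewrite conjcM conjc_real.
  have [nij|nij] := eqVneq (nu i) (nu j).
    have -> : s j = s i by rewrite /s nij.
    by rewrite -s2 rmorphM/=; ring.
  by rewrite (eigen_orth (Epsi i) (Epsi j) nij) !mulr0.
have -> : mu * qform b f = complex.Re (q + r).
  rewrite /qform -complex_ReZ {1}/f (herm_form_suml Xlin bH)// mulr_sumr -big_split/=.
  by congr complex.Re; apply: eq_bigr => i _; rewrite rmorphB/=; ring.
by rewrite hf complex_ReD.
Qed.

End TestFamilies.

(** * The quadratic form of the Schroedinger operator *)

Section ComplexIntegral.
Context {R : realType}.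
Implicit Types (l a b : R) (f g : R -> R[i]).

Definition cbmeas l f : Prop :=
  bmeas l (fun x => complex.Re (f x)) /\ bmeas l (fun x => complex.Im (f x)).

Definition cint a b f : R[i] :=
  itg a b (fun x => complex.Re (f x)) +i* itg a b (fun x => complex.Im (f x)).

Definition cprim l f g : Prop :=
  prim l (fun x => complex.Re (f x)) (fun x => complex.Re (g x)) /\
  prim l (fun x => complex.Im (f x)) (fun x => complex.Im (g x)).

Lemma eq_cbmeas l f g : (forall x, 0 <= x <= l -> f x = g x) ->
  cbmeas l f -> cbmeas l g.
Proof.
move=> fg [bR bI]; split; [move: bR | move: bI]; apply: eq_bmeas => x xl;
  by rewrite fg.
Qed.

Lemma cbmeas_cst l (c : R[i]) : cbmeas l (fun=> c).
Proof. by split; exact: bmeas_cst. Qed.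

Lemma cbmeas_real l (p : R -> R) : bmeas l p -> cbmeas l (fun x => (p x)%:C).
Proof. by move=> bp; split=> //=; exact: bmeas_cst. Qed.

Lemma cbmeasD l f g : cbmeas l f -> cbmeas l g -> cbmeas l (fun x => f x + g x).
Proof.
move=> [fR fI] [gR gI]; split.
- by apply: (eq_bmeas _ (bmeasD fR gR)) => x _; rewrite complex_ReD.
- by apply: (eq_bmeas _ (bmeasD fI gI)) => x _; rewrite complex_ImD.
Qed.

Lemma cbmeasM l f g : cbmeas l f -> cbmeas l g -> cbmeas l (fun x => f x * g x).
Proof.
move=> [fR fI] [gR gI]; split.
- apply: (eq_bmeas _ (bmeasB (bmeasM fR gR) (bmeasM fI gI))) => x _.
  by rewrite complex_ReM.
- apply: (eq_bmeas _ (bmeasD (bmeasM fR gI) (bmeasM fI gR))) => x _.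
  by rewrite complex_ImM.
Qed.

Lemma cbmeasZ l (c : R[i]) f : cbmeas l f -> cbmeas l (fun x => c * f x).
Proof. by move=> bf; apply: cbmeasM => //; exact: cbmeas_cst. Qed.

Lemma cbmeasN l f : cbmeas l f -> cbmeas l (fun x => - f x).
Proof.
move=> /(cbmeasZ (-1)); apply: eq_cbmeas => x _; exact: mulN1r.
Qed.

Lemma cbmeasB l f g : cbmeas l f -> cbmeas l g -> cbmeas l (fun x => f x - g x).
Proof. by move=> bf bg; apply: cbmeasD => //; exact: cbmeasN. Qed.

Lemma cbmeasJ l f : cbmeas l f -> cbmeas l (fun x => conjc (f x)).
Proof.
move=> [fR fI]; split.
- by apply: (eq_bmeas _ fR) => x _; rewrite complex_ReJ.
- by apply: (eq_bmeas _ (bmeasN fI)) => x _; rewrite complex_ImJ.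
Qed.

Lemma cbmeas_sum (I : Type) (r : seq I) (P : pred I) l (F : I -> R -> R[i]) :
  (forall i, P i -> cbmeas l (F i)) ->
  cbmeas l (fun x => \sum_(i <- r | P i) F i x).
Proof.
move=> bF; elim: r => [|i r IH].
  by apply: (eq_cbmeas _ (cbmeas_cst l 0)) => x _; rewrite big_nil.
case Pi : (P i); last first.
  by apply: (eq_cbmeas _ IH) => x _; rewrite big_cons Pi.
by apply: (eq_cbmeas _ (cbmeasD (bF i Pi) IH)) => x _; rewrite big_cons Pi.
Qed.

Lemma eq_cint a b f g : (forall x, a <= x <= b -> f x = g x) -> cint a b f = cint a b g.
Proof. by move=> fg; congr (_ +i* _); apply: eq_itg => x /fg ->. Qed.

Lemma cintD l f g : cbmeas l f -> cbmeas l g ->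
  cint 0 l (fun x => f x + g x) = cint 0 l f + cint 0 l g.
Proof.
move=> [fR fI] [gR gI]; rewrite /cint; apply/eqP; rewrite eq_complex/=.
rewrite -(itgD (lexx 0) (lexx l) fR gR) -(itgD (lexx 0) (lexx l) fI gI).
by apply/andP; split; apply/eqP; apply: eq_itg => x _;
  rewrite ?complex_ReD ?complex_ImD.
Qed.

Lemma cintZ l (c : R[i]) f : cbmeas l f ->
  cint 0 l (fun x => c * f x) = c * cint 0 l f.
Proof.
move=> [fR fI]; rewrite /cint; apply/eqP; rewrite eq_complex.
rewrite complex_ReM complex_ImM /=.
have l0 := lexx (0 : R); have ll := lexx l.
rewrite -!(itgZ _ l0 ll fR) -!(itgZ _ l0 ll fI).
rewrite -(itgB l0 ll (bmeasZ _ fR) (bmeasZ _ fI)) -(itgD l0 ll (bmeasZ _ fI) (bmeasZ _ fR)).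
by apply/andP; split; apply/eqP; apply: eq_itg => x _;
  rewrite ?complex_ReM ?complex_ImM.
Qed.

Lemma cintJ l f : cbmeas l f -> cint 0 l (fun x => conjc (f x)) = conjc (cint 0 l f).
Proof.
move=> [fR fI]; rewrite /cint/=; congr (_ +i* _).
  by apply: eq_itg => x _; rewrite complex_ReJ.
rewrite -(itgN (lexx 0) (lexx l) fI).
by apply: eq_itg => x _; rewrite complex_ImJ.
Qed.

Lemma cintN l f : cbmeas l f -> cint 0 l (fun x => - f x) = - cint 0 l f.
Proof.
move=> bf; rewrite -mulN1r -cintZ//.
by apply: eq_cint => x _; rewrite mulN1r.
Qed.

Lemma cint_sum (I : Type) (r : seq I) (P : pred I) l (F : I -> R -> R[i]) :
  0 <= l -> (forall i, P i -> cbmeas l (F i)) ->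
  cint 0 l (fun x => \sum_(i <- r | P i) F i x) =
  \sum_(i <- r | P i) cint 0 l (F i).
Proof.
move=> l0 bF; elim: r => [|i r IH].
  under eq_cint do rewrite big_nil.
  by rewrite big_nil /cint/= itg_cst// mul0r.
under eq_cint do rewrite big_cons.
rewrite big_cons; case: (boolP (P i)) => // Pi.
by rewrite cintD ?IH//; [exact: bF | exact: cbmeas_sum].
Qed.

Lemma eq_cprim l f g f' g' : (forall x, 0 <= x <= l -> f x = g x) ->
  (forall x, 0 <= x <= l -> f' x = g' x) -> cprim l f f' -> cprim l g g'.
Proof.
move=> fg fg' [pR pI]; split; [move: pR | move: pI]; apply: eq_prim => x xl;
  by rewrite ?fg ?fg'.
Qed.

Lemma cprim_cst l (c : R[i]) : cprim l (fun=> c) (fun=> 0).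
Proof. by split; exact: prim_cst. Qed.

Lemma cprim_real l (u u' : R -> R) : prim l u u' ->
  cprim l (fun x => (u x)%:C) (fun x => (u' x)%:C).
Proof. by move=> pu; split=> //=; exact: prim_cst. Qed.

Lemma cprimD l f g f' g' : cprim l f f' -> cprim l g g' ->
  cprim l (fun x => f x + g x) (fun x => f' x + g' x).
Proof.
move=> [fR fI] [gR gI]; split.
- by apply: (eq_prim _ _ (primD fR gR)) => x _; rewrite complex_ReD.
- by apply: (eq_prim _ _ (primD fI gI)) => x _; rewrite complex_ImD.
Qed.

Lemma cprimJ l f f' : cprim l f f' ->
  cprim l (fun x => conjc (f x)) (fun x => conjc (f' x)).
Proof.
move=> [fR fI]; split.
- by apply: (eq_prim _ _ fR) => x _; rewrite complex_ReJ.
- by apply: (eq_prim _ _ (primN fI)) => x _; rewrite complex_ImJ.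
Qed.

Lemma cprimM l f g f' g' : 0 <= l -> cprim l f f' -> cprim l g g' ->
  cprim l (fun x => f x * g x) (fun x => f' x * g x + f x * g' x).
Proof.
move=> l0 [fR fI] [gR gI]; split.
- apply: (eq_prim _ _ (primB (primM l0 fR gR) (primM l0 fI gI))) => x _.
    by rewrite complex_ReM.
  by rewrite complex_ReD !complex_ReM; ring.
- apply: (eq_prim _ _ (primD (primM l0 fR gI) (primM l0 fI gR))) => x _.
    by rewrite complex_ImM.
  by rewrite complex_ImD !complex_ImM; ring.
Qed.

Lemma cprimZ l (c : R[i]) f f' : 0 <= l -> cprim l f f' ->
  cprim l (fun x => c * f x) (fun x => c * f' x).
Proof.
move=> l0 pf; apply: (eq_cprim _ _ (cprimM l0 (cprim_cst l c) pf)) => x _ //.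
by rewrite mul0r add0r.
Qed.

Lemma cprim_sum (I : Type) (r : seq I) (P : pred I) l (F F' : I -> R -> R[i]) :
  (forall i, P i -> cprim l (F i) (F' i)) ->
  cprim l (fun x => \sum_(i <- r | P i) F i x) (fun x => \sum_(i <- r | P i) F' i x).
Proof.
move=> pF; elim: r => [|i r IH].
  by apply: (eq_cprim _ _ (cprim_cst l 0)) => x _; rewrite big_nil.
case Pi : (P i); last first.
  by apply: (eq_cprim _ _ IH) => x _; rewrite big_cons Pi.
by apply: (eq_cprim _ _ (cprimD (pF i Pi) IH)) => x _; rewrite big_cons Pi.
Qed.

Lemma cprim_cbmeas l f f' : 0 <= l -> cprim l f f' -> cbmeas l f.
Proof. by move=> l0 [pR pI]; split; [exact: prim_bmeas pR|exact: prim_bmeas pI]. Qed.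

Lemma cprim_cbmeas' l f f' : cprim l f f' -> cbmeas l f'.
Proof. by move=> [[bR _] [bI _]]. Qed.

Lemma cint_cprim l f f' : 0 <= l -> cprim l f f' -> cint 0 l f' = f l - f 0.
Proof.
move=> l0 [pR pI]; rewrite /cint -(prim_sub pR)// -(prim_sub pI)//.
by case: (f l); case: (f 0).
Qed.

Lemma cint_Re l f : complex.Re (cint 0 l f) = itg 0 l (fun x => complex.Re (f x)).
Proof. by []. Qed.

End ComplexIntegral.

Arguments cint {R} a b f : simpl never.

Section Dot.
Context {R : realType} {d : nat}.
Implicit Types (A B : 'cV[R[i]]_d) (M : 'M[R[i]]_d).

Definition cdot A B : R[i] := \sum_j A j 0 * conjc (B j 0).

Lemma cdotDl A B D : cdot (A + B) D = cdot A D + cdot B D.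
Proof. by rewrite /cdot -big_split/=; apply: eq_bigr => j _; rewrite mxE mulrDl. Qed.

Lemma cdotZl a A B : cdot (a *: A) B = a * cdot A B.
Proof. by rewrite /cdot mulr_sumr; apply: eq_bigr => j _; rewrite mxE mulrA. Qed.

Lemma cdotC A B : cdot A B = conjc (cdot B A).
Proof.
rewrite /cdot rmorph_sum; apply: eq_bigr => j _.
by rewrite /= conjcM conjcK mulrC.
Qed.

Lemma cdotDr A B D : cdot D (A + B) = cdot D A + cdot D B.
Proof. by rewrite cdotC cdotDl rmorphD/= -!cdotC. Qed.

Lemma cdot0l B : cdot 0 B = 0.
Proof. by rewrite /cdot big1// => j _; rewrite mxE mul0r. Qed.

Lemma hermsymmxE M : M \is hermsymmx -> forall j k, M j k = conjc (M k j).
Proof.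
move=> /is_hermitianmxP; rewrite expr0 scale1r => /matrixP H j k.
by rewrite H !mxE.
Qed.

Lemma cdot_herm M A B : M \is hermsymmx -> cdot (M *m A) B = cdot A (M *m B).
Proof.
move=> /hermsymmxE MH; rewrite /cdot.
under eq_bigr do rewrite mxE mulr_suml.
under [RHS]eq_bigr do rewrite mxE rmorph_sum mulr_sumr.
rewrite exchange_big/=; apply: eq_bigr => j _; apply: eq_bigr => k _.
by rewrite /= conjcM -MH; ring.
Qed.

Lemma satisfies_cdot (K : vertex_cond R d) F F' A :
  satisfies K F F' -> PD K *m A = 0 -> cdot F' A = cdot (Lam K *m F) A.
Proof.
move=> [_ PNF PRF] PDA.
have -> : Lam K *m F = PR K *m F'.
  rewrite PRF mulmxA; congr (_ *m _).
  by rewrite -[in RHS](Lam_ran K) -!mulmxA PR_idem !mulmxA Lam_ran.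
have -> : A = PN K *m A + PR K *m A.
  by rewrite -[LHS]mul1mx -(P_sum K) !mulmxDl PDA add0r.
rewrite !cdotDr -!(cdot_herm _ _ (PN_herm K)) -!(cdot_herm _ _ (PR_herm K)).
rewrite PNF cdot0l add0r !mulmxA PR_idem.
have -> : PN K *m PR K = 0.
  have /is_hermitianmxP := PN_herm K; rewrite expr0 scale1r => {1}->.
  exact: PNR_orth.
by rewrite mul0mx cdot0l add0r.
Qed.

End Dot.

Section GraphForms.
Context {R : realType} (G : metric_graph R).
Variables (q : edge G -> R -> R) (K : forall v : vert G, vertex_cond R (deg v)).

(* [f false] is a function on the graph and [f true] its derivative. *)
Definition gpair : lmodType R[i] := (bool -> edge G -> R -> R[i]^o)%type.

Definition gprim (f : gpair) : Prop := forall e, cprim (len e) (f false e) (f true e).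

(** Only the [PD] part is imposed; the other conditions are natural ones and are encoded in
    [vertex_form]. *)
Definition form_dom (f : gpair) : Prop :=
  gprim f /\ forall v, PD (K v) *m bvec (f false) v = 0.

Definition l2form (f g : gpair) : R[i] :=
  \sum_e cint 0 (len e) (fun x => f false e x * conjc (g false e x)).

Definition edge_form (f g : gpair) : R[i] :=
  \sum_e cint 0 (len e) (fun x => f true e x * conjc (g true e x) +
                                  (q e x)%:C * (f false e x * conjc (g false e x))).

Definition vertex_form (f g : gpair) : R[i] :=
  \sum_v cdot (Lam (K v) *m bvec (f false) v) (bvec (g false) v).

Definition hform (f g : gpair) : R[i] := edge_form f g + vertex_form f g.

(** A subspace of the operator domain: the second derivative is bounded instead of square
    integrable. *)
Definition op_dom (f : gpair) (f2 : gfun G) : Prop :=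
  [/\ gprim f, forall e, cprim (len e) (f true e) (f2 e)
    & forall v, satisfies (K v) (bvec (f false) v) (bvec' (f true) v)].

(** The equation -f'' + q f = nu f, solved for f''. *)
Definition eigenfun (nu : R) (f : gpair) : Prop :=
  op_dom f (fun e x => ((q e x)%:C - nu%:C) * f false e x).

Hypothesis bq : forall e, bmeas (len e) (q e).

Let l0 (e : edge G) : 0 <= len e. Proof. exact/ltW/len_gt0. Qed.

Lemma bvec_lin (a : R[i]) (f g : gfun G) v :
  bvec (a *: (f : edge G -> R -> R[i]^o) + g) v = a *: bvec f v + bvec g v.
Proof.
by apply/matrixP => i j; rewrite !mxE; case: fintype.split => k; rewrite !mxE.
Qed.

Lemma bvec'_lin (a : R[i]) (f g : gfun G) v :
  bvec' (a *: (f : edge G -> R -> R[i]^o) + g) v = a *: bvec' f v + bvec' g v.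
Proof.
apply/matrixP => i j; rewrite !mxE; case: fintype.split => k; rewrite !mxE//=.
by rewrite opprD mulrN.
Qed.

Lemma gpair_lin (a : R[i]) (f g : gpair) s e x :
  (a *: f + g) s e x = a * f s e x + g s e x.
Proof. by []. Qed.

Lemma gprim_lin (a : R[i]) (f g : gpair) : gprim f -> gprim g -> gprim (a *: f + g).
Proof.
move=> pf pg e; apply: (eq_cprim _ _ (cprimD (cprimZ a (l0 e) (pf e)) (pg e))) => x _;
  by rewrite ?gpair_lin.
Qed.

Lemma gprim0 : gprim 0.
Proof. by move=> e; exact: cprim_cst. Qed.

Lemma lin_closed_gprim : lin_closed gprim.
Proof. by split; [exact: gprim0 | exact: gprim_lin]. Qed.

Lemma bvec0 v : bvec (0 : edge G -> R -> R[i]^o) v = 0.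
Proof. by apply/matrixP => i j; rewrite !mxE; case: fintype.split => k; rewrite !mxE. Qed.

Lemma lin_closed_form_dom : lin_closed form_dom.
Proof.
split; first by split; [exact: gprim0 | move=> v; rewrite bvec0 mulmx0].
move=> a f g [pf Df] [pg Dg]; split; first exact: gprim_lin.
by move=> v; rewrite bvec_lin mulmxDr -scalemxAr Df Dg scaler0 addr0.
Qed.

Section Integrands.
Variables (f g : gpair).
Hypotheses (pf : gprim f) (pg : gprim g).

Lemma gprim_cbmeas e : cbmeas (len e) (f false e).
Proof. exact: (cprim_cbmeas (l0 e) (pf e)). Qed.

Lemma cbmeas_l2 e : cbmeas (len e) (fun x => f false e x * conjc (g false e x)).
Proof.
apply: cbmeasM; first exact: gprim_cbmeas.
exact/cbmeasJ/(cprim_cbmeas (l0 e) (pg e)).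
Qed.

Lemma cbmeas_deriv e : cbmeas (len e) (fun x => f true e x * conjc (g true e x)).
Proof.
apply: cbmeasM; first exact: (cprim_cbmeas' (pf e)).
exact/cbmeasJ/(cprim_cbmeas' (pg e)).
Qed.

Lemma cbmeas_pot e :
  cbmeas (len e) (fun x => (q e x)%:C * (f false e x * conjc (g false e x))).
Proof. by apply: cbmeasM; [exact: cbmeas_real | exact: cbmeas_l2]. Qed.

Lemma cbmeas_edge e : cbmeas (len e) (fun x => f true e x * conjc (g true e x) +
                                  (q e x)%:C * (f false e x * conjc (g false e x))).
Proof. by apply: cbmeasD; [exact: cbmeas_deriv | exact: cbmeas_pot]. Qed.

End Integrands.

Lemma herm_form_l2 : herm_form gprim l2form.
Proof.
split=> [a f g k pf pg pk | f g pf pg].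
  rewrite /l2form mulr_sumr -big_split; apply: eq_bigr => e _; rewrite [RHS]/=.
  rewrite -cintZ; last exact: cbmeas_l2.
  rewrite -cintD; [|exact/cbmeasZ/cbmeas_l2|exact: cbmeas_l2].
  by apply: eq_cint => x _; rewrite gpair_lin mulrDl mulrA.
rewrite /l2form rmorph_sum; apply: eq_bigr => e _.
rewrite -[RHS]/(conjc (cint 0 (len e) _)) -cintJ; last exact: cbmeas_l2.
by apply: eq_cint => x _; rewrite conjcM conjcK mulrC.
Qed.

Lemma herm_form_edge : herm_form gprim edge_form.
Proof.
split=> [a f g k pf pg pk | f g pf pg].
  rewrite /edge_form mulr_sumr -big_split; apply: eq_bigr => e _; rewrite [RHS]/=.
  rewrite -cintZ; last exact: cbmeas_edge.
  rewrite -cintD; [|exact/cbmeasZ/cbmeas_edge|exact: cbmeas_edge].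
  apply: eq_cint => x _; rewrite !gpair_lin; ring.
rewrite /edge_form rmorph_sum; apply: eq_bigr => e _.
rewrite -[RHS]/(conjc (cint 0 (len e) _)) -cintJ; last exact: cbmeas_edge.
apply: eq_cint => x _; rewrite rmorphD/= !conjcM !conjcK conjc_real.
by ring.
Qed.

Lemma herm_form_vertex : herm_form (fun=> True) vertex_form.
Proof.
split=> [a f g k _ _ _ | f g _ _].
  rewrite /vertex_form mulr_sumr -big_split/=; apply: eq_bigr => v _.
  by rewrite bvec_lin mulmxDr -scalemxAr cdotDl cdotZl.
rewrite /vertex_form rmorph_sum; apply: eq_bigr => v _.
by rewrite (cdot_herm _ _ (Lam_herm (K v))) cdotC.
Qed.

Lemma herm_form_hform : herm_form form_dom hform.
Proof.
split=> [a f g k [pf _] [pg _] [pk _] | f g [pf _] [pg _]]; rewrite /hform.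
  by rewrite (proj1 herm_form_edge)// (proj1 herm_form_vertex)//; ring.
by rewrite (proj2 herm_form_edge)// (proj2 herm_form_vertex)// rmorphD.
Qed.

Lemma herm_form_l2_dom : herm_form form_dom l2form.
Proof.
split=> [a f g k [pf _] [pg _] [pk _] | f g [pf _] [pg _]].
  by rewrite (proj1 herm_form_l2).
exact: (proj2 herm_form_l2).
Qed.

Lemma qform_l2E f : qform l2form f = \sum_e itg 0 (len e) (fun x => sqnorm (f false e x)).
Proof.
rewrite /qform /l2form complex_Re_sum; apply: eq_bigr => e _.
by apply: eq_itg => x _; rewrite /sqnorm; case: (f false e x) => a b /=; ring.
Qed.

Lemma l2form_ge0 f : 0 <= qform l2form f.
Proof.
rewrite qform_l2E sumr_ge0// => e _; apply: itg_ge0 => x _.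
by rewrite addr_ge0// sqr_ge0.
Qed.

Lemma cdot_bvec' (f g : gfun G) v : cdot (bvec' f v) (bvec g v) =
  \sum_(e <- Ei v) f e 0 * conjc (g e 0) -
  \sum_(e <- Et v) f e (len e) * conjc (g e (len e)).
Proof.
rewrite /cdot (big_tnth _ _ (Ei v)) (big_tnth _ _ (Et v)).
rewrite /deg big_split_ord/=; congr (_ + _).
  by apply: eq_bigr => j _; rewrite !col_mxEu !mxE.
rewrite -sumrN; apply: eq_bigr => j _.
by rewrite !col_mxEd !mxE mulNr.
Qed.

Lemma sum_init (phi : edge G -> R[i]) : \sum_v \sum_(e <- Ei v) phi e = \sum_e phi e.
Proof.
rewrite [RHS](partition_big (@init R G) xpredT)//=; apply: eq_bigr => v _.
rewrite big_uniq ?Ei_uniq//=; apply: eq_bigl => e.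
by rewrite mem_Ei.
Qed.

Lemma sum_term (phi : edge G -> R[i]) : \sum_v \sum_(e <- Et v) phi e = \sum_e phi e.
Proof.
rewrite [RHS](partition_big (@term R G) xpredT)//=; apply: eq_bigr => v _.
rewrite big_uniq ?Et_uniq//=; apply: eq_bigl => e.
by rewrite mem_Et.
Qed.

(** Integration by parts on every edge. With the sign in [bvec'], the vertex terms cancel the
    boundary terms once they are regrouped from vertices to edges. *)
Lemma green f f2 g : op_dom f f2 -> form_dom g ->
  hform f g = \sum_e cint 0 (len e)
    (fun x => (- f2 e x + (q e x)%:C * f false e x) * conjc (g false e x)).
Proof.
move=> [pf pf' sf] [pg Dg].
have bf2 e : cbmeas (len e) (fun x => f2 e x * conjc (g false e x)).
  apply: cbmeasM; first exact: (cprim_cbmeas' (pf' e)).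
  exact/cbmeasJ/gprim_cbmeas.
have edgeE e : cint 0 (len e) (fun x => f true e x * conjc (g true e x)) =
    f true e (len e) * conjc (g false e (len e)) - f true e 0 * conjc (g false e 0) -
    cint 0 (len e) (fun x => f2 e x * conjc (g false e x)).
  have := cprimM (l0 e) (pf' e) (cprimJ (pg e)).
  move=> /(cint_cprim (l0 e)) <-.
  rewrite cintD//; last exact: cbmeas_deriv.
  by rewrite addrC addKr.
rewrite /hform /edge_form.
have -> : vertex_form f g = \sum_v cdot (bvec' (f true) v) (bvec (g false) v).
  by apply: eq_bigr => v _; rewrite (satisfies_cdot (sf v) (Dg v)).
under [X in _ + X]eq_bigr do rewrite cdot_bvec'.
rewrite sumrB sum_init sum_term -sumrB -big_split/=; apply: eq_bigr => e _.
rewrite cintD ?edgeE; [|exact: cbmeas_deriv|exact: cbmeas_pot].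
rewrite [RHS](_ : _ = - cint 0 (len e) (fun x => f2 e x * conjc (g false e x)) +
   cint 0 (len e) (fun x => (q e x)%:C * (f false e x * conjc (g false e x)))).
  by ring.
rewrite -cintN// -cintD; [|exact: cbmeasN|exact: cbmeas_pot].
by apply: eq_cint => x _; ring.
Qed.

Lemma op_dom_form_dom f f2 : op_dom f f2 -> form_dom f.
Proof. by move=> [pf _ sf]; split=> // v; have [] := sf v. Qed.

Lemma eigenfun_form_dom nu f : eigenfun nu f -> form_dom f.
Proof. exact: op_dom_form_dom. Qed.

Lemma hform_eigenfun nu f g : eigenfun nu f -> form_dom g ->
  hform f g = nu%:C * l2form f g.
Proof.
move=> Ef Xg; rewrite (green Ef Xg) /l2form mulr_sumr; apply: eq_bigr => e _.
rewrite -cintZ; last by apply: cbmeas_l2; [case: Ef | case: Xg].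
by apply: eq_cint => x _; ring.
Qed.

End GraphForms.

(** * Coercivity on functions without cell averages *)

Section LowerBound.
Context {R : realType} (G : metric_graph R).
Variables (q : edge G -> R -> R) (K : forall v : vert G, vertex_cond R (deg v)).
Hypothesis bq : forall e, bmeas (len e) (q e).

Let l0 (e : edge G) : 0 <= len e. Proof. exact/ltW/len_gt0. Qed.

Definition cell_size (n : nat) (e : edge G) : R := len e / n%:R.

Definition cell_lo (n : nat) (e : edge G) (i : nat) : R := cell_size n e * i%:R.

Definition cell_ind (n : nat) (e : edge G) (i : nat) (x : R) : R :=
  \1_(`[cell_lo n e i, cell_lo n e i.+1[%classic : set R) x.

(** The integral over a cell, that is, the cell average times [cell_size]. *)
Definition cell_coef (n : nat) (i : edge G * 'I_n) (f : gpair G) : R[i] :=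
  cint 0 (len i.1) (fun x => (cell_ind n i.1 i.2 x)%:C * f false i.1 x).

Lemma cell_size_gt0 n e : (0 < n)%N -> 0 < cell_size n e.
Proof. by move=> n0; rewrite divr_gt0 ?ltr0n// len_gt0. Qed.

Lemma cell_lo_ge0 n e i : 0 <= cell_lo n e i.
Proof. by rewrite mulr_ge0// divr_ge0. Qed.

Lemma cell_lo_lt n e i j : (0 < n)%N -> (i < j)%N -> cell_lo n e i < cell_lo n e j.
Proof. by move=> n0 ij; rewrite /cell_lo ltr_pM2l ?cell_size_gt0// ltr_nat. Qed.

Lemma cell_lo_le_len n e i : (i <= n)%N -> cell_lo n e i <= len e.
Proof.
case: n => [|n] ni; first by move: ni; rewrite leqn0 => /eqP ->; rewrite /cell_lo mulr0.
by rewrite /cell_lo /cell_size mulrAC ler_pdivrMr ?ltr0n// ler_wpM2l// ler_nat.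
Qed.

Lemma cell_width n e i : cell_lo n e i.+1 - cell_lo n e i = cell_size n e.
Proof. by rewrite /cell_lo -natr1; ring. Qed.

Lemma bmeas_cell_ind n e i : bmeas (len e) (cell_ind n e i).
Proof. exact: bmeas_indic_itv. Qed.

Lemma cell_cover n e x : (0 < n)%N -> 0 <= x <= len e ->
  exists i : 'I_n, cell_lo n e i <= x <= cell_lo n e i.+1.
Proof.
move=> n0 /andP[x0 xl].
suff H m : (m <= n)%N -> x <= cell_lo n e m -> (0 < m)%N ->
    exists i : 'I_n, cell_lo n e i <= x <= cell_lo n e i.+1.
  apply: (H n) => //; rewrite /cell_lo /cell_size mulfVK//.
  by rewrite pnatr_eq0 -lt0n.
elim: m => // m IH mn xm _; case: (leP (cell_lo n e m) x) => mx.
  by exists (Ordinal mn); rewrite mx xm.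
apply: IH; [exact: ltnW | exact: ltW |].
rewrite lt0n; apply: contraL mx => /eqP ->.
by rewrite /cell_lo mulr0 -leNgt.
Qed.

Lemma cell_coef_Re n (i : edge G * 'I_n) (f : gpair G) : gprim f -> (0 < n)%N ->
  complex.Re (cell_coef i f) =
    itg (cell_lo n i.1 i.2) (cell_lo n i.1 i.2.+1) (fun x => complex.Re (f false i.1 x)) /\
  complex.Im (cell_coef i f) =
    itg (cell_lo n i.1 i.2) (cell_lo n i.1 i.2.+1) (fun x => complex.Im (f false i.1 x)).
Proof.
move=> pf n0; have [bR bI] := gprim_cbmeas pf i.1.
have lt_i := ltW (cell_lo_lt i.1 n0 (ltnSn i.2)).
have hi := cell_lo_le_len i.1 (ltn_ord i.2).
split; rewrite -(itg_indic (cell_lo_ge0 _ _ _) lt_i hi)//.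
- by apply: eq_itg => x _; rewrite complex_ReZ.
- by apply: eq_itg => x _; rewrite complex_ImM/= mul0r addr0.
Qed.

Definition edge_energy (f : gpair G) e : R := itg 0 (len e) (fun x => sqnorm (f true e x)).

(** The bound of [prim_sqr_le] on one cell, with the coefficients of all cells added so that it does
    not depend on the cell containing the point. *)
Definition edge_bound n (f : gpair G) e : R :=
  2 * (cell_size n e * edge_energy f e) +
  2 * (\sum_(i < n) sqnorm (cell_coef (e, i) f) / cell_size n e ^+ 2).

Lemma edge_energy_ge0 f e : 0 <= edge_energy f e.
Proof. by apply: itg_ge0 => x _; exact: sqnorm_ge0. Qed.

Lemma sqnorm_le_edge_bound n f e x : (0 < n)%N -> gprim f -> 0 <= x <= len e ->
  sqnorm (f false e x) <= edge_bound n f e.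
Proof.
move=> n0 pf xl; have [i xi] := cell_cover n0 xl; have [pR pI] := pf e.
have a0 := cell_lo_ge0 n e i; have ab := cell_lo_lt e n0 (ltnSn i).
have bl := cell_lo_le_len e (ltn_ord i).
have [cR cI] := cell_coef_Re (e, i) pf n0.
have := prim_sqr_le a0 ab bl xi pI; have := prim_sqr_le a0 ab bl xi pR.
rewrite cell_width -cR -cI => h1 h2.
have [b1 b2] := cprim_cbmeas' (pf e).
have -> : edge_bound n f e = 2 * (cell_size n e * edge_energy f e) +
    2 * (sqnorm (cell_coef (e, i) f) / cell_size n e ^+ 2) +
    2 * (\sum_(j < n | j != i) sqnorm (cell_coef (e, j) f) / cell_size n e ^+ 2).
  by rewrite /edge_bound (bigD1 i)//=; ring.
rewrite ler_wpDr//.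
  rewrite mulr_ge0// sumr_ge0// => j _; rewrite divr_ge0 ?sqnorm_ge0//.
  exact: exprn_even_ge0.
have -> : edge_energy f e = itg 0 (len e) (fun t => complex.Re (f true e t) ^+ 2) +
    itg 0 (len e) (fun t => complex.Im (f true e t) ^+ 2).
  by rewrite /edge_energy /sqnorm (itgD (lexx 0) (lexx (len e)))//; exact: bmeasM.
have -> : sqnorm (cell_coef (e, i) f) / cell_size n e ^+ 2 =
    (complex.Re (cell_coef (e, i) f) / cell_size n e) ^+ 2 +
    (complex.Im (cell_coef (e, i) f) / cell_size n e) ^+ 2.
  by rewrite /sqnorm mulrDl -!expr_div_n.
by rewrite /sqnorm; lra.
Qed.

Lemma normRe_cdot_le d (M : 'M[R[i]]_d) (F : 'cV[R[i]]_d) B :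
  (forall j, sqnorm (F j 0) <= B) ->
  `|complex.Re (cdot (M *m F) F)| <=
    (\sum_j \sum_k (`|complex.Re (M j k)| + `|complex.Im (M j k)|)) * B.
Proof.
move=> FB; rewrite /cdot complex_Re_sum mulr_suml.
apply: (le_trans (ler_norm_sum _ _ _)); apply: ler_sum => j _.
rewrite mxE mulr_suml complex_Re_sum mulr_suml.
apply: (le_trans (ler_norm_sum _ _ _)); apply: ler_sum => k _.
have := FB j; have := FB k; rewrite /sqnorm.
case: (F j 0) => x y; case: (F k 0) => z t; case: (M j k) => a b /= h1 h2.
have k1 : `|z * x + t * y| <= B.
  have := sqr_ge0 (x - z); have := sqr_ge0 (x + z).
  have := sqr_ge0 (y - t); have := sqr_ge0 (y + t).
  by rewrite ler_norml => *; apply/andP; split; lra.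
have k2 : `|t * x - z * y| <= B.
  have := sqr_ge0 (y - z); have := sqr_ge0 (y + z).
  have := sqr_ge0 (x - t); have := sqr_ge0 (x + t).
  by rewrite ler_norml => *; apply/andP; split; lra.
rewrite [X in `|X|](_ : _ = a * (z * x + t * y) - b * (t * x - z * y)); last by ring.
by rewrite (le_trans (ler_normB _ _))// !normrM mulrDl lerD// ler_wpM2l.
Qed.

(** The potential, the shift [nu] and the vertex terms are all controlled by sup |f|^2. By
    [edge_bound] this costs a multiple of the squared coefficients and a part of the energy
    proportional to the cell size, which is absorbed for large [n]. *)
Lemma hform_ge_coercive nu : exists (n : nat) (C : R), [/\ (0 < n)%N, 0 <= C &
  forall f : gpair G, gprim f ->
  nu * qform (@l2form R G) f - C * \sum_(i : edge G * 'I_n) sqnorm (cell_coef i f) <=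
  qform (hform q K) f].
Proof.
have [M Mq] : exists M : edge G -> R, forall e x, 0 <= x <= len e -> `|q e x| <= M e.
  have H e : exists m, forall x, 0 <= x <= len e -> `|q e x| <= m.
    by have [_ [m hm]] := bq e; exists m.
  by have [M HM] := choice H; exists M.
have M0 e : 0 <= M e by rewrite (le_trans (normr_ge0 (q e 0)))// Mq// lexx l0.
pose L v := \sum_j \sum_k (`|complex.Re (Lam (K v) j k)| + `|complex.Im (Lam (K v) j k)|).
have L_ge0 v : 0 <= L v.
  by rewrite sumr_ge0// => j _; rewrite sumr_ge0// => k _; rewrite addr_ge0.
(* With [B] the bound for |f|^2 introduced below, K0 B majorizes everything but the energy. *)
pose K0 := \sum_e (M e + `|nu|) * len e + \sum_v L v.
have K00 : 0 <= K0.
  rewrite addr_ge0// sumr_ge0// => e _; rewrite mulr_ge0// addr_ge0//.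
(* [n] exceeds 2 K0 len e for every edge at once, so that K0 times the energy factor 2 [cell_size]
   of [edge_bound] is at most 1. *)
pose n := (Num.truncn (\sum_(e : edge G) 2 * K0 * len e)).+1.
have hn e : 2 * K0 * cell_size n e <= 1.
  rewrite /cell_size mulrA ler_pdivrMr ?ltr0n// mul1r.
  apply: (@le_trans _ _ (\sum_(e : edge G) 2 * K0 * len e)).
    by rewrite (bigD1 e)//= lerDl sumr_ge0// => j _; rewrite !mulr_ge0.
  exact/ltW/truncnS_gt.
pose C := \sum_e K0 * 2 / cell_size n e ^+ 2.
have n0 : (0 < n)%N by [].
have d2 e : 0 <= K0 * 2 / cell_size n e ^+ 2.
  by rewrite divr_ge0 ?mulr_ge0// exprn_even_ge0.
exists n, C; split => //; first by rewrite /C sumr_ge0.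
move=> f pf.
pose B := \sum_e edge_bound n f e.
have Be0 e : 0 <= edge_bound n f e.
  apply: (le_trans (sqnorm_ge0 (f false e 0))).
  by apply: sqnorm_le_edge_bound; rewrite ?lexx ?l0.
have BB e : edge_bound n f e <= B.
  by rewrite /B (bigD1 e)//= lerDl sumr_ge0.
have fB e x : 0 <= x <= len e -> sqnorm (f false e x) <= B.
  by move=> xl; rewrite (le_trans _ (BB e))//; exact: sqnorm_le_edge_bound.
have B0 : 0 <= B by rewrite /B sumr_ge0.
have bsq e : bmeas (len e) (fun x => sqnorm (f false e x)).
  have [bR bI] := gprim_cbmeas pf e.
  by apply: bmeasD; exact: bmeasM.
have bsq2 e : bmeas (len e) (fun x => sqnorm (f true e x)).
  have [bR bI] := cprim_cbmeas' (pf e).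
  by apply: bmeasD; exact: bmeasM.
have edgeE : complex.Re (edge_form q f f) = \sum_e (edge_energy f e +
    itg 0 (len e) (fun x => q e x * sqnorm (f false e x))).
  rewrite /edge_form complex_Re_sum; apply: eq_bigr => e _.
  rewrite cint_Re -(itgD (lexx 0) (lexx (len e)))//; last exact: bmeasM.
  apply: eq_itg => x _; rewrite /sqnorm.
  by case: (f false e x) => a b; case: (f true e x) => c d /=; ring.
have potB e : nu * itg 0 (len e) (fun x => sqnorm (f false e x)) -
    itg 0 (len e) (fun x => q e x * sqnorm (f false e x)) <= (M e + `|nu|) * len e * B.
  rewrite -(itgZ _ (lexx 0) (lexx (len e)))//.
  rewrite -(itgB (lexx 0) (lexx (len e)) (bmeasZ _ (bsq e)) (bmeasM (bq e) (bsq e))).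
  rewrite [X in _ <= X](_ : _ = ((M e + `|nu|) * B) * (len e - 0)); last by ring.
  rewrite -itg_cst//; apply: (le_itg (lexx 0) (lexx (len e))).
  - by apply: bmeasB; [exact: bmeasZ | exact: bmeasM].
  - exact: bmeas_cst.
  move=> x xl; rewrite -mulrBl (@le_trans _ _ ((M e + `|nu|) * sqnorm (f false e x)))//.
    rewrite ler_wpM2r ?sqnorm_ge0//.
    by have := Mq e x xl; have := ler_norm nu; rewrite ler_norml => ? /andP[? ?]; lra.
  by rewrite ler_wpM2l ?fB// addr_ge0.
have vertB : - complex.Re (vertex_form K f f) <= (\sum_v L v) * B.
  rewrite /vertex_form complex_Re_sum -sumrN mulr_suml; apply: ler_sum => v _.
  rewrite (le_trans _ (@normRe_cdot_le _ (Lam (K v)) (bvec (f false) v) B _))//.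
    by rewrite -normrN ler_norm.
  move=> j; rewrite !mxE; case: fintype.split => k; rewrite mxE fB// ?lexx ?l0//.
have energyB : K0 * B <= \sum_e edge_energy f e +
    C * \sum_(i : edge G * 'I_n) sqnorm (cell_coef i f).
  have -> : \sum_(i : edge G * 'I_n) sqnorm (cell_coef i f) =
      \sum_e \sum_(i < n) sqnorm (cell_coef (e, i) f).
    by rewrite pair_bigA/=; apply: eq_bigr => -[].
  rewrite /B mulr_sumr mulr_sumr -big_split/=; apply: ler_sum => e _.
  rewrite /edge_bound mulrDr lerD//.
    rewrite [X in X <= _](_ : _ = 2 * K0 * cell_size n e * edge_energy f e); last by ring.
    by rewrite ler_piMl ?edge_energy_ge0.
  rewrite -mulr_suml; set S := \sum_(i < n) _.
  have S0 : 0 <= S by rewrite sumr_ge0// => i _; exact: sqnorm_ge0.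
  rewrite [X in X <= _](_ : _ = K0 * 2 / cell_size n e ^+ 2 * S); last by ring.
  rewrite ler_wpM2r// /C (bigD1 e)//= lerDl sumr_ge0//.
have potsum : nu * qform (@l2form R G) f -
    \sum_e itg 0 (len e) (fun x => q e x * sqnorm (f false e x)) <=
    (\sum_e (M e + `|nu|) * len e) * B.
  rewrite qform_l2E mulr_sumr -sumrB mulr_suml; apply: ler_sum => e _.
  exact: potB.
have -> : qform (hform q K) f = \sum_e edge_energy f e +
   \sum_e itg 0 (len e) (fun x => q e x * sqnorm (f false e x)) +
   complex.Re (vertex_form K f f).
  by rewrite /qform /hform complex_ReD edgeE big_split.
move: energyB potsum vertB; rewrite /K0 mulrDl; lra.
Qed.

(** Cauchy-Schwarz on each cell, with a crude constant. It yields semiboundedness, and that the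
    coefficients of null functions vanish. *)
Lemma cell_coef_le n (f : gpair G) : (0 < n)%N -> gprim f ->
  \sum_(i : edge G * 'I_n) sqnorm (cell_coef i f) <=
  n%:R * (\sum_(e : edge G) len e) * qform (@l2form R G) f.
Proof.
move=> n0 pf; rewrite qform_l2E.
have -> : \sum_(i : edge G * 'I_n) sqnorm (cell_coef i f) =
    \sum_e \sum_(i < n) sqnorm (cell_coef (e, i) f).
  by rewrite pair_bigA/=; apply: eq_bigr => -[].
rewrite mulr_sumr; apply: ler_sum => e _.
have [bR bI] := gprim_cbmeas pf e.
have bR2 : bmeas (len e) (fun t => complex.Re (f false e t) ^+ 2) by exact: bmeasM.
have bI2 : bmeas (len e) (fun t => complex.Im (f false e t) ^+ 2) by exact: bmeasM.
have E0 : 0 <= itg 0 (len e) (fun x => sqnorm (f false e x)).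
  by apply: itg_ge0 => x _; exact: sqnorm_ge0.
rewrite -[n in n%:R]card_ord -mulrA mulr_natl -sumr_const; apply: ler_sum => i _.
have a0 := cell_lo_ge0 n e i; have ab := cell_lo_lt e n0 (ltnSn i).
have bl := cell_lo_le_len e (ltn_ord i).
have [cR cI] := cell_coef_Re (e, i) pf n0.
apply: (@le_trans _ _ (len e * itg 0 (len e) (fun x => sqnorm (f false e x)))); last first.
  by rewrite ler_wpM2r// (bigD1 e)//= lerDl sumr_ge0.
have cl : cell_size n e <= len e.
  by rewrite /cell_size ler_pdivrMr ?ltr0n// ler_peMr// ler1n.
have cs := ltW (cell_size_gt0 e n0).
rewrite /sqnorm cR cI (itgD (lexx 0) (lexx (len e)) bR2 bI2) mulrDr lerD//=.
- apply: (le_trans (sqr_itg_le a0 ab bl bR)).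
  rewrite cell_width ler_pM//; first by apply: itg_ge0 => t _; exact: sqr_ge0.
  by apply: (subset_le_itg (lexx 0) a0 (ltW ab) bl (lexx _) bR2) => t; exact: sqr_ge0.
- apply: (le_trans (sqr_itg_le a0 ab bl bI)).
  rewrite cell_width ler_pM//; first by apply: itg_ge0 => t _; exact: sqr_ge0.
  by apply: (subset_le_itg (lexx 0) a0 (ltW ab) bl (lexx _) bI2) => t; exact: sqr_ge0.
Qed.

Lemma hform_semibounded : exists c0 : R, forall f, form_dom K f ->
  c0 * qform (@l2form R G) f <= qform (hform q K) f.
Proof.
have [n [C [n0 C0 H]]] := hform_ge_coercive 0.
exists (- (C * (n%:R * \sum_(e : edge G) len e))) => f [pf _].
apply: le_trans (H f pf); rewrite mul0r add0r mulNr lerN2 -mulrA ler_wpM2l//.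
exact: cell_coef_le.
Qed.

End LowerBound.

(** * Solutions with piecewise constant right-hand side *)

Section Vanishing.
Context {R : realType} (G : metric_graph R).

Lemma cprim_sqnorm_eq0 l (f f' : R -> R[i]) : 0 < l -> cprim l f f' ->
  itg 0 l (fun x => sqnorm (f x)) = 0 -> forall x, 0 <= x <= l -> f x = 0.
Proof.
move=> l0 [pR pI] f0 x xl.
have bR : bmeas l (fun x => complex.Re (f x) ^+ 2).
  by apply: bmeasM; exact: (prim_bmeas (ltW l0) pR).
have bI : bmeas l (fun x => complex.Im (f x) ^+ 2).
  by apply: bmeasM; exact: (prim_bmeas (ltW l0) pI).
have [R0 I0] : itg 0 l (fun x => complex.Re (f x) ^+ 2) = 0 /\
    itg 0 l (fun x => complex.Im (f x) ^+ 2) = 0.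
  move: f0; rewrite /sqnorm (itgD (lexx 0) (lexx l) bR bI) => /eqP.
  rewrite paddr_eq0; try by apply: itg_ge0 => t _; exact: sqr_ge0.
  by move=> /andP[/eqP ? /eqP].
move: (prim_sqr_eq0 l0 pR R0 xl) (prim_sqr_eq0 l0 pI I0 xl).
by case: (f x) => a b /= -> ->.
Qed.

Lemma cprim_deriv_eq0 l (f f' f'' : R -> R[i]) : 0 < l ->
  cprim l f f' -> cprim l f' f'' -> (forall x, 0 <= x <= l -> f x = 0) ->
  forall x, 0 <= x <= l -> f' x = 0.
Proof.
move=> l0 [pR pI] [pR' pI'] f0 x xl.
have fR : forall x, 0 <= x <= l -> complex.Re (f x) = 0 by move=> y /f0 ->.
have fI : forall x, 0 <= x <= l -> complex.Im (f x) = 0 by move=> y /f0 ->.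
move: (prim_deriv_eq0 l0 pR pR' fR xl) (prim_deriv_eq0 l0 pI pI' fI xl).
by case: (f' x) => a b /= -> ->.
Qed.

Lemma cell_indM n (e : edge G) i j x : (0 < n)%N ->
  cell_ind n e i x * cell_ind n e j x = (i == j)%:R * cell_ind n e i x.
Proof.
move=> n0; rewrite /cell_ind !indicE.
have [->|ij] := eqVneq i j; first by rewrite mul1r; case: (_ \in _); rewrite ?mulr1 ?mulr0.
rewrite mul0r; apply/eqP; rewrite mulf_eq0 !pnatr_eq0 !eqb0 -negb_and.
apply/negP => /andP[/set_mem/= + /set_mem/=].
rewrite !in_itv/= => /andP[ix xi] /andP[jx xj].
move: ij; rewrite neq_ltn => /orP[h|h].
- have : cell_lo n e i.+1 <= cell_lo n e j.
    by move: h; rewrite leq_eqVlt => /predU1P[->//|/(cell_lo_lt e n0)/ltW].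
  lra.
- have : cell_lo n e j.+1 <= cell_lo n e i.
    by move: h; rewrite leq_eqVlt => /predU1P[->//|/(cell_lo_lt e n0)/ltW].
  lra.
Qed.

(** The integral over the j-th cell is [a j] times the cell size. *)
Lemma step_coef_eq0 n (e : edge G) (a : 'I_n -> R) :
  (forall x, 0 <= x <= len e -> itg 0 x (fun t => \sum_i a i * cell_ind n e i t) = 0) ->
  forall i, a i = 0.
Proof.
move=> a0 j; have n0 : (0 < n)%N by exact: leq_ltn_trans (leq0n j) (ltn_ord j).
set f := (fun t => _) in a0.
have bf : bmeas (len e) f.
  by apply: bmeas_sum => i _; apply: bmeasZ; exact: bmeas_cell_ind.
have lo0 := cell_lo_ge0 n e j; have lo1 := ltW (cell_lo_lt e n0 (ltnSn j)).
have lol := cell_lo_le_len e (ltn_ord j).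
have : itg (cell_lo n e j) (cell_lo n e j.+1) f = 0.
  have := itg_split (lexx 0) lo0 lo1 lol bf.
  rewrite !a0 ?lo0 ?(le_trans lo1)// ?(le_trans lo0)//.
  by rewrite add0r => <-.
rewrite -(itg_indic lo0 lo1 lol bf).
have -> : itg 0 (len e) (fun x => cell_ind n e j x * f x) =
    itg 0 (len e) (fun x => cell_ind n e j x * a j).
  apply: eq_itg => x _; rewrite /f mulr_sumr (bigD1 j)//= big1 ?addr0.
    by rewrite mulrCA cell_indM// eqxx mul1r mulrC.
  by move=> i ij; rewrite mulrCA cell_indM// eq_sym val_eqE (negbTE ij) mul0r mulr0.
rewrite (itg_indic lo0 lo1 lol (bmeas_cst _ _)) itg_cst// cell_width => /eqP.
by rewrite mulf_eq0 (gt_eqF (cell_size_gt0 e n0)) orbF => /eqP.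
Qed.

Lemma gpair_sum (I : finType) (c : I -> R[i]) (u : I -> gpair G) s e x :
  (\sum_i c i *: u i) s e x = \sum_i c i * u i s e x.
Proof.
elim: (index_enum I) => [|i r IH]; first by rewrite !big_nil.
by rewrite !big_cons gpair_lin IH.
Qed.

Lemma cell_coef_lin n (i : edge G * 'I_n) (a : R[i]) (f g : gpair G) :
  gprim f -> gprim g -> cell_coef i (a *: f + g) = a * cell_coef i f + cell_coef i g.
Proof.
move=> pf pg.
have bc : cbmeas (len i.1) (fun x => (cell_ind n i.1 i.2 x)%:C).
  exact/cbmeas_real/bmeas_cell_ind.
have bf := cbmeasM bc (gprim_cbmeas pf i.1); have bg := cbmeasM bc (gprim_cbmeas pg i.1).
rewrite /cell_coef -cintZ// -cintD//; last exact: cbmeasZ.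
by apply: eq_cint => x _; rewrite gpair_lin; ring.
Qed.

Lemma lin_fun_sum (L : gpair G -> R[i]) (I : finType) (c : I -> R[i]) (u : I -> gpair G) :
  (forall a f g, gprim f -> gprim g -> L (a *: f + g) = a * L f + L g) ->
  (forall i, gprim (u i)) -> L (\sum_i c i *: u i) = \sum_i c i * L (u i).
Proof.
move=> lin pu.
have L0 : L 0 = 0.
  have := lin 1 0 0 (@gprim0 _ _) (@gprim0 _ _).
  by rewrite scale1r addr0 mul1r => /esym/eqP; rewrite -subr_eq0 addrK => /eqP.
suff [] : L (\sum_i c i *: u i) = \sum_i c i * L (u i) /\ gprim (\sum_i c i *: u i) by [].
elim/big_rec2: _ => [|i z v _ [<- pv]]; first by split=> //; exact: gprim0.
by split; [exact: lin | exact: gprim_lin].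
Qed.

End Vanishing.

Section Reduction.
Context {R : realType} (G : metric_graph R).
Variables (q : edge G -> R -> R) (K : forall v : vert G, vertex_cond R (deg v)).
Hypothesis bq : forall e, bmeas (len e) (q e).

Let l0 (e : edge G) : 0 <= len e. Proof. exact/ltW/len_gt0. Qed.

(* [PD F], [PN F'] and [PR F' - Lam F] have mutually orthogonal ranges, so the
   conditions at [v] amount to the vanishing of their sum. *)
Definition vertex_res v (f : gpair G) : 'cV[R[i]]_(deg v) :=
  PD (K v) *m bvec (f false) v + PN (K v) *m bvec' (f true) v +
  PR (K v) *m bvec' (f true) v - Lam (K v) *m bvec (f false) v.

Lemma vertex_res_lin v a (f g : gpair G) :
  vertex_res v (a *: f + g) = a *: vertex_res v f + vertex_res v g.
Proof.
rewrite /vertex_res !bvec_lin !bvec'_lin !mulmxDr -!scalemxAr.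
have E (A B C D A' B' C' D' : 'cV[R[i]]_(deg v)) :
    a *: A + A' + (a *: B + B') + (a *: C + C') - (a *: D + D') =
    a *: (A + B + C - D) + (A' + B' + C' - D').
  by apply/colP => j; rewrite !mxE; ring.
exact: E.
Qed.

Lemma vertex_resP v (f : gpair G) :
  vertex_res v f = 0 -> satisfies (K v) (bvec (f false) v) (bvec' (f true) v).
Proof.
set F := bvec _ v; set F' := bvec' _ v; rewrite /vertex_res -/F -/F'.
have hermK (M : 'M[R[i]]_(deg v)) : M \is hermsymmx -> M = map_mx Num.conj (trmx M).
  by move=> /is_hermitianmxP; rewrite expr0 scale1r.
have herm0 (M N : 'M[R[i]]_(deg v)) : M \is hermsymmx -> N \is hermsymmx ->
    M *m N = 0 -> N *m M = 0.
  move=> /hermK hM /hermK hN MN; rewrite hM hN -map_mxM -trmx_mul MN.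
  by rewrite trmx0 map_mx0.
have DN : PD (K v) *m PN (K v) = 0 by rewrite {1}(hermK _ (PD_herm _)) PDN_orth.
have DR : PD (K v) *m PR (K v) = 0 by rewrite {1}(hermK _ (PD_herm _)) PDR_orth.
have NR : PN (K v) *m PR (K v) = 0 by rewrite {1}(hermK _ (PN_herm _)) PNR_orth.
have ND := herm0 _ _ (PD_herm _) (PN_herm _) DN.
have RD := herm0 _ _ (PD_herm _) (PR_herm _) DR.
have RN := herm0 _ _ (PN_herm _) (PR_herm _) NR.
have LE (P : 'M[R[i]]_(deg v)) : P *m PR (K v) = 0 -> P *m Lam (K v) = 0.
  by move=> PP; rewrite -(Lam_ran (K v)) !mulmxA PP !mul0mx.
have RL : PR (K v) *m Lam (K v) = Lam (K v).
  by rewrite -[in LHS](Lam_ran (K v)) !mulmxA PR_idem Lam_ran.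
have LR : Lam (K v) *m PR (K v) = Lam (K v).
  by rewrite -[in LHS](Lam_ran (K v)) -!mulmxA PR_idem !mulmxA Lam_ran.
move=> H.
have HP (P : 'M[R[i]]_(deg v)) : P *m (PD (K v) *m F) + P *m (PN (K v) *m F') +
    P *m (PR (K v) *m F') - P *m (Lam (K v) *m F) = 0.
  by rewrite -!mulmxDr -mulmxBr H mulmx0.
split.
- have := HP (PD (K v)); rewrite !mulmxA PD_idem DN DR (LE _ DR).
  by rewrite !mul0mx !addr0 subr0.
- have := HP (PN (K v)); rewrite !mulmxA PN_idem ND NR (LE _ NR).
  by rewrite !mul0mx add0r addr0 subr0.
- have := HP (PR (K v)); rewrite !mulmxA RD RN PR_idem RL LR.
  by rewrite !mul0mx !add0r => /eqP; rewrite subr_eq0 => /eqP.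
Qed.

(** Every edge has one initial and one terminal end, so the degrees add up to 2|E|: there are as
    many scalar vertex conditions as initial values u(0), u'(0). *)
Lemma card_vertex_index : #|{: {v : vert G & 'I_(deg v)}}| = (2 * #|edge G|)%N.
Proof.
have sumE (end_ : edge G -> vert G) (s : vert G -> seq (edge G)) :
    (forall v, uniq (s v)) -> (forall v e, (e \in s v) = (end_ e == v)) ->
    (\sum_v size (s v))%N = #|edge G|.
  move=> us sE; rewrite -sum1_card (partition_big end_ xpredT)//=.
  apply: eq_bigr => v _; rewrite -(card_uniqP (us v)) -sum1_card.
  by apply: eq_bigl => e; rewrite sE.
rewrite card_tagged sumnE big_map big_enum/=.
under eq_bigr do rewrite card_ord /deg.
rewrite big_split/= (sumE (@init R G))// ?(sumE (@term R G))//; first by rewrite mul2n addnn.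
- exact: Et_uniq.
- exact: mem_Et.
- exact: Ei_uniq.
- exact: mem_Ei.
Qed.

End Reduction.

(** * Step right-hand sides and prescribed cell integrals *)

Section StepSolutions.
Context {R : realType} (G : metric_graph R).
Variables (q : edge G -> R -> R) (K : forall v : vert G, vertex_cond R (deg v)).
Hypothesis bq : forall e, bmeas (len e) (q e).
Variables (nu : R) (n : nat).

Let l0 (e : edge G) : 0 <= len e. Proof. exact/ltW/len_gt0. Qed.

(** Parameters on one edge: [inl false] stands for u(0), [inl true] for u'(0), and [inr i] for the
    height of the right-hand side on the i-th cell. *)
Let J : finType := (bool + 'I_n)%type.

Let step (k : edge G * J) : R -> R :=
  if k.2 is inr i then cell_ind n k.1 i else fun=> 0.

Variable B : edge G * J -> bool -> R -> R.
Hypothesis B_prim : forall k, prim (len k.1) (B k false) (B k true).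
Hypothesis B_prim' : forall k, prim (len k.1) (B k true)
  (fun x => (q k.1 x - nu) * B k false x - step k x).
Hypothesis B_init : forall k s, B k s 0 = (k.2 == inl s)%:R.

Let basis (k : edge G * J) : gpair G :=
  fun s e x => if e == k.1 then (B k s x)%:C else 0.

Definition step_sol (c : edge G * J -> R[i]) : gpair G := \sum_k c k *: basis k.

Lemma step_solE c s e x : step_sol c s e x = \sum_j c (e, j) * (B (e, j) s x)%:C.
Proof.
rewrite /step_sol gpair_sum.
transitivity (\sum_e' \sum_j c (e', j) * basis (e', j) s e x).
  by rewrite pair_bigA/=; apply: eq_bigr => -[].
rewrite (bigD1 e)//= [X in _ + X]big1 ?addr0; last first.
  move=> e' e'e; rewrite big1// => j _.
  by rewrite /basis/= eq_sym (negbTE e'e) mulr0.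
by apply: eq_bigr => j _; rewrite /basis/= eqxx.
Qed.

Let gprim_basis k : gprim (basis k).
Proof.
move=> e; rewrite /basis; have [->|ek] := eqVneq e k.1.
  exact: cprim_real.
exact: cprim_cst.
Qed.

Lemma gprim_step_sol c : gprim (step_sol c).
Proof. by apply: (lin_closed_sum (lin_closed_gprim G)) => k _; exact: gprim_basis. Qed.

(** This is u'', read off from -u'' + (q - nu) u = step function. *)
Definition step_sol2 c e x : R[i] :=
  ((q e x)%:C - nu%:C) * step_sol c false e x -
  \sum_(i < n) c (e, inr i) * (cell_ind n e i x)%:C.

Lemma cprim_step_sol c e : cprim (len e) (step_sol c true e) (step_sol2 c e).
Proof.
have H : cprim (len e) (fun x => \sum_j c (e, j) * (B (e, j) true x)%:C)
   (fun x => \sum_j c (e, j) * ((q e x - nu) * B (e, j) false x - step (e, j) x)%:C).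
  apply: cprim_sum => j _; apply: cprimZ => //.
  exact: (cprim_real (B_prim' (e, j))).
apply: (eq_cprim _ _ H) => x _; first by rewrite step_solE.
rewrite /step_sol2 step_solE mulr_sumr.
have -> : \sum_(i < n) c (e, inr i) * (cell_ind n e i x)%:C =
    \sum_j c (e, j) * (step (e, j) x)%:C.
  by rewrite [RHS]big_sumType/= [X in _ = X + _]big1 ?add0r// => j _; rewrite mulr0.
rewrite -sumrB; apply: eq_bigr => j _.
by rewrite !(rmorphB, rmorphM)/=; ring.
Qed.

Lemma step_sol_init c s e : step_sol c s e 0 = c (e, inl s).
Proof.
rewrite step_solE (bigD1 (inl s))//= B_init eqxx mulr1 big1 ?addr0// => j js.
by rewrite B_init/= (negbTE js) mulr0.
Qed.

Lemma op_dom_step_sol c : (forall v, vertex_res K v (step_sol c) = 0) ->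
  op_dom K (step_sol c) (step_sol2 c).
Proof.
move=> vc; split; [exact: gprim_step_sol|exact: cprim_step_sol|].
by move=> v; exact: vertex_resP.
Qed.

(** Green's formula with (H - nu) u a step function: against it, [f] counts only through its cell
    integrals. *)
Lemma hform_step_sol c f : (forall v, vertex_res K v (step_sol c) = 0) ->
  form_dom K f ->
  hform q K (step_sol c) f = nu%:C * l2form (step_sol c) f +
    \sum_(i : edge G * 'I_n) c (i.1, inr i.2) * conjc (cell_coef i f).
Proof.
move=> vc Xf; have [pf _] := Xf; have pu := gprim_step_sol c.
have -> : \sum_(i : edge G * 'I_n) c (i.1, inr i.2) * conjc (cell_coef i f) =
    \sum_e \sum_(i < n) c (e, inr i) * conjc (cell_coef (e, i) f).
  by rewrite pair_bigA/=; apply: eq_bigr => -[].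
rewrite (green bq (op_dom_step_sol vc) Xf) /l2form mulr_sumr -big_split.
apply: eq_bigr => e _; rewrite [RHS]/=.
have bc i : cbmeas (len e) (fun x => (cell_ind n e i x)%:C * f false e x).
  by apply: cbmeasM; [exact/cbmeas_real/bmeas_cell_ind | exact: gprim_cbmeas].
have bcc (i : 'I_n) : cbmeas (len e) (fun x => c (e, inr i) *
    conjc ((cell_ind n e i x)%:C * f false e x)).
  exact/cbmeasZ/cbmeasJ.
have -> : \sum_(i < n) c (e, inr i) * conjc (cell_coef (e, i) f) =
   cint 0 (len e) (fun x => \sum_(i < n) c (e, inr i) *
     conjc ((cell_ind n e i x)%:C * f false e x)).
  rewrite cint_sum//; apply: eq_bigr => i _.
  by rewrite cintZ ?cintJ//; exact: cbmeasJ.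
rewrite -cintZ; last exact: cbmeas_l2.
rewrite -cintD; [|exact/cbmeasZ/cbmeas_l2|by apply: cbmeas_sum].
apply: eq_cint => x _; rewrite /step_sol2.
have -> : \sum_(i < n) c (e, inr i) * conjc ((cell_ind n e i x)%:C * f false e x) =
   (\sum_(i < n) c (e, inr i) * (cell_ind n e i x)%:C) * conjc (f false e x).
  rewrite mulr_suml; apply: eq_bigr => i _.
  by rewrite conjcM conjc_real mulrA.
by ring.
Qed.

(** The matrix of the linear system for [c]: 2|E| vertex conditions and n|E| cell integrals against
    (2 + n)|E| parameters. *)
Let phi (k : edge G * J) (t : {v : vert G & 'I_(deg v)} + edge G * 'I_n) : R[i] :=
  match t with
  | inl s => vertex_res K (tag s) (basis k) (tagged s) 0
  | inr i => cell_coef i (basis k)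
  end.

Let phi_vertex c s : \sum_k c k * phi k (inl s) =
  vertex_res K (tag s) (step_sol c) (tagged s) 0.
Proof.
rewrite (@lin_fun_sum _ _ (fun f => vertex_res K (tag s) f (tagged s) 0))//.
by move=> a f g _ _; rewrite vertex_res_lin !mxE.
Qed.

Let phi_cell c i : \sum_k c k * phi k (inr i) = cell_coef i (step_sol c).
Proof.
rewrite (@lin_fun_sum _ _ (fun f => cell_coef i f))//.
exact: cell_coef_lin.
Qed.

Hypothesis coercive : forall g, form_dom K g ->
  (forall i : edge G * 'I_n, cell_coef i g = 0) ->
  (nu + 1) * qform (@l2form R G) g <= qform (hform q K) g.

(** Without cell integrals h(u,u) = nu b(u,u), so coercivity forces b(u,u) = 0, and [u] and u'
    vanish on every edge. Then the initial values are 0, and so is the right-hand side. *)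
Lemma step_sol_inj c : (forall v, vertex_res K v (step_sol c) = 0) ->
  (forall i : edge G * 'I_n, cell_coef i (step_sol c) = 0) -> forall k, c k = 0.
Proof.
move=> vc cc; set u := step_sol c.
have Xu : form_dom K u by exact: (op_dom_form_dom (op_dom_step_sol vc)).
have hu : qform (hform q K) u = nu * qform (@l2form R G) u.
  rewrite /qform hform_step_sol// [X in _ + X]big1 ?addr0 ?complex_ReZ// => i _.
  by rewrite cc conjc0 mulr0.
have qu : qform (@l2form R G) u = 0.
  apply/eqP; rewrite eq_le l2form_ge0 andbT.
  have := coercive Xu cc; rewrite hu mulrDl mul1r.
  by move: (qform _ _) => z; lra.
have uv e x : 0 <= x <= len e -> u false e x = 0.
  apply: (cprim_sqnorm_eq0 (len_gt0 e) (gprim_step_sol c e)).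
  move/eqP: qu; rewrite qform_l2E psumr_eq0; last first.
    by move=> e' _; apply: itg_ge0 => y _; exact: sqnorm_ge0.
  by move=> /allP/(_ e (mem_index_enum _))/implyP/(_ isT)/eqP.
have u0 e x : 0 <= x <= len e -> u false e x = 0 /\ u true e x = 0.
  move=> xl; split; first exact: uv.
  exact: (cprim_deriv_eq0 (len_gt0 e) (gprim_step_sol c e) (cprim_step_sol c e) (uv e)).
have r0 e x : 0 <= x <= len e -> step_sol2 c e x =
    - \sum_(i < n) c (e, inr i) * (cell_ind n e i x)%:C.
  by move=> xl; rewrite /step_sol2 -/u (u0 e x xl).1 mulr0 sub0r.
(* As u' vanishes, so do all integrals of u'', which is minus the step function; [step_coef_eq0]
   applies to real and imaginary parts. *)
have [zR zI] : (forall e i, complex.Re (c (e, inr i)) = 0) /\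
    (forall e i, complex.Im (c (e, inr i)) = 0).
  split=> e; apply: (step_coef_eq0 (e := e)) => x xl;
    have [pR pI] : cprim (len e) (u true e) (step_sol2 c e) := cprim_step_sol c e.
  - have /andP[x0 xl'] := xl.
    have := prim_sub pR (lexx 0) x0 xl'.
    rewrite !(u0 e _ _).2 ?lexx ?l0// subrr => /esym z.
    apply/eqP; rewrite -oppr_eq0 -(itgN (l := len e) (lexx 0) xl'); last first.
      by apply: bmeas_sum => i _; apply: bmeasZ; exact: bmeas_cell_ind.
    rewrite -[X in _ == X]z; apply/eqP/eq_itg => y /andP[y0 yx].
    rewrite r0 ?y0 ?(le_trans yx)// raddfN/= complex_Re_sum; congr (- _).
    by apply: eq_bigr => i _; rewrite complex_ReM/= mulr0 subr0.
  - have /andP[x0 xl'] := xl.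
    have := prim_sub pI (lexx 0) x0 xl'.
    rewrite !(u0 e _ _).2 ?lexx ?l0// subrr => /esym z.
    apply/eqP; rewrite -oppr_eq0 -(itgN (l := len e) (lexx 0) xl'); last first.
      by apply: bmeas_sum => i _; apply: bmeasZ; exact: bmeas_cell_ind.
    rewrite -[X in _ == X]z; apply/eqP/eq_itg => y /andP[y0 yx].
    rewrite r0 ?y0 ?(le_trans yx)// raddfN/= complex_Im_sum; congr (- _).
    by apply: eq_bigr => i _; rewrite complex_ImM/= mulr0 add0r.
case=> e [s|i]; last first.
  by move: (zR e i) (zI e i); case: (c _) => a b /= -> ->.
rewrite -step_sol_init; have [] := u0 e 0; first by rewrite lexx l0.
by case: s.
Qed.

(** Injectivity and the dimension count make the system solvable for every right-hand side; here the
    vertex data are 0. *)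
Lemma step_sol_surj (y : edge G * 'I_n -> R[i]) : exists c,
  (forall v, vertex_res K v (step_sol c) = 0) /\
  (forall i, cell_coef i (step_sol c) = y i).
Proof.
have [||c Hc] := @injective_solvable _ _ _ phi _ _ (fun t => if t is inr i then y i else 0).
- move=> c c0; apply: step_sol_inj => [v|i]; last by rewrite -phi_cell.
  apply/colP => j; have := phi_vertex c (Tagged (fun v => 'I_(deg v)) j).
  by rewrite c0 => /= <-; rewrite mxE.
- rewrite card_sum card_vertex_index !card_prod card_sum card_bool card_ord.
  by rewrite mulnDr mulnC.
exists c; split=> [v|i]; last by rewrite -phi_cell Hc.
apply/colP => j; have := phi_vertex c (Tagged (fun v => 'I_(deg v)) j).
by rewrite Hc => /= <-; rewrite mxE.
Qed.

End StepSolutions.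

(** * Diagonalization of the form on step solutions *)

Section GraphReduction.
Context {R : realType} (G : metric_graph R).
Variables (q : edge G -> R -> R) (K : forall v : vert G, vertex_cond R (deg v)).
Hypothesis bq : forall e, bmeas (len e) (q e).

Let l0 (e : edge G) : 0 <= len e. Proof. exact/ltW/len_gt0. Qed.

Lemma exists_edge_basis nu n : exists B : edge G * (bool + 'I_n) -> bool -> R -> R,
  [/\ forall k, prim (len k.1) (B k false) (B k true),
      forall k, prim (len k.1) (B k true) (fun x => (q k.1 x - nu) * B k false x -
        (if k.2 is inr i then cell_ind n k.1 i else fun=> 0) x)
    & forall k s, B k s 0 = (k.2 == inl s)%:R].
Proof.
have H (k : edge G * (bool + 'I_n)) : exists B : bool -> R -> R,
    [/\ prim (len k.1) (B false) (B true),
      prim (len k.1) (B true) (fun x => (q k.1 x - nu) * B false x -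
        (if k.2 is inr i then cell_ind n k.1 i else fun=> 0) x)
    & forall s, B s 0 = (k.2 == inl s)%:R].
  have bp : bmeas (len k.1) (fun x => q k.1 x - nu).
    by apply: bmeasB => //; exact: bmeas_cst.
  have br : bmeas (len k.1) (if k.2 is inr i then cell_ind n k.1 i else fun=> 0).
    by case: k.2 => [_|i]; [exact: bmeas_cst | exact: bmeas_cell_ind].
  have [u [u1 [pu pu1 ua u1b]]] := ivp_solvable (k.2 == inl false)%:R
    (k.2 == inl true)%:R (l0 k.1) bp br.
  by exists (fun s => if s then u1 else u); split=> //; case.
have [B HB] := choice H.
by exists B; split=> k; have [] := HB k.
Qed.

(** The step solutions dual to the cell integrals span a complement to the functions without cell
    averages; an orthonormal eigenbasis of their matrix gives [w] and [d]. *)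
Lemma graph_reduction nu : exists (I : finType) (d : I -> R) (w : I -> gpair G)
  (ell : I -> gpair G -> R[i]),
  shifted_diag (form_dom K) (hform q K) (@l2form R G) (eigenfun q K) nu d w ell.
Proof.
(* Coercivity is taken at nu + 1 to have a margin over [nu]. *)
have [n [C [n0 C0 coer]]] := hform_ge_coercive K bq (nu + 1).
have [B [B1 B2 B3]] := exists_edge_basis nu n.
have coercive g : form_dom K g -> (forall i : edge G * 'I_n, cell_coef i g = 0) ->
    (nu + 1) * qform (@l2form R G) g <= qform (hform q K) g.
  move=> [pg _] gc; apply: le_trans (coer g pg).
  by rewrite big1 ?mulr0 ?subr0// => i _; rewrite gc /sqnorm/= expr0n addr0.
pose I : finType := (edge G * 'I_n)%type.
have [c Hc] := choice (fun k : I => step_sol_surj bq B1 B2 B3 coercive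
  (fun i => (i == k)%:R)).
pose u (k : I) := step_sol B (c k).
have vu k v : vertex_res K v (u k) = 0 by exact: (Hc k).1.
have Hu k i : cell_coef i (u k) = (i == k)%:R by exact: (Hc k).2.
have Xu k : form_dom K (u k).
  exact: (op_dom_form_dom (op_dom_step_sol B1 B2 (vu k))).
(* The height of the right-hand side of [u k] on cell [i]. By duality it is also the value of h - nu
   b at (u k, u i), hence [A] is Hermitian. *)
pose A (i k : I) := c k (i.1, inr i.2).
have hu k f : form_dom K f -> hform q K (u k) f = nu%:C * l2form (u k) f +
    \sum_(i : I) A i k * conjc (cell_coef i f).
  by move=> Xf; rewrite (hform_step_sol bq B1 B2 (vu k) Xf).
have huA i k : hform q K (u k) (u i) = nu%:C * l2form (u k) (u i) + A i k.
  rewrite hu//; congr (_ + _); rewrite (bigD1 i)// big1.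
    by rewrite Hu eqxx conjc1 mulr1; exact: addr0.
  by move=> j /andP[_ ji]; rewrite Hu (negbTE ji) conjc0 mulr0.
have Aherm i k : A i k = conjc (A k i).
  have := herm_formC (herm_form_hform K bq) (Xu k) (Xu i).
  rewrite !huA rmorphD/= conjcM conjc_real.
  by rewrite -(herm_formC (herm_form_l2_dom K) (Xu k) (Xu i)) => /addrI.
have [d [E [AE EE EE']]] := hermitian_eigenbasis Aherm.
(* Parameters of the rotated solutions. Their right-hand sides have heights (d k) E k i, because row
   [k] of [E] is an eigenvector of [A]. *)
pose cw (k : I) kap := \sum_j E k j * c j kap.
pose w k := step_sol B (cw k).
have wE k : w k = \sum_j E k j *: u j.
  apply/funext => s; apply/funext => e; apply/funext => x.
  rewrite gpair_sum /w step_solE.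
  under eq_bigr do rewrite mulr_suml.
  rewrite exchange_big/=; apply: eq_bigr => j _.
  rewrite /u step_solE mulr_sumr; apply: eq_bigr => j' _.
  by rewrite mulrA.
have pu k : gprim (u k) by have [] := Xu k.
have vw k v : vertex_res K v (w k) = 0.
  apply/colP => j; rewrite wE [RHS]mxE.
  rewrite (@lin_fun_sum _ _ (fun f => vertex_res K v f j 0))//.
    by apply: big1 => i _; rewrite vu mxE mulr0.
  by move=> a f g _ _; rewrite vertex_res_lin !mxE.
have cww k i : cell_coef i (w k) = E k i.
  rewrite wE (@lin_fun_sum _ _ (fun f => cell_coef i f))//; last exact: cell_coef_lin.
  rewrite (bigD1 i)//= Hu eqxx mulr1 big1 ?addr0// => j ji.
  by rewrite Hu eq_sym (negbTE ji) mulr0.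
have cwA k (i : I) : cw k (i.1, inr i.2) = (d k)%:C * E k i.
  by rewrite -AE; apply: eq_bigr => j _; rewrite mulrC.
pose ell (k : I) f := \sum_i conjc (E k i) * cell_coef i f.
have cell_ell f i : cell_coef i f = \sum_k E k i * ell k f.
  under eq_bigr do rewrite mulr_sumr.
  rewrite exchange_big/= (bigD1 i)//= [X in _ + X]big1 ?addr0.
    under eq_bigr do rewrite mulrA.
    by rewrite -mulr_suml EE' eqxx mul1r.
  move=> j ji; under eq_bigr do rewrite mulrA.
  by rewrite -mulr_suml EE' eq_sym (negbTE ji) mul0r.
exists I, d, w, ell; split; split.
- by move=> k; exact: (op_dom_form_dom (op_dom_step_sol B1 B2 (vw k))).
- move=> k f Xf; rewrite (hform_step_sol bq B1 B2 (vw k) Xf); congr (_ + _).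
  rewrite /ell rmorph_sum mulr_sumr; apply: eq_bigr => i _.
  by rewrite cwA /= conjcM conjcK mulrA.
- move=> i j; rewrite /ell.
  under eq_bigr do rewrite cww mulrC.
  by rewrite EE eq_sym.
- move=> k a f g [pf _] [pg _]; rewrite /ell mulr_sumr -big_split/=.
  apply: eq_bigr => i _; rewrite cell_coef_lin//; ring.
- move=> g Xg gl; apply: coercive => // i.
  by rewrite cell_ell big1// => k _; rewrite gl mulr0.
- move=> f k [pf _] qf; rewrite /ell big1// => i _.
  have := cell_coef_le n0 pf; rewrite qf mulr0 => s0.
  have : sqnorm (cell_coef i f) = 0.
    apply/eqP; rewrite eq_le sqnorm_ge0 andbT; apply: le_trans s0.
    by rewrite (bigD1 i)//= lerDl sumr_ge0// => j _; exact: sqnorm_ge0.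
  case: (cell_coef i f) => a b; rewrite /sqnorm/= => /eqP.
  rewrite paddr_eq0 ?sqr_ge0// !sqrf_eq0 => /andP[/eqP-> /eqP->].
  exact: mulr0.
(* For d k = 0 the right-hand side vanishes identically, so [w k] is an eigenfunction. *)
- move=> k dk; have [pw pw' sw] := op_dom_step_sol B1 B2 (vw k).
  split=> // e; apply: (eq_cprim _ _ (pw' e)) => // x _.
  rewrite /step_sol2 big1 ?subr0// => i _.
  by rewrite (cwA k (e, i)) dk mul0r mul0r.
Qed.

End GraphReduction.

(** * Eigenvalue enumerations *)

Section AlmostEverywhere.
Local Open Scope classical_set_scope.
Local Open Scope ring_scope.
Local Open Scope complex_scope.
Context {R : realType}.
Local Notation mu := (@lebesgue_measure R).

Lemma ae_imp (P Q : R -> Prop) : (forall x, P x -> Q x) ->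
  {ae mu, forall x, P x} -> {ae mu, forall x, Q x}.
Proof.
move=> PQ; apply: (@filterS _ _ _ P Q) => //.
exact: (@ae_filter_ringOfSetsType _ _ R mu).
Qed.

Lemma ae_imp2 (P Q S : R -> Prop) : (forall x, P x -> Q x -> S x) ->
  {ae mu, forall x, P x} -> {ae mu, forall x, Q x} -> {ae mu, forall x, S x}.
Proof.
move=> PQS; apply: (@filterS2 _ _ _ P Q S) => //.
exact: (@ae_filter_ringOfSetsType _ _ R mu).
Qed.

Lemma itg_ae l x (f g : R -> R) : 0 <= x <= l ->
  mu.-integrable `[0, l] (EFin \o f) -> bmeas l g ->
  {ae mu, forall t, t \in `[0, l] -> f t = g t} -> itg 0 x f = itg 0 x g.
Proof.
move=> /andP[x0 xl] intf bg fg.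
have sub : (`[0, x]%classic : set R) `<=` `[0, l]%classic.
  by apply: subset_itvl; rewrite bnd_simp.
have intx : mu.-integrable `[0, x] (EFin \o f).
  exact: (@integrableS _ _ R lebesgue_measure `[0, l]%classic `[0, x]%classic).
congr fine; apply: ae_eq_integral => //.
- exact: (measurable_int mu).
- exact: (measurable_int mu (bmeas_integrable bg (lexx 0) xl)).
- by apply: (ae_imp _ fg) => t + tx => /(_ (sub _ tx))/= ->.
Qed.

(** The bound is |f(0)| plus the integral of |g|. It is applied to f', whose measurability comes
    from its integrability as the derivative of f. *)
Lemma ac_deriv_bmeas l (f g : R -> R) : ac_deriv l f g ->
  measurable_fun (`[0, l]%classic : set R) f -> bmeas l f.
Proof.
move=> [intg fE] mf; split=> //.
exists (`|f 0| + \int[mu]_(t in `[0, l]) `|g t|) => x xl.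
have /andP[x0 xl'] := xl.
have sub : (`[0, x]%classic : set R) `<=` `[0, l]%classic.
  by apply: subset_itvl; rewrite bnd_simp.
have intx : mu.-integrable `[0, x] (EFin \o g).
  exact: (@integrableS _ _ R lebesgue_measure `[0, l]%classic `[0, x]%classic).
rewrite fE ?in_itv// (le_trans (ler_normD _ _))// lerD2l.
apply: (le_trans (le_normr_Rintegral _ intx)) => //.
rewrite /Rintegral fine_le//.
- by apply: integrable_fin_num => //; exact: (integrable_norm intx).
- by apply: integrable_fin_num => //; exact: (integrable_norm intg).
apply: ge0_subset_integral => //.
apply: (measurable_int mu); exact: (integrable_norm intg).
Qed.

Lemma cac_deriv_cprim l (f f1 : R -> R[i]) : cac_deriv l f f1 -> cbmeas l f1 ->
  cprim l f f1.
Proof.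
move=> [[_ fR] [_ fI]] [bR bI]; by split; split.
Qed.

(** Passing from f'' to a bounded representative [g] turns an absolutely continuous f' into a
    Lipschitz one. *)
Lemma cac_deriv_ae l (f1 f2 g : R -> R[i]) : cac_deriv l f1 f2 -> cbmeas l g ->
  {ae mu, forall x, x \in `[0, l] -> f2 x = g x} -> cprim l f1 g.
Proof.
move=> [[intR fR] [intI fI]] [bR bI] f2g; split; split=> // x xl.
  rewrite fR ?in_itv//; congr (_ + _); apply: (itg_ae xl) => //.
  by apply: (ae_imp _ f2g) => t + tl => /(_ tl) ->.
rewrite fI ?in_itv//; congr (_ + _); apply: (itg_ae xl) => //.
by apply: (ae_imp _ f2g) => t + tl => /(_ tl) ->.
Qed.

Lemma cprim_cac_deriv l (f f1 : R -> R[i]) : cprim l f f1 -> cac_deriv l f f1.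
Proof.
move=> [[bR fR] [bI fI]]; split; split.
- exact: (bmeas_integrable bR).
- by move=> x; rewrite in_itv; exact: fR.
- exact: (bmeas_integrable bI).
- by move=> x; rewrite in_itv; exact: fI.
Qed.

Lemma bmeas_Lfun2 l (f : R -> R) : bmeas l f -> f \_ `[0, l] \in Lfun mu 2%:E.
Proof.
move=> bf; have [mf _] := bf; rewrite inE/=; apply/andP; split.
  by rewrite inE/=; apply/(measurable_restrictT (D := `[0, l]%classic) f).
rewrite inE/= /finite_norm unlock/= poweR_lty//.
have /integrableP[_] := bmeas_integrable (bmeasM bf bf) (lexx 0) (lexx l).
rewrite integral_mkcond; congr (_ < _)%E; apply: eq_integral => x _.
rewrite !patchE; case: ifPn => _ /=.
  by rewrite normrM -expr2 -powR_mulrn.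
by rewrite normr0 powR0// pnatr_eq0.
Qed.

Lemma cbmeas_L2fun l (f : R -> R[i]) : cbmeas l f -> L2fun l f.
Proof. by move=> [bR bI]; split; exact: bmeas_Lfun2. Qed.

Lemma ess_bounded_truncation l (f : R -> R) : f \_ `[0, l] \in Lfun mu +oo%E ->
  exists2 g, bmeas l g & {ae mu, forall x, x \in `[0, l] -> f x = g x}.
Proof.
rewrite inE/= => /andP[]; rewrite !inE/= => mf.
(* The L^oo norm is defined as an essential supremum only on a space of positive measure. *)
have muT : (0 < mu setT)%E.
  apply: (@lt_le_trans _ _ (mu `[0, 1]%classic)); last by apply: le_measure; rewrite ?inE.
  by rewrite lebesgue_measure_itv/= lte_fin ltr01 sube0 lte_fin ltr01.
rewrite /finite_norm unlock muT.
have -> : abse \o (EFin \o f \_ `[0, l]) = EFin \o (Num.norm \o f \_ `[0, l]) by [].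
move=> /ess_supr_bounded[M fM].
(* Clipping at |M| changes [f] on a null subset of [0, l] only. *)
exists (fun x => Num.max (- `|M|) (Num.min `|M| ((f \_ `[0, l]) x))).
  split.
    apply: measurable_funTS; apply: measurable_maxr; first exact: measurable_cst.
    by apply: measurable_minr => //; exact: measurable_cst.
  exists `|M| => x _; rewrite ler_norml le_max lexx ge_max ge_min lexx andbT/=.
  by rewrite ge0_cp.
apply: (ae_imp _ fM) => x /= fMx xl.
have fxE : (f \_ `[0, l]) x = f x by rewrite patchE mem_set.
move: fMx; rewrite fxE => fMx.
have : `|f x| <= `|M| by rewrite (le_trans fMx)// ler_norm.
by rewrite ler_norml => /andP[h1 h2]; rewrite min_r// max_r.
Qed.

End AlmostEverywhere.

Lemma potential_truncation {R : realType} (G : metric_graph R) (q : edge G -> R -> R) :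
  potential q -> exists q' : edge G -> R -> R,
  (forall e, bmeas (len e) (q' e)) /\
  forall e, {ae @lebesgue_measure R, forall x, x \in `[0, len e] -> q e x = q' e x}.
Proof.
move=> qb.
have H e : exists g, bmeas (len e) g /\
    {ae @lebesgue_measure R, forall x, x \in `[0, len e] -> q e x = g x}.
  by have [g bg qg] := ess_bounded_truncation (qb e); exists g.
have [q' Hq'] := choice H.
by exists q'; split=> e; have [] := Hq' e.
Qed.

Lemma card_le_injection (A B : set nat) : (A #<= B)%card ->
  exists f : nat -> nat, (forall x, A x -> B (f x)) /\
    (forall x y, A x -> A y -> f x = f y -> x = y).
Proof.
move=> /pcard_leP/injfunPex[f fAB finj]; exists f; split=> // x y Ax Ay.
by apply: finj; rewrite inE.
Qed.

(** * Eigenfunctions, multiplicities and min-max values *)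

Section Spectrum.
Context {R : realType} (G : metric_graph R).
Variables (q q' : edge G -> R -> R) (K : forall v : vert G, vertex_cond R (deg v)).
Hypothesis bq' : forall e, bmeas (len e) (q' e).
Hypothesis qq' : forall e, {ae @lebesgue_measure R, forall x, x \in `[0, len e] ->
  q e x = q' e x}.

Let l0 (e : edge G) : 0 <= len e. Proof. exact/ltW/len_gt0. Qed.

(** Regularity bootstrap: f' is absolutely continuous, hence bounded, so [f] is Lipschitz; then (q'
    - nu) f is a bounded representative of f'', so f' is Lipschitz too. *)
Lemma in_eigenspace_eigenfun nu (f : gfun G) : in_eigenspace (schroedinger q K) nu f ->
  exists2 F : gpair G, F false = f & eigenfun q' K nu F.
Proof.
move=> [f1 [f2 [H2f sf eqf]]].
have bf1 e : cbmeas (len e) (f1 e).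
  have [[[iR _] [iI _]] [fR fI] _] := H2f e.
  split; [apply: ac_deriv_bmeas fR _ | apply: ac_deriv_bmeas fI _].
    by have /measurable_EFinP := measurable_int _ iR.
  by have /measurable_EFinP := measurable_int _ iI.
exists (fun s => if s then f1 else f) => //.
have pf : gprim (G := G) (fun s => if s then f1 else f).
  by move=> e; have [cf _ _] := H2f e; exact: (cac_deriv_cprim cf (bf1 e)).
split=> // e; have [_ cf1 _] := H2f e.
apply: (cac_deriv_ae cf1).
  apply: cbmeasM; last exact: (gprim_cbmeas pf).
  by apply: cbmeasB; [exact: cbmeas_real | exact: cbmeas_cst].
apply: (ae_imp2 _ (eqf e) (qq' e)) => x /= + + xl => /(_ xl) h /(_ xl) <-.
by rewrite mulrBl h; ring.
Qed.

Lemma eigenfun_in_eigenspace nu (F : gpair G) : eigenfun q' K nu F ->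
  in_eigenspace (schroedinger q K) nu (F false).
Proof.
move=> [pF pF' sF].
exists (F true), (fun e x => ((q' e x)%:C - nu%:C) * F false e x); split=> // e.
  split; [exact: cprim_cac_deriv|exact: cprim_cac_deriv|].
  exact/cbmeas_L2fun/(cprim_cbmeas' (pF' e)).
by apply: ae_imp (qq' e) => x /= + xl => /(_ xl) ->; ring.
Qed.

Lemma qform_l2_eq0_L2eq (f : gpair G) : gprim f ->
  qform (@l2form R G) f = 0 -> L2eq (f false) (fun _ _ => 0).
Proof.
move=> pf /eqP; rewrite qform_l2E psumr_eq0; last first.
  by move=> e _; apply: itg_ge0 => y _; exact: sqnorm_ge0.
move=> /allP f0 e; apply: aeW => x; rewrite in_itv/= => xl.
have := f0 e (mem_index_enum _) => /implyP/(_ isT)/eqP.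
by move=> /(cprim_sqnorm_eq0 (len_gt0 e) (pf e))/(_ x xl).
Qed.

Lemma L2eq_qform_l2_eq0 (f : gpair G) : gprim f ->
  L2eq (f false) (fun _ _ => 0) -> qform (@l2form R G) f = 0.
Proof.
move=> pf f0; rewrite qform_l2E big1// => e _.
have [bR bI] := gprim_cbmeas pf e.
have bs : bmeas (len e) (fun x => sqnorm (f false e x)).
  by apply: bmeasD; exact: bmeasM.
rewrite (itg_ae (l := len e) _ _ (bmeas_cst _ 0)).
- by rewrite itg_cst// mul0r.
- by rewrite l0 lexx.
- exact: (bmeas_integrable bs).
- by apply: ae_imp (f0 e) => x + xl => /(_ xl) ->; rewrite /sqnorm/= expr0n/= addr0.
Qed.

Variable lam : nat -> R.
Hypothesis lamP : eigenvalue_enum (schroedinger q K) lam.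

(** If [Z] were larger than the multiplicity, some nontrivial combination of the [w i] would have
    zero coordinates in a basis of the eigenspace and be null in L^2. *)
Lemma multiplicity_bound nu (I : finType) (Z : {set I}) (w : I -> gpair G) :
  (forall i, i \in Z -> eigenfun q' K nu (w i)) ->
  (forall c : I -> R[i], (forall i, i \notin Z -> c i = 0) ->
     qform (@l2form R G) (\sum_i c i *: w i) = 0 -> forall i, c i = 0) ->
  exists s : seq nat, [/\ uniq s, (#|Z| <= size s)%N & forall k, k \in s -> lam k = nu].
Proof.
move=> Ew indep; have [n [[phi [_ _ span]] card_n]] := proj2 lamP nu.
have [_ /card_le_injection[g [gA ginj]]] := (card_eqPle _ _).1 card_n.
exists (map g (iota 0 n)); split.
- rewrite map_inj_in_uniq ?iota_uniq// => x y; rewrite !mem_iota/= => xn yn.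
  exact: ginj.
- rewrite size_map size_iota leqNgt; apply/negP => nZ.
  have Hi i : exists c : 'I_n -> R[i], i \in Z -> L2eq (w i false) (lincomb c phi).
    case: (boolP (i \in Z)) => iZ; last by exists (fun=> 0).
    by have [c Hc] := span _ (eigenfun_in_eigenspace (Ew i iZ)); exists c.
  have [M HM] := choice Hi.
  have nZ' : (#|[set: 'I_n]| < #|Z|)%N by rewrite cardsT card_ord.
  have [x [xZ [i xi] xM]] := exists_nontrivial_solution M nZ'.
  move/eqP: xi; apply.
  (* Nothing is known about [w i] off [Z]; its coefficient is 0 there, so 0 may replace it. *)
  pose w' i := if i \in Z then w i else 0.
  have wE : \sum_i x i *: w i = \sum_i x i *: w' i.
    apply: eq_bigr => j _; rewrite /w'; case: ifPn => // jZ.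
    by rewrite (xZ j jZ) !scale0r.
  apply: (indep x xZ); rewrite wE.
  apply: L2eq_qform_l2_eq0.
    apply: (lin_closed_sum (lin_closed_gprim G)) => j _; rewrite /w'.
    by case: ifPn => [/Ew[]//|_]; exact: gprim0.
  move=> e.
  (* One null set for all [j] at once, by induction over a list of the indices. *)
  have ae_all : {ae @lebesgue_measure R, forall t, t \in `[0, len e] ->
      forall j, j \in Z -> w j false e t = lincomb (M j) phi e t}.
    suff H (r : seq I) : {ae @lebesgue_measure R, forall t, t \in `[0, len e] ->
        forall j, j \in r -> j \in Z -> w j false e t = lincomb (M j) phi e t}.
      by apply: ae_imp (H (enum I)) => t ht tl j; apply: ht => //; rewrite mem_enum.
    elim: r => [|j r IH]; first by apply: aeW.
    case: (boolP (j \in Z)) => jZ; last first.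
      apply: ae_imp IH => t ht tl k; rewrite inE => /predU1P[->|].
        by rewrite (negbTE jZ).
      exact: ht.
    apply: (ae_imp2 _ IH (HM j jZ e)) => t ht hj tl k.
    by rewrite inE => /predU1P[-> _|]; [exact: hj | exact: ht].
  apply: ae_imp ae_all => t ht tl; rewrite gpair_sum.
  transitivity (\sum_i \sum_j x i * M i j * phi j e t).
    apply: eq_bigr => k _; rewrite /w'; case: ifPn => kZ.
      by rewrite (ht tl k kZ) /lincomb mulr_sumr; apply: eq_bigr => j _; rewrite mulrA.
    rewrite xZ// mul0r big1// => j _; by rewrite !mul0r.
  rewrite exchange_big big1// => j _.
  by rewrite -mulr_suml xM ?mul0r// inE.
- by move=> k /mapP[j]; rewrite mem_iota/= => jn ->; exact: gA.
Qed.

(** For each [nu], the set of indices [k] with lam k = nu injects into a basis of the eigenspace;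
    every index receives the basis vector so assigned. *)
Lemma exists_eigen_family : exists psi : nat -> gpair G,
  (forall i, eigenfun q' K (lam i) (psi i)) /\
  forall nu m (c : 'I_m -> R[i]), (forall i : 'I_m, lam i != nu -> c i = 0) ->
    qform (@l2form R G) (\sum_i c i *: psi i) = 0 -> forall i, c i = 0.
Proof.
have H nu : exists p : nat -> gpair G,
    (forall k, lam k = nu -> eigenfun q' K nu (p k)) /\
    forall m (c : 'I_m -> R[i]), (forall i : 'I_m, lam i != nu -> c i = 0) ->
      qform (@l2form R G) (\sum_i c i *: p i) = 0 -> forall i, c i = 0.
  have [n [[phi [eig indep _]] card_n]] := proj2 lamP nu.
  have [/card_le_injection[f [fn finj]] _] := (card_eqPle _ _).1 card_n.
  have [Phi HPhi] := choice (fun j =>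
    let: ex_intro2 F h1 h2 := in_eigenspace_eigenfun (eig j) in
    ex_intro (fun F : gpair G => F false = phi j /\ eigenfun q' K nu F) F (conj h1 h2)).
  pose p k : gpair G := if lam k == nu then
    (if insub (f k) is Some j then Phi j else 0) else 0.
  have pE k (j : 'I_n) : lam k = nu -> f k = j -> p k = Phi j.
    by move=> lk fk; rewrite /p lk eqxx fk valK.
  have Ep k : lam k = nu -> eigenfun q' K nu (p k).
    by move=> lk; rewrite (pE k (Ordinal (fn k lk)))//; exact: (HPhi _).2.
  exists p; split=> // m c c0 qc i.
  have [lk|] := eqVneq (lam i) nu; last exact: c0.
  have pp k : gprim (p k).
    have [/Ep[]//|lk'] := eqVneq (lam k) nu.
    by rewrite /p (negbTE lk'); exact: gprim0.
  have sum0 := qform_l2_eq0_L2eq (lin_closed_sum (lin_closed_gprim G) c (fun k _ => pp k)) qc.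
  (* Coefficients transported to the basis; as [f] is injective on the indices with value [nu], each
     [c' j] has at most one term. *)
  pose c' (j : 'I_n) := \sum_(k < m | (lam k == nu) && (f k == j)) c k.
  have c'0 : forall j, c' j = 0.
    apply: indep => e; apply: ae_imp (sum0 e) => x + xl => /(_ xl).
    rewrite gpair_sum => h; rewrite -[RHS]h /lincomb /c'.
    under eq_bigr do rewrite mulr_suml.
    rewrite (exchange_big_dep (fun k : 'I_m => lam k == nu))/=; last by move=> j k _ /andP[].
    rewrite [RHS](bigID (fun k : 'I_m => lam k == nu))/=.
    rewrite [X in _ = _ + X]big1 ?addr0; last first.
      by move=> k /c0 ->; rewrite mul0r.
    apply: eq_bigr => k /eqP lk'; rewrite lk' eqxx/=.
    rewrite (big_pred1 (Ordinal (fn k lk'))); last by move=> j; rewrite /= -val_eqE eq_sym.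
    by rewrite (pE k (Ordinal (fn k lk')))// (HPhi _).1.
  have := c'0 (Ordinal (fn i lk)); rewrite /c' (big_pred1 i)// => k /=.
  apply/andP/eqP => [[/eqP lk' /eqP fk]|->]; last by rewrite lk !eqxx.
  exact/val_inj/finj.
have [P HP] := choice H.
exists (fun i => P (lam i) i); split; first by move=> i; exact: (HP (lam i)).1.
move=> nu m c c0 qc; apply: ((HP nu).2 m c c0).
rewrite -[RHS]qc; congr qform; apply: eq_bigr => i _.
have [<-//|li] := eqVneq (lam i) nu.
by rewrite c0// !scale0r.
Qed.

(** Indices start at 0, so the eigenvalues up to [lam k] provide k + 1 eigenfunctions. *)
Lemma eigen_test_family k :
  test_family (form_dom K) (hform q' K) (@l2form R G) k.+1 (lam k).
Proof.
have [psi [Epsi indep]] := exists_eigen_family.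
apply: (@test_family_eigen _ _ _ _ _ (eigenfun q' K) _ _ _ _ _ _ k.+1
  (fun i => lam i) (fun i => psi i)).
- exact: lin_closed_form_dom.
- exact: herm_form_hform.
- exact: herm_form_l2_dom.
- by move=> u _; exact: l2form_ge0.
- by move=> nu v; exact: eigenfun_form_dom.
- by move=> nu v f; exact: hform_eigenfun.
- by move=> i; exact: Epsi.
- by move=> i; apply: (proj1 lamP); rewrite -ltnS.
- by move=> i0 c; exact: indep.
Qed.

Lemma eigenvalue_le k mu :
  test_family (form_dom K) (hform q' K) (@l2form R G) k.+1 mu -> lam k <= mu.
Proof.
apply: (@eigenvalue_le_of_test_family _ _ _ _ _ (eigenfun q' K)).
- exact: lin_closed_form_dom.
- exact: herm_form_hform.
- exact: herm_form_l2_dom.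
- by move=> u _; exact: l2form_ge0.
- exact: (proj1 lamP).
- by move=> nu; exact: graph_reduction.
- exact: hform_semibounded.
- by move=> nu I Z w; exact: multiplicity_bound.
Qed.

End Spectrum.

(** * Joining two vertices *)

Section VertexSums.
Context {R : realType} (G : metric_graph R).

Definition vertex_sum (f : gfun G) v : R[i] :=
  \sum_(e <- Ei v) f e 0 + \sum_(e <- Et v) f e (len e).

Definition vertex_sqnorm (f : gfun G) v : R :=
  \sum_(e <- Ei v) sqnorm (f e 0) + \sum_(e <- Et v) sqnorm (f e (len e)).

(** The squared norm of the part of the boundary vector orthogonal to (1, ..., 1), that is, the form
    of [Qones] at it. For degree 0 the quotient is 0. *)
Definition vertex_var (f : gfun G) v : R :=
  vertex_sqnorm f v - sqnorm (vertex_sum f v) / (deg v)%:R.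

Lemma sum_bvec f v : \sum_j bvec f v j 0 = vertex_sum f v.
Proof.
rewrite /vertex_sum (big_tnth _ _ (Ei v)) (big_tnth _ _ (Et v)).
rewrite /deg big_split_ord/=; congr (_ + _); apply: eq_bigr => j _.
  by rewrite col_mxEu mxE.
by rewrite col_mxEd mxE.
Qed.

Lemma sum_sqnorm_bvec f v : \sum_j sqnorm (bvec f v j 0) = vertex_sqnorm f v.
Proof.
rewrite /vertex_sqnorm (big_tnth _ _ (Ei v)) (big_tnth _ _ (Et v)).
rewrite /deg big_split_ord/=; congr (_ + _); apply: eq_bigr => j _.
  by rewrite col_mxEu mxE.
by rewrite col_mxEd mxE.
Qed.

Lemma Pones_bvec f v : Pones R (deg v) *m bvec f v =
  const_mx ((deg v)%:R^-1 * vertex_sum f v).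
Proof.
apply/matrixP => i j; rewrite !mxE ord1 -sum_bvec mulr_sumr.
by apply: eq_bigr => k _; rewrite mxE.
Qed.

Lemma vertex_sum_deg0 f v : deg v = 0%N -> vertex_sum f v = 0.
Proof.
move=> d0; rewrite /vertex_sum.
have /eqP := d0; rewrite /deg addn_eq0 !size_eq0 => /andP[/eqP-> /eqP->].
by rewrite !big_nil addr0.
Qed.

Lemma Pones_bvec_eq0 f v : Pones R (deg v) *m bvec f v = 0 -> vertex_sum f v = 0.
Proof.
have [/vertex_sum_deg0->//|d0] := eqVneq (deg v) 0%N.
rewrite Pones_bvec -lt0n in d0 * => /matrixP/(_ (Ordinal d0) 0)/eqP.
by rewrite !mxE mulf_eq0 invr_eq0 pnatr_eq0 gtn_eqF//= => /eqP.
Qed.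

Lemma Re_cdot_Qones f v (C : R) :
  complex.Re (cdot (C%:C *: Qones R (deg v) *m bvec f v) (bvec f v)) =
  C * vertex_var f v.
Proof.
rewrite -scalemxAl cdotZl complex_ReZ; congr (_ * _).
rewrite /Qones mulmxBl mul1mx -scaleN1r cdotDl cdotZl Pones_bvec.
have -> : cdot (const_mx ((deg v)%:R^-1 * vertex_sum f v)) (bvec f v) =
    ((deg v)%:R^-1)%:C * (vertex_sum f v * conjc (vertex_sum f v)).
  rewrite -[in conjc _]sum_bvec rmorph_sum !mulr_sumr; apply: eq_bigr => j _.
  by rewrite mxE fmorphV rmorph_nat mulrA.
rewrite mulN1r complex_ReD raddfN/= complex_ReZ /vertex_var -sum_sqnorm_bvec.
congr (_ - _); last first.
  by rewrite mulrC /sqnorm; case: (vertex_sum f v) => a b /=; congr (_ * _); ring.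
rewrite /cdot complex_Re_sum; apply: eq_bigr => j _.
by rewrite /sqnorm; case: (bvec f v j 0) => a b /=; ring.
Qed.

End VertexSums.

(** For a = m and b = n the defect is |b s - a t|^2 / (a b (a + b)). The hypotheses cover vertices
    of degree 0, where division by 0 gives 0. *)
Lemma sqnormD_div_le {R : realType} (s t : R[i]) (m n : nat) :
  (m = 0%N -> s = 0) -> (n = 0%N -> t = 0) ->
  sqnorm (s + t) / (m + n)%:R <= sqnorm s / m%:R + sqnorm t / n%:R.
Proof.
case: m => [/(_ erefl) -> _|m _].
  by rewrite !add0r /sqnorm/= expr0n/= addr0 mul0r add0r.
case: n => [/(_ erefl) ->|n _].
  by rewrite !addr0 addn0 /sqnorm/= expr0n/= addr0 mul0r addr0.
have a0 : 0 < m.+1%:R :> R by rewrite ltr0n.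
have b0 : 0 < n.+1%:R :> R by rewrite ltr0n.
rewrite natrD; move: (m.+1%:R) (n.+1%:R) a0 b0 => a b a0 b0.
have ab0 : 0 < a + b by rewrite addr_gt0.
rewrite ler_pdivrMr//.
have -> : (sqnorm s / a + sqnorm t / b) * (a + b) =
    (sqnorm s * b * (a + b) + sqnorm t * a * (a + b)) / (a * b).
  by field; rewrite !gt_eqF.
rewrite ler_pdivlMr ?mulr_gt0//.
case: s => x y; case: t => z w; rewrite /sqnorm/=.
have := sqr_ge0 (b * x - a * z); have := sqr_ge0 (b * y - a * w).
by move=> h1 h2; rewrite -subr_ge0; apply: le_trans (addr_ge0 h1 h2) _; rewrite le_eqVlt;
  apply/orP; left; apply/eqP; ring.
Qed.

Section Join.
Context {R : realType} (G : metric_graph R) (v1 v2 : vert G) (v12 : v1 != v2).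
Local Notation Gt := (join v12).
Variables (q : edge G -> R -> R) (K : forall v : vert G, vertex_cond R (deg v)).
Variable Kt : forall v : vert Gt, vertex_cond R (deg v).
Hypothesis same_cond : forall w : {w : vert G | w \notin [:: v1; v2]},
  Kt (Some w) = K (val w).

Lemma vertex_sum_join (f : gfun G) :
  @vertex_sum R Gt f None = vertex_sum f v1 + vertex_sum f v2.
Proof. by rewrite /vertex_sum/= !big_cat/= addrACA. Qed.

Lemma vertex_sqnorm_join (f : gfun G) :
  @vertex_sqnorm R Gt f None = vertex_sqnorm f v1 + vertex_sqnorm f v2.
Proof. by rewrite /vertex_sqnorm/= !big_cat/= addrACA. Qed.

Lemma deg_join : @deg R Gt None = (deg v1 + deg v2)%N.
Proof. by rewrite /deg/= !size_cat addnACA. Qed.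

Lemma vertex_var_join (f : gfun G) :
  vertex_var f v1 + vertex_var f v2 <= @vertex_var R Gt f None.
Proof.
rewrite /vertex_var vertex_sqnorm_join vertex_sum_join deg_join.
have := sqnormD_div_le (@vertex_sum_deg0 _ _ f v1) (@vertex_sum_deg0 _ _ f v2).
lra.
Qed.

(** The vertices other than [v1] and [v2] correspond to the [Some w] and cancel. *)
Lemma sum_join (F : vert G -> R) (Ft : vert Gt -> R) :
  (forall w : {w : vert G | w \notin [:: v1; v2]}, Ft (Some w) = F (val w)) ->
  \sum_v Ft v - \sum_v F v = Ft None - (F v1 + F v2).
Proof.
move=> FE.
have -> : \sum_v Ft v = Ft None + \sum_(v | v \notin [:: v1; v2]) F v.
  rewrite (bigD1 None)//=; congr (_ + _).
  rewrite (reindex_omap Some id)/=; last by case.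
  rewrite [RHS](reindex_omap val (insub : vert G -> option {w | w \notin [:: v1; v2]}))/=;
    last by move=> v vN; rewrite insubT.
  by apply: eq_big => w; rewrite ?FE// eqxx valK eqxx (valP w).
rewrite [in X in _ - X](bigD1 v1)//= [X in _ - (_ + X)](bigD1 v2)/=; last by rewrite eq_sym.
rewrite [X in _ - (_ + (_ + X))](eq_bigl (fun v => v \notin [:: v1; v2])); last first.
  by move=> v; rewrite !inE negb_or.
ring.
Qed.

(** For general conditions neither domain contains the other; each is completed by the Dirichlet
    conditions it lacks, so as to serve both types. *)
Lemma form_dom_join (u : gpair G) :
  @form_dom R G K u /\ PD (Kt None) *m @bvec R Gt (u false) None = 0 <->
  @form_dom R Gt Kt u /\ PD (K v1) *m bvec (u false) v1 = 0 /\
    PD (K v2) *m bvec (u false) v2 = 0.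
Proof.
split=> [[[pu Du] D0]|[[pu Du] [D1 D2]]].
  split; last by split; exact: Du.
  split=> //; case=> [w|//].
  by rewrite same_cond; exact: Du.
split; last exact: Du.
split=> // v; have [->//|vv1] := eqVneq v v1; have [->//|vv2] := eqVneq v v2.
have vN : v \notin [:: v1; v2] by rewrite !inE negb_or vv1.
by have := Du (Some (Sub v vN)); rewrite same_cond.
Qed.

Lemma qform_hform_join (u : gpair G) :
  qform (@hform R Gt q Kt) u - qform (@hform R G q K) u =
  complex.Re (cdot (Lam (Kt None) *m @bvec R Gt (u false) None)
                   (@bvec R Gt (u false) None)) -
  (complex.Re (cdot (Lam (K v1) *m bvec (u false) v1) (bvec (u false) v1)) +
   complex.Re (cdot (Lam (K v2) *m bvec (u false) v2) (bvec (u false) v2))).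
Proof.
rewrite /qform /hform !complex_ReD /vertex_form.
rewrite [X in _ + X - _]complex_Re_sum [X in _ - (_ + X)]complex_Re_sum.
rewrite opprD addrACA subrr add0r.
apply: (sum_join
  (F := fun v => complex.Re (cdot (Lam (K v) *m bvec (u false) v) (bvec (u false) v)))
  (Ft := fun v => complex.Re (cdot (Lam (Kt v) *m @bvec R Gt (u false) v)
                                   (@bvec R Gt (u false) v)))) => w.
by rewrite same_cond.
Qed.

(** The Dirichlet conditions make both boundary sums vanish, hence also the sum at the joined
    vertex. On such vectors [Qones] is the identity, so the vertex terms add up exactly, for either
    sign of [C]. *)
Lemma typeIIIa_join C (u : gpair G) :
  typeIIIa (K v1) C -> typeIIIa (K v2) C -> typeIIIa (Kt None) C ->
  form_dom K u -> @form_dom R Gt Kt u /\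
    qform (@hform R Gt q Kt) u <= qform (@hform R G q K) u.
Proof.
move=> [_ [R1 D1 _ L1]] [_ [R2 D2 _ L2]] [_ [R0 D0 _ L0]] Xu; have [_ Du] := Xu.
have s1 : vertex_sum (u false) v1 = 0 by apply: Pones_bvec_eq0; rewrite -D1 Du.
have s2 : vertex_sum (u false) v2 = 0 by apply: Pones_bvec_eq0; rewrite -D2 Du.
have s0 : @vertex_sum R Gt (u false) None = 0 by rewrite vertex_sum_join s1 s2 addr0.
have PD0 : PD (Kt None) *m @bvec R Gt (u false) None = 0.
  by rewrite D0 Pones_bvec s0 mulr0; apply/matrixP => i j; rewrite !mxE.
split; first by have /form_dom_join[] : form_dom K u /\ _ := conj Xu PD0.
rewrite -subr_le0 qform_hform_join L1 L2 L0 R1 R2 R0 !Re_cdot_Qones.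
rewrite /vertex_var s1 s2 s0 vertex_sqnorm_join /sqnorm/= expr0n/= addr0 !mul0r.
by rewrite !subr0 -mulrDr subrr.
Qed.

(** There is no Dirichlet part, so the domains coincide. At the joined vertex [Qones] also sees the
    difference of the two means, whence the nonnegative [d]; its weight 1/D decides the
    direction. *)
Lemma typeIIIb_join D (u : gpair G) :
  typeIIIb (K v1) D -> typeIIIb (K v2) D -> typeIIIb (Kt None) D ->
  (form_dom K u <-> @form_dom R Gt Kt u) /\
  exists2 d : R, 0 <= d &
    qform (@hform R Gt q Kt) u - qform (@hform R G q K) u = D^-1 * d.
Proof.
move=> [_ [R1 D1 _ L1]] [_ [R2 D2 _ L2]] [_ [R0 D0 _ L0]]; split.
  have H := form_dom_join u; rewrite D1 D2 D0 !mul0mx in H.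
  by split=> [Xu|Xu]; [case: (proj1 H) | case: (proj2 H)].
exists (@vertex_var R Gt (u false) None - (vertex_var (u false) v1 + vertex_var (u false) v2)).
  by rewrite subr_ge0 vertex_var_join.
rewrite qform_hform_join L1 L2 L0 R1 R2 R0 !Re_cdot_Qones.
ring.
Qed.

End Join.

Local Close Scope complex_scope.

Theorem theorem4p5 (R : realType) (G : metric_graph R) (v1 v2 : vert G)
    (v12 : v1 != v2) (q : edge G -> R -> R) (q_bounded : potential q)
    (K : forall v : vert G, vertex_cond R (deg v))
    (Kt : forall v : vert (join v12), vertex_cond R (deg v))
    (same_cond : forall w : {w : vert G | w \notin [:: v1; v2]},
        Kt (Some w) = K (val w))
    (lam lamt : nat -> R)
    (lamP : eigenvalue_enum (schroedinger q K) lam)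
    (lamtP : eigenvalue_enum (@schroedinger R (join v12) q Kt) lamt) :
  [/\ forall C : R,
        typeIIIa (K v1) C -> typeIIIa (K v2) C -> typeIIIa (Kt None) C ->
        forall k : nat, lamt k <= lam k,
      forall D : R, 0 < D ->
        typeIIIb (K v1) D -> typeIIIb (K v2) D -> typeIIIb (Kt None) D ->
        forall k : nat, lam k <= lamt k
    & forall D : R, D < 0 ->
        typeIIIb (K v1) D -> typeIIIb (K v2) D -> typeIIIb (Kt None) D ->
        forall k : nat, lamt k <= lam k].
Proof.
(* [q] matters only almost everywhere; from here on the forms use the bounded [q']. *)
have [q' [bq' qq']] := potential_truncation q_bounded.
(* [join] keeps edges and lengths, so the facts about [q'] apply to the joined graph as they
   stand. *)
have [le_lam le_lamt] := (eigenvalue_le bq' qq' lamP,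
  @eigenvalue_le R (join v12) q q' Kt bq' qq' lamt lamtP).
have [famK famKt] := (eigen_test_family bq' qq' lamP,
  @eigen_test_family R (join v12) q q' Kt bq' qq' lamt lamtP).
have linK := lin_closed_form_dom K.
have linKt := @lin_closed_form_dom R (join v12) Kt.
split=> [C K1 K2 K0 k|D D0 K1 K2 K0 k|D D0 K1 K2 K0 k].
- apply: le_lamt; apply: (test_family_transfer linK _ (famK k)) => u Xu.
  exact: (typeIIIa_join q' same_cond K1 K2 K0 Xu).
(* For D > 0 the joined form is the larger one, so families are transferred back from [Kt] to
   [K]. *)
- apply: le_lam; apply: (test_family_transfer linKt _ (famKt k)) => u Xu.
  have [dom [d d0 hd]] := typeIIIb_join q' same_cond u K1 K2 K0.
  split; first exact/dom.
  by rewrite -subr_ge0 [X in 0 <= X]hd mulr_ge0// invr_ge0 ltW.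
- apply: le_lamt; apply: (test_family_transfer linK _ (famK k)) => u Xu.
  have [dom [d d0 hd]] := typeIIIb_join q' same_cond u K1 K2 K0.
  split; first exact/dom.
  by rewrite -subr_le0 [X in X <= 0]hd mulr_le0_ge0// invr_le0 ltW.
Qed.
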